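(* Let $I=[0,\infty)$, let $X$ be a Banach r.i. space on $I$, and let $w$ be a weight (nondecreasing if $q=\infty$). Suppose that $\Lambda(w,q)$ is a Banach space, meaning that $w$ satisfies condition $(AM_q)$ if $1\le q<\infty$, and condition $(A_1)$ if $q=\infty$. Then: (i) For $1\le q<\infty$, $\Lambda(w,q)\in\mathcal{LI}(\Lambda(X),M^*(X);L^\infty)$ if and only if there is a constant $B>0$ such that $$\int_t^\infty\frac{w(x)}{\phi_X(x)^q}\,dx\le\frac{B}{\phi_X(t)^q}\int_0^t w(x)\,dx\qquad\text{for all }t>0.$$ (ii) $\Lambda(w,\infty)\in\mathcal{LI}(\Lambda(X),M^*(X);L^\infty)$ if and only if there is a constant $C>0$ such that $$\int_0^t\frac{d\phi_X(x)}{w(x)}\le C\,\frac{\phi_X(t)}{w(t)}\qquad\text{for all }t>0.$$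
   Context: All functions are real-valued Lebesgue measurable on $I$; $f^*$ is the nonincreasing rearrangement of $f$. A Banach r.i. (rearrangement invariant) space on $I$ is a Banach space $(X,\|\cdot\|)$ of locally integrable functions on $I$ such that: (i) $|g|\le|f|$ a.e., $f\in X$ imply $g\in X$, $\|g\|\le\|f\|$; (ii) (Fatou) $0\le f_n\uparrow$, $\sup_n\|f_n\|<\infty$ imply $f=\sup f_n\in X$ and $\|f\|=\sup_n\|f_n\|$; (iii) $X$ contains the simple integrable functions; (iv) $f\in X\iff f^*\in X$, and $\|f\|=\|f^*\|$. A quasi-Banach r.i. space is a complete quasi-normed space of measurable functions satisfying (i)-(iv) (local integrability not required). The fundamental function of $X$ is $\phi_X(t)=\|\chi_{[0,t]}\|_X$; for Banach r.i. $X$ it is assumed (without loss of generality, up to equivalent renorming) positive for $t>0$, nondecreasing, concave and absolutely continuous away from the origin, with $\phi_X(0)=0$. $\Lambda(X)$ is the space of $f$ with $\|f\|_{\Lambda(X)}=\int_I f^*(t)\,d\phi_X(t)<\infty$ (Stieltjes integral, a jump of $\phi_X$ at $0$ being counted). $M^*(X)$ is the space of $f$ with $\|f\|_{M^*(X)}=\sup_{t\in I}\phi_X(t)f^*(t)<\infty$. A weight $w$ is an a.e. positive function on $[0,\infty)$ with $\int_0^t w<\infty$ for all $t<\infty$ and $\int_0^\infty w=\infty$. The classical Lorentz space $\Lambda(w,q)$ consists of all $f$ with $\|f\|_{\Lambda(w,q)}<\infty$, where $\|f\|_{\Lambda(w,q)}=\left(\int_0^\infty f^*(t)^q w(t)\,dt\right)^{1/q}$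 for $0<q<\infty$ and $\|f\|_{\Lambda(w,\infty)}=\sup_{t>0}f^*(t)w(t)$; for $q=\infty$ only nondecreasing $w$ are considered. Condition $(AM_q)$: there is $B>0$ with $\int_t^\infty\frac{w(x)}{x^q}dx\le\frac{B}{t^q}\int_0^t w(x)\,dx$ for all $t>0$. Condition $(A_1)$: there is $C>0$ with $\frac{w(t)}{t}\int_0^t\frac{dx}{w(x)}\le C$ for all $t>0$. For quasi-Banach r.i. spaces $A_0,A_1$, a couple $(X_0,X_1)$ of quasi-Banach r.i. spaces with $A_i\cap L^\infty\hookrightarrow X_i\hookrightarrow A_i+L^\infty$ (continuous embeddings, $i=0,1$) belongs to $\mathcal{LI}(A_0,A_1;L^\infty)$ if every linear operator $T:A_0+L^\infty\to A_1+L^\infty$ bounded from $A_0$ into $A_1$ and from $L^\infty$ into $L^\infty$ is also bounded from $X_0$ into $X_1$. For a single space $Y$, $Y\in\mathcal{LI}(A_0,A_1;L^\infty)$ means $(Y,Y)\in\mathcal{LI}(A_0,A_1;L^\infty)$ (embedding requirement included). *)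

(* Defs.v *)
From HB Require Import structures.
From mathcomp Require Import all_boot all_order all_algebra.
From mathcomp Require Import all_classical all_reals all_analysis.

Set Implicit Arguments.
Unset Strict Implicit.
Unset Printing Implicit Defensive.

Import Order.TTheory GRing.Theory Num.Theory.
Import numFieldNormedType.Exports.

Local Open Scope classical_set_scope.
Local Open Scope ring_scope.

(* The real line with the sigma-algebra of Lebesgue measurable sets, as opposed
   to the Borel sets carried by [R] itself. *)
Notation lebesgueType R :=
  (caratheodory_type (mu_ext (@wlength R idfun))).

Notation leb := completed_lebesgue_measure.

Section function_spaces.
Context {R : realType}.
Implicit Types (f g : R -> R) (N M : (R -> R) -> \bar R) (w phi : R -> R).

Definition halfline : set R := `[0, +oo[.

Local Notation I := halfline.

(* Functions on I are functions on R whose values outside I are never used;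
   functions that agree a.e. on I are identified. *)
Definition lmeasurable f :=
  measurable_fun (I : set (lebesgueType R)) (f : lebesgueType R -> R).

Definition aeI (P : R -> Prop) :=
  {ae (@leb R), forall x, I x -> P x}.

Definition aeI_eq f g := aeI (fun x => f x = g x).

(* A space is given by its (quasi-)norm, extended by the value +oo. *)
Definition in_space N f := lmeasurable f /\ (N f < +oo)%E.

Definition rearr f (t : R) : \bar R :=
  ereal_inf [set s%:E | s in
    [set s : R | 0 <= s /\
       (leb [set x | I x /\ (s < `|f x|)%R] <= t%:E)%E]].

Definition quasi_norm_with (K : R) N :=
  [/\ forall f, in_space N f -> (0 <= N f)%E,
      forall f, lmeasurable f -> (N f = 0 <-> aeI_eq f (cst 0)),
      forall (a : R) f, in_space N f ->
        N (fun x => a * f x) = (`|a|%:E * N f)%E &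
      forall f g, in_space N f -> in_space N g ->
        (N (fun x => (f x + g x)%R) <= K%:E * (N f + N g))%E].

Definition complete_space N :=
  forall u : nat -> R -> R, (forall n, in_space N (u n)) ->
    (forall e : R, 0 < e -> exists n0 : nat, forall m n : nat,
       (n0 <= m)%N -> (n0 <= n)%N ->
       (N (fun x => (u m x - u n x)%R) < e%:E)%E) ->
    exists2 f, in_space N f &
      (fun n => N (fun x => u n x - f x)) @ \oo --> 0%E.

Definition ideal_property N :=
  forall f g, in_space N f -> lmeasurable g ->
    aeI (fun x => `|g x| <= `|f x|) -> in_space N g /\ (N g <= N f)%E.

Definition fatou_property N :=
  forall u : nat -> R -> R, (forall n, in_space N (u n)) ->
    (forall n, aeI (fun x => 0 <= u n x <= u n.+1 x)) ->
    (ereal_sup (range (fun n => N (u n))) < +oo)%E ->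
    exists f, [/\ in_space N f,
      aeI (fun x => (f x)%:E = ereal_sup (range (fun n => (u n x)%:E))) &
      N f = ereal_sup (range (fun n => N (u n)))].

Definition contains_simple N :=
  forall f, lmeasurable f -> finite_set (f @` I) ->
    (@leb R).-integrable I (EFin \o f) ->
    in_space N f.

(* [rearr f] may be infinite at 0, where its value is immaterial. *)
Definition rearrangement_invariant N :=
  (forall f, lmeasurable f ->
     (in_space N f <->
      (forall t : R, 0 < t -> (rearr f t < +oo)%E) /\
      in_space N (fine \o rearr f))) /\
  (forall f, in_space N f -> N f = N (fine \o rearr f)).

Definition ri_axioms N :=
  [/\ ideal_property N, fatou_property N, contains_simple N &
      rearrangement_invariant N].

Definition quasi_banach_ri N :=
  [/\ exists2 K : R, 1 <= K & quasi_norm_with K N,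
      complete_space N & ri_axioms N].

Definition locally_integrableI f :=
  forall t : R,
    (@leb R).-integrable `[0, t] (EFin \o f).

Definition banach_ri N :=
  [/\ quasi_norm_with 1 N, complete_space N, ri_axioms N &
      forall f, in_space N f -> locally_integrableI f].

Definition fundamental N (t : R) : R := fine (N (\1_(`[0, t] : set R))).

Definition abs_continuous_on (a b : R) phi :=
  forall e : R, 0 < e -> exists2 d : R, 0 < d &
    forall (n : nat) (u v : nat -> R),
      (forall i, (i < n)%N -> [/\ a <= u i, u i <= v i & v i <= b]) ->
      trivIset [set i : nat | (i < n)%N] (fun i => `]u i, v i[%classic) ->
      \sum_(i < n) (v i - u i) < d ->
      \sum_(i < n) `|phi (v i) - phi (u i)| < e.

(* The usual normalization of a fundamental function; a jump at 0 is allowed. *)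
Definition normalized_fundamental phi :=
  [/\ phi 0 = 0,
      forall t, 0 < t -> 0 < phi t,
      {in I &, {homo phi : s t / s <= t}},
      {in I &, forall s t : R, forall l : R, 0 <= l <= 1 ->
         l * phi s + (1 - l) * phi t <= phi (l * s + (1 - l) * t)} &
      forall a b, 0 < a -> a <= b -> abs_continuous_on a b phi].

(* For phi nonnegative and nondecreasing on I with phi 0 = 0, this is the
   right-continuous function x |-> phi (x+) on I, extended by 0 to the negative
   reals, so that its Stieltjes measure is dphi with mass phi (0+) at 0. The
   absolute value only serves to bound the infimum for arbitrary phi. *)
Definition right_limit_fun phi (x : R) : R :=
  if x < 0 then 0 else inf [set `|phi y| | y in `]x, +oo[].

Lemma right_limit_fun_itvN phi (x : R) :
  [set `|phi y| | y in `]x, +oo[] !=set0.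
Proof.
exists `|phi (x + 1)|; exists (x + 1) => //=.
by rewrite in_itv/= andbT ltrDl.
Qed.

Lemma right_limit_fun_lb phi (x : R) :
  has_lbound [set `|phi y| | y in `]x, +oo[].
Proof. by exists 0 => _ [y _ <-]. Qed.

Lemma right_limit_fun_nondecreasing phi :
  {homo right_limit_fun phi : x y / x <= y}.
Proof.
move=> x y xy; rewrite /right_limit_fun.
have inf0 z : 0 <= inf [set `|phi y| | y in `]z, +oo[].
  by apply: lb_le_inf; [exact: right_limit_fun_itvN|move=> _ [? _ <-]].
case: ltP => x0; first by case: ltP.
rewrite ltNge (le_trans x0 xy)/=.
apply: lb_le_inf; first exact: right_limit_fun_itvN.
move=> _ [z /= yz <-]; apply: ge_inf; first exact: right_limit_fun_lb.
exists z => //=; move: yz; rewrite !in_itv/= !andbT.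
exact: le_lt_trans.
Qed.

Lemma right_limit_fun_right_continuous phi :
  right_continuous (right_limit_fun phi).
Proof.
move=> x; apply/cvgrPdist_le => e e0.
have nd := right_limit_fun_nondecreasing phi.
have [x0|x0] := ltP x 0.
  near=> y; have y0 : y < 0 by near: y; exact: nbhs_right_lt.
  by rewrite /right_limit_fun x0 y0 subrr normr0 ltW.
have [_ [z /= xz <-] zle] := inf_adherent e0
  (conj (right_limit_fun_itvN phi x) (right_limit_fun_lb phi x)).
near=> y.
have xy : x < y by near: y; exact: nbhs_right_gt.
have yz : y < z.
  by near: y; apply: nbhs_right_lt; move: xz; rewrite in_itv/= andbT.
rewrite distrC ger0_norm ?subr_ge0; last exact/nd/ltW.
rewrite lerBlDl [leRHS](_ : _ =
  inf [set `|phi y| | y in `]x, +oo[] + e); last first.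
  by rewrite /right_limit_fun ltNge x0.
apply: le_trans (ltW zle).
rewrite /right_limit_fun ltNge (le_trans x0 (ltW xy))/=.
apply: ge_inf; first exact: right_limit_fun_lb.
by exists z => //=; rewrite in_itv/= yz.
Unshelve. all: by end_near. Qed.

HB.instance Definition _ phi :=
  isCumulative.Build R _ R (right_limit_fun phi)
    (@right_limit_fun_nondecreasing phi)
    (@right_limit_fun_right_continuous phi).

Definition stieltjes phi : {measure set (measurableTypeR R) -> \bar R} :=
  lebesgue_stieltjes_measure (right_limit_fun phi).

Definition Lambda N f : \bar R :=
  (\int[stieltjes (fundamental N)]_(t in I) rearr f t)%E.

Definition Mstar N f : \bar R :=
  ereal_sup [set ((fundamental N t)%:E * rearr f t)%E | t in I].

Definition weight w :=
  [/\ lmeasurable w, aeI (fun x => 0 < w x),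
      forall t : R,
        (\int[leb]_(x in `[0%R, t]) (w x)%:E < +oo)%E &
      (\int[leb]_(x in I) (w x)%:E = +oo)%E].

(* The second index ranges over the positive reals and +oo; the value at -oo is
   a dummy. *)
Definition lorentz w (q : \bar R) f : \bar R :=
  match q with
  | q%:E => poweR
      (\int[leb]_(t in I)
         (poweR (rearr f t) q * (w t)%:E)%E) q^-1
  | +oo%E => ereal_sup [set (rearr f t * (w t)%:E)%E | t in `]0, +oo[]
  | -oo%E => +oo%E
  end.

Definition AM (q : R) w :=
  exists2 B : R, 0 < B & forall t : R, 0 < t ->
    (\int[leb]_(x in `[t, +oo[) (w x / x `^ q)%:E <=
     (B / t `^ q)%:E *
     \int[leb]_(x in `[0%R, t]) (w x)%:E)%E.

Definition A1 w :=
  exists2 C : R, 0 < C & forall t : R, 0 < t ->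
    ((w t / t)%:E *
     \int[leb]_(x in `[0%R, t]) ((w x)^-1)%:E
     <= C%:E)%E.

(* A weight carries no information at the point 0, which dphi may charge; for a
   nondecreasing weight its value there is read as the limit w (0+). *)
Definition weight_at w (x : R) : R :=
  if x == 0 then inf [set w y | y in `]0, +oo[] else w x.

Definition Linfty f : \bar R :=
  Lnorm (@leb R) +oo%E (fun x : lebesgueType R => ((f \_ I) x)%:E).

Definition cap_Linfty N f : \bar R := maxe (N f) (Linfty f).

Definition sum_Linfty N f : \bar R :=
  ereal_inf [set s | exists g h,
    [/\ in_space N g, in_space Linfty h, aeI_eq f (fun x => g x + h x) &
        s = (N g + Linfty h)%E]].

Definition bounded_op N M (T : (R -> R) -> (R -> R)) :=
  exists2 C : R, 0 < C &
    forall f, in_space N f -> in_space M (T f) /\ (M (T f) <= C%:E * N f)%E.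

Definition embeds N M := bounded_op N M id.

Definition linear_op N M (T : (R -> R) -> (R -> R)) :=
  [/\ forall f, in_space N f -> in_space M (T f),
      forall f g, in_space N f -> in_space N g ->
        aeI_eq f g -> aeI_eq (T f) (T g) &
      forall (a : R) f g, in_space N f -> in_space N g ->
        aeI_eq (T (fun x => a * f x + g x)) (fun x => a * T f x + T g x)].

Definition LI (A0 A1 X0 X1 : (R -> R) -> \bar R) :=
  [/\ quasi_banach_ri X0 /\ quasi_banach_ri X1,
      embeds (cap_Linfty A0) X0 /\ embeds X0 (sum_Linfty A0),
      embeds (cap_Linfty A1) X1 /\ embeds X1 (sum_Linfty A1) &
      forall T, linear_op (sum_Linfty A0) (sum_Linfty A1) T ->
        bounded_op A0 A1 T -> bounded_op Linfty Linfty T ->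
        bounded_op X0 X1 T].

End function_spaces.

(* Main.v *)
Require Import Defs.
From mathcomp Require Import all_boot all_order all_algebra.
From mathcomp Require Import all_classical all_reals all_analysis.
From mathcomp Require Import measurable_realfun ess_sup_inf.
From mathcomp Require Import ring lra.
Set Implicit Arguments.
Unset Strict Implicit.
Unset Printing Implicit Defensive.
Import Order.TTheory GRing.Theory Num.Theory.
Import numFieldNormedType.Exports.
Local Open Scope classical_set_scope.
Local Open Scope ring_scope.

(* If [T] is bounded from [Lambda(X)] to [M^*(X)] and on [L^oo], truncating [f]
   at the level [f^*(t)] gives
     [phi(t) (T f)^*(t) <= C int_[0,t] f^* dphi],
   so the space is in LI as soon as the Hardy-type operator sending [f^*] to
   [(1 / phi(t)) int_[0,t] f^* dphi] is bounded on it. For q = oo this follows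
   from [f^* <= ||f|| / w]. For q < oo, with [W(t) = int_0^t w], the weight
   condition forces [phi(0+) = 0], [phi] unbounded, and
     [W(phi^-1(2^k phi(r))) <= C theta^k 2^(k q) W(r)] for some [theta < 1];
   cutting [0, t] into the shells where [phi] halves then bounds the Hardy
   operator by a convergent geometric series of dilations.

   Conversely, [d(x) = (phi(2 x) - phi(x)) / x] is nonincreasing and
     [(phi(2 a) - phi(0+)) / 2 <= int_0^a d <= phi(a) - phi(0+)],
   so [T f(t) = (1 / phi(t)) int_0^t f d] is an admissible operator. Testing it
   on the indicator of [0, r] for q < oo, and on [1 / w] for q = oo, gives the
   weight condition; the atom of [dphi] at 0 is handled by the embeddings. *)

(** Membership in [LI] includes that the Lorentz space is quasi-Banach r.i. This is proved once for
    every norm [J (rearr f)] with [ri_functional J]; completeness follows from the ideal and Fatou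
    properties. [AM] or [A1] enters through doubling of [W] or [w], which gives the quasi-triangle
    inequality.

    The gain [theta] comes from the tail [V(t) = int_t^oo w / phi^q]. The weight condition says
    [V <= B W / phi^q]. When [phi] doubles, [V] drops by at least the increment of [W] over the new
    [phi^q], so [V + W / phi^q] contracts by a fixed factor. One factor [sqrt theta] of this gain
    makes the sum over the shells converge, the other the sum of the dilations.

    [d] stands in for [phi']: a difference quotient is defined and monotone at every point, and its
    integrals over dyadic shells telescope, at the price of factors 2.

    Integrals against [dphi] and against Lebesgue measure are compared on superlevel sets. For a
    monotone integrand these are intervals starting at 0, where both measures are explicit. *)

(** * Layer-cake formula and comparison of integrals *)

Section layer_cake.
Context d {T : measurableType d} {R : realType}.
Variable m : {sigma_finite_measure set T -> \bar R}.
Variables (D : set T) (h v : T -> \bar R).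
Hypotheses (mD : measurable D) (mh : measurable_fun D h)
  (mv : measurable_fun D v).
Hypotheses (h0 : forall x, D x -> (0 <= h x)%E)
  (v0 : forall x, D x -> (0 <= v x)%E).
Local Open Scope ereal_scope.

Let GR := measurableTypeR R.
(** The region under the graph of [h], in the product with the height axis; [layer_cake] is
    Tonelli's theorem for [v] on this region. *)
Let A : set (T * GR) := [set p | (0 <= p.2)%R /\ p.2%:E < (h \_ D) p.1].
Let F (p : T * GR) : \bar R := (v \_ D) p.1 * (\1_A p)%:E.

Let mA : measurable A.
Proof.
have -> : A = [set p | (0 <= p.2)%R] `&` [set p | p.2%:E < (h \_ D) p.1].
  by apply/seteqP; split => p [].
apply: measurableI.
  rewrite -[X in measurable X]setTI.
  have -> : [set p : T * GR | (0 <= p.2)%R] = snd @^-1` `[0%R, +oo[%classic.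
    by apply/seteqP; split => p /=; rewrite in_itv/= andbT.
  exact: measurable_snd.
rewrite -[X in measurable X]setTI.
apply: measurable_lte => //.
  by apply/measurable_EFinP; exact: measurable_snd.
apply: (measurableT_comp (f := h \_ D)); last exact: measurable_fst.
by apply/(measurable_restrictT h).
Qed.

Let mF : measurable_fun setT F.
Proof.
apply: emeasurable_funM.
  apply: (measurableT_comp (f := v \_ D)); last exact: measurable_fst.
  by apply/(measurable_restrictT v).
by apply/measurable_EFinP; exact: measurable_indic.
Qed.

Let F0 p : 0 <= F p.
Proof.
rewrite /F mule_ge0 ?lee_fin//.
by rewrite patchE; case: ifPn => //; rewrite inE => /v0.
Qed.

Let inner s : (0 <= s)%R -> \int[m]_x F (x, s) =
  \int[m]_(x in D `&` [set x | s%:E < h x]) v x.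
Proof.
move=> s0; rewrite [RHS]integral_mkcond; apply: eq_integral => x _.
rewrite /F /= /patch indicE [in RHS]in_setI.
have [xD|xD] := boolP (x \in D); last by rewrite mul0e.
rewrite /=; case: ifPn => [|].
  rewrite inE/= => sh; rewrite mem_set ?mule1// /A/=; split => //.
  by rewrite /patch xD.
rewrite notin_setE/= => sh; rewrite memNset ?mule0// /A/= => -[_].
by rewrite /patch xD.
Qed.

Let innerN s : (s < 0)%R -> \int[m]_x F (x, s) = 0.
Proof.
move=> s0; apply: integral0_eq => x _.
rewrite /F indicE memNset ?mule0// /A/= => -[]; rewrite leNgt.
by move: s0; rewrite /GR => ->.
Qed.

Lemma measurable_layer : measurable_fun (`[0%R, +oo[%classic : set GR)
  (fun s : GR => \int[m]_(x in D `&` [set x | s%:E < h x]) v x).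
Proof.
apply: (@eq_measurable_fun _ _ _ _ _ (fun s : GR => \int[m]_x F (x, s))).
  by move=> s; rewrite inE/= in_itv/= andbT => s0; rewrite inner.
by apply: measurable_funTS; exact: measurable_fun_fubini_tonelli_G.
Qed.

Lemma layer_cake : \int[m]_(x in D) (h x * v x) =
  \int[lebesgue_measure]_(s in `[0%R, +oo[)
     \int[m]_(x in D `&` [set x | s%:E < h x]) v x.
Proof.
transitivity (\int[m]_x \int[@lebesgue_measure R]_s F (x, s)); last first.
  rewrite fubini_tonelli//= [RHS]integral_mkcond.
  apply: eq_integral => s _; rewrite patchE.
  case: ifPn; first by rewrite inE/= in_itv/= andbT => ?; rewrite inner.
  rewrite notin_setE/= in_itv/= andbT => /negP; rewrite -ltNge => ?.
  by rewrite innerN.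
rewrite integral_mkcond; apply: eq_integral => x _; rewrite patchE /F/=.
case: ifPn => xD; last first.
  rewrite patchE (negbTE xD) [RHS]integral0_eq//.
  by move=> s _; rewrite mul0e.
have Dx : D x by rewrite inE in xD.
pose B := [set s : GR | A (x, s)].
have mAx : measurable B.
  have := measurable_xsection x mA.
  by rewrite (_ : xsection A x = [set s : GR | A (x, s)])//;
    apply/seteqP; split => s; rewrite /xsection/= inE.
rewrite patchE xD.
have -> : (fun s : GR => v x * (\1_A (x, s))%:E) =
    (fun s => v x * (\1_B s)%:E).
  by apply/funext => s; rewrite !indicE; congr (_ * (nat_of_bool _)%:R%:E);
    apply/idP/idP; rewrite !inE.
rewrite ge0_integralZl//; last 2 first.
- by apply/measurable_EFinP; exact: measurable_indic.
- exact: v0.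
rewrite muleC; congr (_ * _).
rewrite integral_indic//.
  rewrite setIT.
  have := h0 Dx; case hx : (h x) => [r| |] // r0.
  - rewrite (_ : B = `[0%R, r[%classic); last first.
      apply/seteqP; split => s; rewrite /B/A/= /patch xD hx in_itv/= lte_fin.
        by move=> [-> ->].
      by move=> /andP[].
    rewrite /= lebesgue_measure_itv/= lte_fin; case: ltP => [r0'|].
      by rewrite sube0.
    by move: r0; rewrite lee_fin => ? ?; congr EFin; apply/eqP; rewrite eq_le; apply/andP.
  - rewrite (_ : B = `[0%R, +oo[%classic); last first.
      apply/seteqP; split => s; rewrite /B/A/= /patch xD hx in_itv/= andbT ltry.
        by move=> [].
      by [].
    by rewrite /= lebesgue_measure_itv/= ltry.
Qed.

End layer_cake.

(** Compares integrals over two unrelated measure spaces by comparing superlevel sets height by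
    height. It serves for dilations, for Lebesgue measure against [dphi], and for [dphi] against
    Lebesgue measure. *)
Lemma le_integral_layer d1 (T1 : measurableType d1) d2 (T2 : measurableType d2)
    (R : realType) (m1 : {sigma_finite_measure set T1 -> \bar R})
    (m2 : {sigma_finite_measure set T2 -> \bar R})
    (D1 : set T1) (D2 : set T2) (h1 v1 : T1 -> \bar R) (h2 v2 : T2 -> \bar R)
    (C : R) :
  measurable D1 -> measurable_fun D1 h1 -> measurable_fun D1 v1 ->
  (forall x, D1 x -> 0 <= h1 x)%E -> (forall x, D1 x -> 0 <= v1 x)%E ->
  measurable D2 -> measurable_fun D2 h2 -> measurable_fun D2 v2 ->
  (forall x, D2 x -> 0 <= h2 x)%E -> (forall x, D2 x -> 0 <= v2 x)%E ->
  0 <= C ->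
  (forall s : R, (0 <= s)%R ->
     (\int[m1]_(x in D1 `&` [set x | s%:E < h1 x]) v1 x <=
      C%:E * \int[m2]_(x in D2 `&` [set x | s%:E < h2 x]) v2 x))%E ->
  (\int[m1]_(x in D1) (h1 x * v1 x) <=
   C%:E * \int[m2]_(x in D2) (h2 x * v2 x))%E.
Proof.
move=> mD1 mh1 mv1 h10 v10 mD2 mh2 mv2 h20 v20 C0 le12.
rewrite !layer_cake// -ge0_integralZl//.
- apply: ge0_le_integral => //.
  + by move=> s _; apply: integral_ge0 => x [Dx _]; exact: v10.
  + exact: measurable_layer.
  + by apply: measurable_funeM; exact: measurable_layer.
  + by move=> s; rewrite /= in_itv/= andbT => s0; exact: le12.
- exact: measurable_layer.
- by move=> s _; apply: integral_ge0 => x [Dx _]; exact: v20.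
Qed.

(** * Lebesgue measure on the half-line, distribution function and rearrangement *)

Section lebesgue.
Context {R : realType}.
Implicit Types (f g : R -> R) (s t : R) (A B D : set R).
Local Notation I := (@halfline R).
Local Notation mu := (@leb R).
Local Notation LR := (lebesgueType R).
Local Notation GR := (measurableTypeR R).

Lemma borel_lebesgue A : measurable (A : set GR) -> measurable (A : set LR).
Proof. by move=> mA; apply: sub_caratheodory. Qed.

Lemma lebesgue_itv (i : interval R) : measurable ([set` i] : set LR).
Proof. exact: borel_lebesgue. Qed.

Lemma leb_itv (i : interval R) :
  mu [set` i] = (if i.1 < i.2 then (i.2 : \bar R) - i.1 else 0)%E.
Proof. exact: lebesgue_measure_itv. Qed.

Lemma leb_set1 (x : R) : mu [set x] = 0%E.
Proof. exact: lebesgue_measure_set1. Qed.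

Lemma halflineE x : I x = (0 <= x).
Proof. by rewrite /halfline/= in_itv/= andbT. Qed.

Lemma mI : measurable (I : set LR).
Proof. exact: lebesgue_itv. Qed.

Lemma borel_fun_lebesgue d (U : measurableType d) D (h : R -> U) :
  measurable (D : set GR) -> measurable_fun (D : set GR) h ->
  measurable_fun (D : set LR) h.
Proof. by move=> mD mh _ B mB; apply: borel_lebesgue; exact: mh. Qed.

(** Superlevel sets of an antitone function on an interval are intervals. *)
Lemma measurable_antitone D (h : R -> \bar R) : is_interval D ->
  (forall x y, D x -> D y -> x <= y -> (h y <= h x)%E) ->
  measurable_fun (D : set GR) h.
Proof.
move=> iD hh; apply: (measurability _ (ErealGenOInfty.measurableE R)) => //.
move=> _ [_ [x ->] <-]; apply: is_interval_measurable => a b [Da ha] [Db hb] u.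
move=> /andP[au ub]; have Du : D u by apply: (iD a b) => //; apply/andP.
split => //; move: hb; rewrite /= !in_itv/= !andbT => /lt_le_trans; apply.
exact: hh.
Qed.

Lemma measurable_antitone_leb D (h : R -> \bar R) : is_interval D ->
  (forall x y, D x -> D y -> x <= y -> (h y <= h x)%E) ->
  measurable_fun (D : set LR) h.
Proof.
move=> iD hh; apply: borel_fun_lebesgue; last exact: measurable_antitone.
exact: is_interval_measurable.
Qed.

Global Instance ae_leb_filter : Filter (nbhs (almost_everywhere (@leb R))).
Proof. exact: ae_filter_ringOfSetsType. Qed.

Lemma aeI_mono (P Q : R -> Prop) :
  aeI P -> (forall x, I x -> P x -> Q x) -> aeI Q.
Proof.
rewrite /aeI => aP PQ; apply: filterS aP => x h Ix; apply: PQ => //; exact: h.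
Qed.

Lemma aeI_mono2 (P Q S : R -> Prop) : aeI P -> aeI Q ->
  (forall x, I x -> P x -> Q x -> S x) -> aeI S.
Proof.
rewrite /aeI => aP aQ PQ; apply: filterS2 aP aQ => x h k Ix.
by apply: PQ => //; [exact: h|exact: k].
Qed.

Lemma aeI_forall (P : nat -> R -> Prop) :
  (forall n, aeI (P n)) -> aeI (fun x => forall n, P n x).
Proof.
move=> aP; have /ae_foralln := aP.
by apply: filterS => x h Ix n; exact: h.
Qed.

Lemma aeIW (P : R -> Prop) : (forall x, I x -> P x) -> aeI P.
Proof. by move=> h; apply: aeW => x /=; exact: h. Qed.

Lemma leb_le_ae A B : measurable (A : set LR) -> measurable (B : set LR) ->
  A `<=` I -> aeI (fun x => A x -> B x) -> (mu A <= mu B)%E.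
Proof.
move=> mA mB AI [N [mN N0 sub]].
have -> : mu B = mu (B `|` N).
  rewrite measureU0//; exact: mB.
apply: le_measure; rewrite ?inE//; first exact: measurableU.
move=> x Ax; have [Bx|nBx] := pselect (B x); [by left|right].
apply: sub => /= h; apply: nBx; apply: h => //; exact: AI.
Qed.

Lemma lmeasurable_norm f : lmeasurable f ->
  measurable_fun (I : set LR) (fun x => `|f x|).
Proof. by move=> mf; exact: measurableT_comp. Qed.

Definition level f s : set R := [set x | I x /\ s < `|f x|].

Definition distr f s : \bar R := mu (level f s).

Lemma measurable_level f s : lmeasurable f ->
  measurable (level f s : set LR).
Proof.
move=> mf; have := lmeasurable_norm mf mI (measurable_itv `]s, +oo[).
rewrite (_ : _ `&` _ = level f s)//.
by apply/seteqP; split => x [Ix] /=; rewrite in_itv/= andbT.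
Qed.

Lemma le_distr f s t : lmeasurable f -> s <= t -> (distr f t <= distr f s)%E.
Proof.
move=> mf st; apply: le_measure; rewrite ?inE; [exact: measurable_level..|].
by move=> x [Ix p]; split => //; exact: le_lt_trans p.
Qed.

(** The duality between [rearr] and [distr] through which all rearrangement estimates are reduced to
    measures of level sets. The strict form is what makes it an equivalence. *)
Lemma rearr_gt f s t : lmeasurable f -> 0 <= s ->
  (s%:E < rearr f t)%E = (t%:E < distr f s)%E.
Proof.
move=> mf s0; apply/idP/idP.
  rewrite !ltNge; apply: contra => h; apply: ereal_inf_lbound.
  by exists s.
move=> ts.
(* The infimum defining [rearr] could equal [s]. Continuity from below gives a level slightly above
   [s] whose level set still has measure greater than [t]. *)
pose F n := level f (s + n.+1%:R^-1).
have ndF : nondecreasing_seq F.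
  move=> m n mn; apply/subsetPset => x [Ix p]; split => //; apply: le_lt_trans p.
  by rewrite lerD2l lef_pV2 ?posrE// ler_nat.
have UF : \bigcup_n F n = level f s.
  apply/seteqP; split => x.
    by move=> [n _ [Ix p]]; split => //; apply: le_lt_trans p; rewrite lerDl.
  move=> [Ix sx]; have /ltr_add_invr[n hn] := sx.
  by exists n => //; split.
have cvgF : mu \o F @ \oo --> distr f s.
  rewrite /distr -UF; apply: nondecreasing_cvg_mu => //.
    by move=> n; exact: measurable_level.
  by rewrite UF; exact: measurable_level.
have [n tn] : exists n, (t%:E < mu (F n))%E.
  apply: contrapT => /forallNP h.
  have : (distr f s <= t%:E)%E.
    rewrite -(cvg_lim _ cvgF)//; apply: lime_le; first by apply/cvg_ex; exists (distr f s).
    by apply: nearW => n /=; rewrite leNgt; apply/negP/h.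
  by rewrite leNgt ts.
apply: (@lt_le_trans _ _ (s + n.+1%:R^-1)%:E); first by rewrite lte_fin ltrDl.
apply: le_ereal_inf_tmp => _ [u [u0 ut] <-]; rewrite lee_fin leNgt; apply/negP => us.
move: tn; rewrite ltNge => /negP; apply; apply: le_trans ut.
by apply: le_distr => //; exact: ltW.
Qed.

Lemma rearr_ge0 f t : (0 <= rearr f t)%E.
Proof. by apply: le_ereal_inf_tmp => _ [u [u0 _] <-]; rewrite lee_fin. Qed.

Lemma le_rearr f s t : s <= t -> (rearr f t <= rearr f s)%E.
Proof.
move=> st; apply: ereal_inf_le_tmp => _ [u [u0 us] <-]; exists u => //.
by split => //; apply: le_trans us _; rewrite lee_fin.
Qed.

Lemma measurable_rearr f : measurable_fun (I : set GR) (rearr f).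
Proof.
apply: measurable_antitone; first exact: interval_is_interval.
by move=> x y _ _; exact: le_rearr.
Qed.

Lemma measurable_rearr_leb f : measurable_fun (I : set LR) (rearr f).
Proof.
by apply: borel_fun_lebesgue; [exact: measurable_itv|exact: measurable_rearr].
Qed.

Lemma lee_distr (x y : \bar R) : (0 <= x)%E ->
  (forall s, 0 <= s -> (s%:E < x)%E -> (s%:E < y)%E) -> (0 <= y)%E -> (x <= y)%E.
Proof.
move=> x0 h y0; rewrite leNgt; apply/negP => yx.
case: y y0 h yx => [y| |] //; rewrite ?lee_fin => y0 h yx.
- by have := h _ y0 yx; rewrite ltxx.
- by move: yx; rewrite ltNge leey.
Qed.

Lemma rearr_le f g t t' : lmeasurable f -> lmeasurable g ->
  (forall s, 0 <= s -> (t%:E < distr f s)%E -> (t'%:E < distr g s)%E) ->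
  (rearr f t <= rearr g t')%E.
Proof.
move=> mf mg h; apply: lee_distr; [exact: rearr_ge0| |exact: rearr_ge0].
by move=> s s0; rewrite !rearr_gt//; exact: h.
Qed.

Lemma rearr_mono f g t : lmeasurable f -> lmeasurable g ->
  aeI (fun x => `|g x| <= `|f x|) -> (rearr g t <= rearr f t)%E.
Proof.
move=> mf mg gf; apply: rearr_le => // s s0 /lt_le_trans; apply.
apply: leb_le_ae; [exact: measurable_level|exact: measurable_level|by move=> x []|].
by apply: aeI_mono gf _ => x Ix h [_ gx]; split => //; exact: lt_le_trans h.
Qed.

Lemma eq_rearr f g : lmeasurable f -> lmeasurable g -> aeI_eq f g ->
  rearr f = rearr g.
Proof.
move=> mf mg fg; apply/funext => t; apply/eqP; rewrite eq_le.
by rewrite !rearr_mono//; apply: aeI_mono fg _ => x _ ->.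
Qed.

End lebesgue.

(** * Rearrangement inequalities and monotone limits *)

Section rearr_theory.
Context {R : realType}.
Implicit Types (f g : R -> R) (s t : R) (A B D : set R).
Local Notation I := (@halfline R).
Local Notation mu := (@leb R).
Local Notation LR := (lebesgueType R).
Local Notation GR := (measurableTypeR R).

Lemma rearr_le_fin f s t : lmeasurable f -> 0 <= s ->
  (rearr f t <= s%:E)%E = (distr f s <= t%:E)%E.
Proof. by move=> mf s0; rewrite !leNgt rearr_gt. Qed.

Lemma lmeasurableD f g : lmeasurable f -> lmeasurable g ->
  lmeasurable (fun x => f x + g x).
Proof. by move=> mf mg; exact: measurable_funD. Qed.

Lemma lmeasurableZ (a : R) f : lmeasurable f -> lmeasurable (fun x => a * f x).
Proof. by move=> mf; apply: measurable_funM => //; exact: measurable_cst. Qed.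

Lemma rearrD f g s t : lmeasurable f -> lmeasurable g ->
  (rearr (fun x => (f x + g x)%R) (s + t)%R <= rearr f s + rearr g t)%E.
Proof.
move=> mf mg; have mfg := lmeasurableD mf mg.
have := rearr_ge0 f s; have := rearr_ge0 g t.
case eb : (rearr g t) => [b| |] // b0; last by rewrite addey ?leey// -ltNye (lt_le_trans _ (rearr_ge0 _ _)).
case ea : (rearr f s) => [a| |] // a0; last by rewrite addye ?leey.
rewrite -EFinD rearr_le_fin//; last by rewrite addr_ge0.
apply: (@le_trans _ _ (mu (level f a `|` level g b))).
  apply: le_measure; rewrite ?inE; [exact: measurable_level|apply: measurableU; exact: measurable_level|].
  move=> x [Ix sfg]; have [fa|fa] := ltP a `|f x|; first by left.
  have [gb|gb] := ltP b `|g x|; first by right.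
  by move: sfg; rewrite ltNge (le_trans (ler_normD _ _))// lerD.
apply: le_trans (measureU2 _ _ _) _; [exact: measurable_level..|].
by rewrite EFinD leeD// -rearr_le_fin// ?ea ?eb.
Qed.

Let rearrZ_le (a : R) f t : 0 <= t -> lmeasurable f ->
  (rearr (fun x => (a * f x)%R) t <= `|a|%:E * rearr f t)%E.
Proof.
move=> t0 mf; have ma := lmeasurableZ a mf.
have := rearr_ge0 f t; case ef : (rearr f t) => [r| |] // r0.
  rewrite -EFinM rearr_le_fin//; last by rewrite mulr_ge0.
  have : (distr f r <= t%:E)%E by rewrite -rearr_le_fin// ef.
  apply: le_trans; apply: le_measure; rewrite ?inE; [exact: measurable_level..|].
  move=> x [Ix] /=; rewrite normrM => h; split => //; rewrite ltNge; apply/negP => h'.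
  by move: h; rewrite ltNge ler_wpM2l.
have [->|a0] := eqVneq a 0; last by rewrite gt0_muley ?leey// lte_fin normr_gt0.
rewrite normr0 mul0e rearr_le_fin//; last by have := lmeasurableZ 0 mf.
rewrite /distr (_ : level _ _ = set0) ?measure0 ?lee_fin//.
by apply/seteqP; split => x // [_]; rewrite mul0r normr0 ltxx.
Qed.

Lemma rearrZ (a : R) f t : 0 <= t -> lmeasurable f ->
  rearr (fun x => (a * f x)%R) t = (`|a|%:E * rearr f t)%E.
Proof.
move=> t0 mf; apply/eqP; rewrite eq_le rearrZ_le//=.
have [->|a0] := eqVneq a 0; first by rewrite normr0 mul0e rearr_ge0.
have -> : rearr f t = rearr (fun x => a^-1 * (a * f x)) t.
  by congr (rearr _ t); apply/funext => x; rewrite mulrA mulVf// mul1r.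
apply: (@le_trans _ _ (`|a|%:E * (`|a^-1|%:E * rearr (fun x => (a * f x)%R) t))%E).
  by rewrite lee_pmul2l ?fin_numE// ?lte_fin ?normr_gt0// rearrZ_le//; exact: lmeasurableZ.
by rewrite muleA -EFinM -normrM divff// normr1 mul1e.
Qed.

Lemma Linfty_rearr f : lmeasurable f -> Linfty f = rearr f 0.
Proof.
move=> mf; rewrite /Linfty unlock.
have muT : (@leb R : {measure set LR -> \bar R}) setT = +oo%E.
  by have := @leb_itv R `]-oo, +oo[; rewrite set_itvE.
rewrite muT ltry.
set F := abse \o _.
have F0 : (0 <= ess_sup mu F)%E.
  by apply: ess_sup_gee; rewrite ?muT ?ltry//; apply: aeW => x; rewrite /F/= lee_fin.
have FE x : I x -> F x = `|f x|%:E.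
  by move=> Ix; rewrite /F/= patchE mem_set.
apply/eqP; rewrite eq_le; apply/andP; split.
  have := rearr_ge0 f 0; case ef : (rearr f 0) => [r| |] // r0; last by rewrite leey.
  have : (distr f r <= 0%:E)%E by rewrite -rearr_le_fin// ef.
  rewrite measure_le0 => /eqP mur0; apply/ess_supP.
  exists (level f r); split => //; first exact: measurable_level.
  move=> x /= h; have [Ix|nIx] := pselect (I x).
    by split => //; rewrite ltNge; apply/negP => fr; apply: h; rewrite /= FE.
  by exfalso; apply: h; rewrite /F/= patchE memNset//= normr0 lee_fin.
case eM : (ess_sup mu F) F0 => [M| |] // M0; last by rewrite leey.
rewrite rearr_le_fin// measure_le0; apply/eqP.
have /ess_supP [N [mN N0 sub]] : (ess_sup mu F <= M%:E)%E by rewrite eM.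
apply: (@subset_measure0 _ _ _ mu _ N) => //; first exact: measurable_level.
move=> x [Ix Mx]; apply: sub => /=; rewrite FE// lee_fin.
by apply/negP; rewrite -ltNge.
Qed.

(** An antitone majorant confines the set where [|f|] exceeds [h t] to [[0, t]]. With [rearr_lb],
    this replaces the explicit computation of rearrangements. *)
Lemma rearr_ub f (h : R -> R) t : lmeasurable f -> 0 < t ->
  (forall x y, 0 < x -> x <= y -> h y <= h x) -> 0 <= h t ->
  aeI (fun x => 0 < x -> `|f x| <= h x) -> (rearr f t <= (h t)%:E)%E.
Proof.
move=> mf t0 hh ht0 fh; rewrite rearr_le_fin//.
have -> : t%:E = mu `[0, t] by rewrite leb_itv/= lte_fin t0 sube0.
apply: leb_le_ae; [exact: measurable_level|exact: lebesgue_itv|by move=> x []|].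
apply: aeI_mono fh _ => x; rewrite halflineE => x0 fh [_ ltx].
rewrite /= in_itv/= x0/= leNgt; apply/negP => tx.
have xpos : 0 < x := lt_trans t0 tx.
by have := lt_le_trans ltx (le_trans (fh xpos) (hh _ _ t0 (ltW tx))); rewrite ltxx.
Qed.

Lemma rearr_lb f A (c t : R) : lmeasurable f -> measurable (A : set LR) ->
  A `<=` I -> (t%:E < mu A)%E -> (forall x, A x -> c <= `|f x|) ->
  (c%:E <= rearr f t)%E.
Proof.
move=> mf mA AI tA fA; rewrite leNgt; apply/negP => rc.
have := rearr_ge0 f t; case ef : (rearr f t) rc => [r| |] //.
rewrite lte_fin lee_fin => rc r0.
have : (distr f r <= t%:E)%E by rewrite -rearr_le_fin// ef.
rewrite leNgt => /negP; apply; apply: (lt_le_trans tA).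
apply: le_measure; rewrite ?inE//; first exact: measurable_level.
by move=> x Ax; split; [exact: AI|exact: lt_le_trans rc (fA _ Ax)].
Qed.

Lemma leb_lt (l : \bar R) : (0 <= l)%E ->
  mu [set t | I t /\ (t%:E < l)%E] = l.
Proof.
case: l => [r| |] // r0.
  rewrite (_ : [set _ | _] = `[0, r[%classic); last first.
    by apply/seteqP; split => x /=; rewrite halflineE in_itv/= lte_fin; [move=> [-> ->]|move=> /andP[-> ->]].
  rewrite leb_itv/= lte_fin; case: ltP => [_|r0']; first by rewrite sube0.
  by congr EFin; apply/eqP; rewrite eq_le r0' andbT -lee_fin.
rewrite (_ : [set _ | _] = `[0, +oo[%classic); last first.
  by apply/seteqP; split => x /=; rewrite halflineE in_itv/= ltry andbT; [move=> [->]|move=> ->].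
by rewrite leb_itv/= ltry.
Qed.

Lemma distr_ge0 f s : (0 <= distr f s)%E.
Proof. exact: measure_ge0. Qed.

Lemma rearr_level f s : lmeasurable f -> 0 <= s ->
  I `&` [set t | (s%:E < rearr f t)%E] = [set t | I t /\ (t%:E < distr f s)%E].
Proof.
by move=> mf s0; apply/seteqP; split => t [It] /=; rewrite rearr_gt.
Qed.

Lemma measurable_rearr_level f s : lmeasurable f -> 0 <= s ->
  measurable ([set t | I t /\ (t%:E < distr f s)%E] : set GR).
Proof.
move=> mf s0; rewrite -rearr_level//.
by apply: emeasurable_fun_o_infty; [exact: measurable_itv|exact: measurable_rearr].
Qed.

Lemma lmeasurable_fine_rearr f : lmeasurable (fine \o rearr f).
Proof.
apply: (@measurable_comp _ _ _ _ _ _ setT) => //; first exact: measurable_rearr_leb.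
Qed.

Lemma rearr_rearr f t : lmeasurable f ->
  (forall u, 0 < u -> (rearr f u < +oo)%E) ->
  rearr (fine \o rearr f) t = rearr f t.
Proof.
move=> mf fin; have mrf := lmeasurable_fine_rearr f.
suff E s : 0 <= s -> distr (fine \o rearr f) s = distr f s.
  by apply/eqP; rewrite eq_le !rearr_le// => s s0; rewrite E.
move=> s0; rewrite -[RHS]leb_lt ?distr_ge0//.
have fE u : 0 < u -> (s < `|(fine \o rearr f) u|) = (u%:E < distr f s)%E.
  move=> u0; rewrite -rearr_gt//= ger0_norm ?fine_ge0 ?rearr_ge0//.
  by rewrite -lte_fin fineK// ge0_fin_numE ?rearr_ge0// fin.
have mlt := borel_lebesgue (measurable_rearr_level mf s0).
(* The point 0 is excluded because [rearr f 0] may be infinite, and [fine] then turns it into 0. *)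
have ae0 : aeI (fun x : R => x != 0).
  exists [set 0]; split; [exact: borel_lebesgue (measurable_set1 _)|exact: leb_set1|].
  by move=> x /= h; apply: contrapT => x0; apply: h => _; apply/eqP.
have pos x : I x -> x != 0 -> 0 < x by rewrite halflineE lt_neqAle eq_sym => -> ->.
apply/eqP; rewrite eq_le; apply/andP; split.
- apply: leb_le_ae => //; [exact: measurable_level|by move=> x []|].
  by apply: aeI_mono ae0 _ => x Ix x0 [_]; rewrite fE ?pos.
- apply: leb_le_ae => //; [exact: measurable_level|by move=> x []|].
  by apply: aeI_mono ae0 _ => x Ix x0 [_]; rewrite -fE ?pos.
Qed.

(** Off one null set the level sets increase with [n], so continuity from below carries a uniform
    bound to their union. *)
Lemma fatou_level (u : nat -> R -> R) (M : R) (l : \bar R) :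
  (forall n, lmeasurable (u n)) ->
  (forall n, aeI (fun x => 0 <= u n x <= u n.+1 x)) ->
  (forall n, distr (u n) M <= l)%E ->
  (mu (\bigcup_n level (u n) M) <= l)%E.
Proof.
move=> mu_ /aeI_forall [N [mN N0 sub]] ul.
have good x : I x -> ~ N x -> forall n, 0 <= u n x <= u n.+1 x.
  by move=> Ix; apply: contra_notP => h; apply: sub => /=; apply: contra_not h; exact.
pose F n := level (u n) M `\` N.
have mF n : measurable (F n : set LR).
  by apply: measurableD => //; exact: measurable_level.
have ndF : nondecreasing_seq F.
  apply/nondecreasing_seqP => n; apply/subsetPset => x [[Ix Mx] Nx]; split => //.
  split => //; have /andP[u0 un] := good _ Ix Nx n.
  by apply: lt_le_trans Mx _; rewrite !ger0_norm// (le_trans u0).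
have mUF : measurable (\bigcup_n F n : set LR) by exact: bigcup_measurable.
have cvgF := nondecreasing_cvg_mu (mu := mu) mF mUF ndF.
have -> : mu (\bigcup_n level (u n) M) = mu (\bigcup_n F n).
  have -> : \bigcup_n F n = (\bigcup_n level (u n) M) `\` N by rewrite setD_bigcupl.
  apply/eqP; rewrite eq_le; apply/andP; split.
  - rewrite -[leRHS](@measureU0 _ _ _ mu _ N)//; last first.
      by apply: measurableD => //; apply: bigcup_measurable => n _; exact: measurable_level.
    rewrite setUDl// setDv setD0; apply: le_measure; rewrite ?inE//.
    + by apply: bigcup_measurable => n _; exact: measurable_level.
    + by apply: measurableU => //; apply: bigcup_measurable => n _; exact: measurable_level.
  - apply: le_measure; rewrite ?inE//.
    + by apply: measurableD => //; apply: bigcup_measurable => n _; exact: measurable_level.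
    + by apply: bigcup_measurable => n _; exact: measurable_level.
rewrite -(cvg_lim _ cvgF)//; apply: lime_le; first by apply/cvg_ex; exists (mu (\bigcup_n F n)).
apply: nearW => n /=; apply: le_trans (ul n).
apply: le_measure => [|| x []//]; rewrite ?inE; first exact: mF.
exact: measurable_level.
Qed.

Lemma rearr_fatou (u : nat -> R -> R) f t :
  (forall n, lmeasurable (u n)) -> lmeasurable f ->
  (forall n, aeI (fun x => 0 <= u n x <= u n.+1 x)) ->
  aeI (fun x => (f x)%:E = ereal_sup (range (fun n => (u n x)%:E))) ->
  rearr f t = ereal_sup (range (fun n => rearr (u n) t)).
Proof.
move=> mu_ mf ndu fE; apply/eqP; rewrite eq_le; apply/andP; split; last first.
  apply: ge_ereal_sup => _ [n _ <-]; apply: rearr_mono => //.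
  apply: aeI_mono2 (ndu n) fE _ => x Ix /andP[un0 _] fx.
  have unf : u n x <= f x by rewrite -lee_fin fx; apply: ereal_sup_ubound; exists n.
  by rewrite !ger0_norm// (le_trans un0).
have sup0 : (0 <= ereal_sup (range (fun n => rearr (u n) t)))%E.
  by apply: le_ereal_sup_tmp; exists (rearr (u 0%N) t); [exists 0%N|exact: rearr_ge0].
apply: lee_distr => //; first exact: rearr_ge0.
move=> s s0; rewrite rearr_gt// => tf.
rewrite ltNge; apply/negP => sups.
move: tf; rewrite ltNge => /negP; apply.
apply: le_trans (_ : mu (\bigcup_n level (u n) s) <= _)%E; last first.
  apply: fatou_level => // n; rewrite -rearr_le_fin//; apply: le_trans sups.
  by apply: ereal_sup_ubound; exists n.
apply: leb_le_ae; [exact: measurable_level| |by move=> x []|].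
  by apply: bigcup_measurable => n _; exact: measurable_level.
apply: aeI_mono2 (aeI_forall ndu) fE _ => x Ix un fx [_ sf].
have f0 : 0 <= f x.
  have /andP[u0 _] := un 0%N; apply: le_trans u0 _.
  by rewrite -lee_fin fx; apply: ereal_sup_ubound; exists 0%N.
move: sf; rewrite ger0_norm// -lte_fin fx => /ereal_sup_gt[_ [n _ <-]]; rewrite lte_fin => sun.
by exists n => //; split => //; rewrite ger0_norm//; have /andP[] := un n.
Qed.

(** The pointwise supremum could be infinite on a large set. A finite bound [M] on all
    [rearr (u n) t] places that set in the union of the levels above [M], of measure at most [t];
    letting [t] tend to 0 makes it null. *)
Lemma fatou_limit (u : nat -> R -> R) :
  (forall n, lmeasurable (u n)) ->
  (forall n, aeI (fun x => 0 <= u n x <= u n.+1 x)) ->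
  (forall t, 0 < t -> (ereal_sup (range (fun n => rearr (u n) t)) < +oo)%E) ->
  exists2 f, lmeasurable f &
    aeI (fun x => (f x)%:E = ereal_sup (range (fun n => (u n x)%:E))).
Proof.
move=> mu_ ndu fin.
pose G x := ereal_sup (range (fun n => (u n x)%:E)).
have GE : G = fun x => esups (fun n => (u n x)%:E) 0%N.
  apply/funext => x; rewrite /G /esups/= /sdrop; congr ereal_sup.
  by apply/seteqP; split => _ [n _ <-]; exists n.
have mG : measurable_fun (I : set LR) G.
  by rewrite GE; apply: measurable_fun_esups => n; apply/measurable_EFinP; exact: mu_.
exists (fine \o G).
  by apply: (@measurable_comp _ _ _ _ _ _ setT).
pose B := I `&` [set x | G x = +oo%E].
have mB : measurable (B : set LR).
  have := mG mI [set +oo%E]; apply; exact: emeasurable_set1.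
have small t : 0 < t -> (mu B <= t%:E)%E.
  move=> t0; have [M M0 hM] : exists2 M : R, 0 <= M & forall n, (rearr (u n) t <= M%:E)%E.
    have s0 : (0 <= ereal_sup (range (fun n => rearr (u n) t)))%E.
      by apply: le_ereal_sup_tmp; exists (rearr (u 0%N) t); [exists 0%N|exact: rearr_ge0].
    exists (fine (ereal_sup (range (fun n => rearr (u n) t)))); first exact: fine_ge0.
    move=> n; rewrite fineK; last by rewrite ge0_fin_numE// fin.
    by apply: ereal_sup_ubound; exists n.
  apply: le_trans (_ : mu (\bigcup_n level (u n) M) <= _)%E; last first.
    by apply: fatou_level => // n; rewrite -rearr_le_fin.
  apply: leb_le_ae => //; [|by move=> x []|].
    by apply: bigcup_measurable => n _; exact: measurable_level.
  apply: aeI_mono (aeI_forall ndu) _ => x Ix un [_ Gx].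
  have : (M%:E < G x)%E by rewrite Gx ltry.
  move=> /ereal_sup_gt[_ [n _ <-]]; rewrite lte_fin => sun.
  by exists n => //; split => //; rewrite ger0_norm//; have /andP[] := un n.
have B0 : mu B = 0%E.
  apply/eqP; rewrite -measure_le0; apply/lee_addgt0Pr => e e0.
  by rewrite add0e small.
have aeB : aeI (fun x => ~ B x) by exists B; split => // x /= h; apply: contrapT => nB; exact: h.
apply: aeI_mono2 aeB (aeI_forall ndu) _ => x Ix nBx un /=.
rewrite fineK// ge0_fin_numE; last first.
  by apply: le_ereal_sup_tmp; exists (u 0%N x)%:E; [exists 0%N|have /andP[] := un 0%N; rewrite lee_fin].
by rewrite ltey; apply/negP => /eqP Gx; apply: nBx.
Qed.

End rearr_theory.

(** * Completeness from the ideal and Fatou properties *)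

Lemma cvge0P (R : realType) (F : nat -> \bar R) : (forall n, (0 <= F n)%E) ->
  (forall e : R, 0 < e -> exists n0, forall n, (n0 <= n)%N -> (F n <= e%:E)%E) ->
  F @ \oo --> 0%E.
Proof.
move=> F0 h; apply/fine_cvgP; split.
  have [n0 hn] := h 1 ltr01; near=> n.
  rewrite ge0_fin_numE//; apply: le_lt_trans (hn n _) (ltry _).
  by near: n; exact: nbhs_infty_ge.
apply/cvgrPdist_le => e e0; have [n0 hn] := h e e0; near=> n.
have Fn : (F n <= e%:E)%E by apply: hn; near: n; exact: nbhs_infty_ge.
rewrite /= sub0r normrN ger0_norm ?fine_ge0// -lee_fin fineK//.
by rewrite ge0_fin_numE// (le_lt_trans Fn) ?ltry.
Unshelve. all: by end_near. Qed.

Section riesz_fischer.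
Context {R : realType}.
Implicit Types (f g : R -> R).
Variables (N : (R -> R) -> \bar R) (K : R).
Hypotheses (K1 : 1 <= K) (qN : quasi_norm_with K N) (iN : ideal_property N)
  (fN : fatou_property N).
Local Notation I := (@halfline R).

Let N0 f : in_space N f -> (0 <= N f)%E. Proof. by case: qN => + _ _ _; exact. Qed.

Let K0 : 0 < K. Proof. exact: lt_le_trans K1. Qed.

Let N_D f g : in_space N f -> in_space N g ->
  in_space N (fun x => f x + g x) /\
  (N (fun x => (f x + g x)%R) <= K%:E * (N f + N g))%E.
Proof.
move=> sf sg; case: qN => _ _ _ /(_ f g sf sg) h; split => //; split.
  by case: sf sg => mf _ [mg _]; exact: lmeasurableD.
apply: le_lt_trans h _; case: sf sg => mf hf [mg hg].
by rewrite lte_mul_pinfty// ?lee_fin ?ltW// lte_add_pinfty.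
Qed.

Let N_Z (a : R) f : in_space N f -> in_space N (fun x => a * f x).
Proof.
move=> sf; case: qN => _ _ /(_ a f sf) h _; split.
  by case: sf => mf _; exact: lmeasurableZ.
by rewrite h lte_mul_pinfty//; case: sf.
Qed.

Let N_B f g : in_space N f -> in_space N g -> in_space N (fun x => f x - g x).
Proof.
move=> sf sg; have [h _] := N_D sf (N_Z (-1) sg).
by congr (in_space N _): h; apply/funext => x; rewrite mulN1r.
Qed.

Let N_le f g : in_space N f -> lmeasurable g ->
  aeI (fun x => `|g x| <= `|f x|) -> in_space N g /\ (N g <= N f)%E.
Proof. by move=> sf mg gf; exact: iN. Qed.

Let inv2K : 0 < (2 * K)^-1. Proof. by rewrite invr_gt0 mulr_gt0. Qed.

Section sums.
Variables (u : nat -> R -> R) (d : nat -> R -> R).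
Hypotheses (sd : forall k, in_space N (d k))
  (dle : forall k, (N (d k) <= ((2 * K)^-1 ^+ k.+1)%:E)%E)
  (d0 : forall k x, 0 <= d k x).

Let S j m x := \sum_(i < m) d (j + i)%N x.

(** Summing from the right, each quasi-triangle inequality costs a factor [K]. The ratio
    [(2 * K)^-1] absorbs it, since [K] times twice the power [j.+1] is the power [j]. *)
Lemma riesz_fischer_sum m j :
  in_space N (S j m) /\ (N (S j m) <= ((2 * K)^-1 ^+ j)%:E)%E.
Proof.
elim: m j => [|m IH] j.
  have s0 := N_Z 0 (sd 0).
  have -> : S j 0 = (fun x => 0 * d 0 x).
    by apply/funext => x; rewrite /S big_ord0 mul0r.
  split => //; case: qN => _ _ /(_ 0 _ (sd 0)) -> _.
  by rewrite normr0 mul0e lee_fin exprn_ge0// ltW.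
have -> : S j m.+1 = fun x => d j x + S j.+1 m x.
  apply/funext => x; rewrite /S big_ord_recl/= addn0; congr (_ + _).
  by apply: eq_bigr => i _; rewrite /bump/= add1n addSnnS.
have [sS leS] := IH j.+1; have [sD leD] := N_D (sd j) sS; split => //.
apply: le_trans leD _; apply: (@le_trans _ _ (K%:E *
    (((2 * K)^-1 ^+ j.+1)%:E + ((2 * K)^-1 ^+ j.+1)%:E))%E).
  by rewrite lee_pmul2l ?fin_numE ?lte_fin// leeD.
rewrite -EFinD -EFinM lee_fin exprS -mulr2n mulrnAr mulrA -mulrnAl.
rewrite -[leRHS]mul1r ler_wpM2r ?exprn_ge0 ?(ltW inv2K)// -mulr_natl.
by rewrite mulrA divff// mulf_neq0 ?gt_eqF.
Qed.

Lemma riesz_fischer_sup j : exists g, [/\ in_space N g,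
  aeI (fun x => (g x)%:E = ereal_sup (range (fun m => (S j m x)%:E))) &
  (N g <= ((2 * K)^-1 ^+ j)%:E)%E].
Proof.
have le1 : (ereal_sup (range (fun m => N (S j m))) <= ((2 * K)^-1 ^+ j)%:E)%E.
  by apply: ge_ereal_sup => _ [m _ <-]; have [] := riesz_fischer_sum m j.
have [|||g [sg gE Ng]] := fN (u := S j).
- by move=> m; have [] := riesz_fischer_sum m j.
- move=> m; apply: aeIW => x _; rewrite /S big_ord_recr/= lerDl d0 andbT.
  exact: sumr_ge0.
- exact: le_lt_trans le1 (ltry _).
by exists g; split => //; rewrite Ng.
Qed.

End sums.

(** A subsequence with geometrically small increments is summed. The Fatou property, available only
    for increasing nonnegative sequences, supplies the sums, and the ideal property bounds the
    remainders in norm. *)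
Lemma riesz_fischer : complete_space N.
Proof.
move=> u su cauchy.
pose eps k := (2 * K)^-1 ^+ k.+1.
have eps0 k : 0 < eps k by rewrite exprn_gt0.
have /choice[n_ hn_] : forall k, exists n0, forall m n, (n0 <= m)%N -> (n0 <= n)%N ->
    (N (fun x => (u m x - u n x)%R) < (eps k)%:E)%E.
  by move=> k; exact: cauchy.
(* Cumulative sums turn the thresholds [n_] into nondecreasing indices that still dominate them. *)
pose nn k := (\sum_(i < k.+1) n_ i)%N.
have nnS k : (nn k <= nn k.+1)%N by rewrite /nn [leqRHS]big_ord_recr/= leq_addr.
have n_nn k : (n_ k <= nn k)%N by rewrite /nn big_ord_recr/= leq_addl.
pose v k := u (nn k).
have sv k : in_space N (v k) by exact: su.
pose d k x := v k.+1 x - v k x.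
have sd k : in_space N (d k) by exact: N_B.
have dle k : (N (d k) <= (eps k)%:E)%E.
  by apply/ltW/hn_ => //; apply: leq_trans (nnS k).
(* The positive and negative parts of the increments are summed separately, so that the partial sums
   increase; the limit is the difference of the two sums. *)
pose dp k x := Num.max (d k x) 0; pose dn k x := Num.max (- d k x) 0.
pose da k x := `|d k x|.
have dpn k x : d k x = dp k x - dn k x.
  by rewrite /dp /dn; case: (leP (d k x) 0) => h; case: (leP (- d k x) 0) => h'; lra.
have dapn k x : da k x = dp k x + dn k x.
  rewrite /da /dp /dn; case: (leP (d k x) 0) => h; case: (leP (- d k x) 0) => h'.
  - by rewrite ler0_norm//; lra.
  - by rewrite ler0_norm//; lra.
  - by rewrite gtr0_norm//; lra.
  - by rewrite gtr0_norm//; lra.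
have dp0 k x : 0 <= dp k x by rewrite /dp le_max lexx orbT.
have dn0 k x : 0 <= dn k x by rewrite /dn le_max lexx orbT.
have da0 k x : 0 <= da k x by rewrite /da.
have mdk k : lmeasurable (d k) by case: (sd k).
have part (e : nat -> R -> R) : (forall k, lmeasurable (e k)) ->
    (forall k x, 0 <= e k x <= da k x) ->
    (forall k, in_space N (e k)) /\ (forall k, (N (e k) <= (eps k)%:E)%E).
  move=> me ed; have h k : in_space N (e k) /\ (N (e k) <= N (d k))%E.
    apply: N_le => //; apply: aeIW => x _; have /andP[e0 ex] := ed k x.
    by rewrite ger0_norm.
  by split => k; have [h1 h2] := h k => //; exact: le_trans (dle k).
have [sdp ledp] : (forall k, in_space N (dp k)) /\ (forall k, (N (dp k) <= (eps k)%:E)%E).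
  apply: part => [k|k x]; last by rewrite dp0 dapn lerDl dn0.
  by apply: measurable_maxr => //; exact: mdk.
have [sdn ledn] : (forall k, in_space N (dn k)) /\ (forall k, (N (dn k) <= (eps k)%:E)%E).
  apply: part => [k|k x]; last by rewrite dn0 dapn lerDr dp0.
  have mN : lmeasurable (fun x => - d k x) by apply: measurable_funN; exact: mdk.
  by apply: measurable_maxr => //; exact: mN.
have [sda leda] : (forall k, in_space N (da k)) /\ (forall k, (N (da k) <= (eps k)%:E)%E).
  by apply: part => [k|k x]; [exact: lmeasurable_norm|rewrite da0 lexx].
have [p [sp pE _]] := riesz_fischer_sup sdp ledp dp0 0.
have [q [sq qE _]] := riesz_fischer_sup sdn ledn dn0 0.
pose f x := v 0%N x + (p x - q x).
have sf : in_space N f by have [] := N_D (sv 0%N) (N_B sp sq).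
have vE j x : v j x = v 0%N x + (\sum_(i < j) dp i x - \sum_(i < j) dn i x).
  elim: j => [|j IH]; first by rewrite !big_ord0 subrr addr0.
  have -> : v j.+1 x = v j x + d j x by rewrite /d addrC subrK.
  by rewrite IH !big_ord_recr/= dpn; ring.
have close j : (N (fun x => (v j x - f x)%R) <= ((2 * K)^-1 ^+ j)%:E)%E.
  have [g [sg gE Ng]] := riesz_fischer_sup sda leda da0 j.
  apply: le_trans Ng; have [] // := @N_le g (fun x => v j x - f x) sg.
    by case: (N_B (sv j) sf).
  apply: aeI_mono2 pE (_ : aeI (fun x => (q x)%:E = ereal_sup (range (fun m =>
    (\sum_(i < m) dn (0 + i)%N x)%:E)) /\ (g x)%:E = ereal_sup (range (fun m =>
    (\sum_(i < m) da (j + i)%N x)%:E)))) _.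
    by apply: aeI_mono2 qE gE _ => x _; split.
  move=> x _ px [qx gx].
  pose P m := \sum_(i < m) dp i x; pose Q m := \sum_(i < m) dn i x.
  have Pp m : P m <= p x by rewrite -lee_fin px; apply: ereal_sup_ubound; exists m.
  have Qq m : Q m <= q x by rewrite -lee_fin qx; apply: ereal_sup_ubound; exists m.
  have ndP m n : (m <= n)%N -> P m <= P n.
    move=> /subnKC <-; rewrite /P big_split_ord/= lerDl; exact: sumr_ge0.
  have ndQ m n : (m <= n)%N -> Q m <= Q n.
    move=> /subnKC <-; rewrite /Q big_split_ord/= lerDl; exact: sumr_ge0.
  have PQg m : P (j + m)%N + Q (j + m)%N - P j - Q j <= g x.
    rewrite -lee_fin gx; apply: ereal_sup_ubound; exists m => //; congr EFin.
    rewrite /P /Q !big_split_ord/=.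
    rewrite (eq_bigr (fun i : 'I_m => dp (j + i)%N x + dn (j + i)%N x)); last by move=> i _; rewrite dapn.
    by rewrite big_split/=; ring.
  (* With independent indices [m] and [n], the suprema [p x] and [q x] can be taken one after the
     other. *)
  have PQ m n : P m + Q n <= g x + P j + Q j.
    have h2 : P m <= P (j + (m + n))%N by apply: ndP; rewrite addnCA leq_addr.
    have h1 : Q n <= Q (j + (m + n))%N by apply: ndQ; rewrite addnA leq_addl.
    by have := PQg (m + n)%N; lra.
  have pQ n : p x + Q n <= g x + P j + Q j.
    rewrite -lerBrDr -lee_fin px; apply: ge_ereal_sup => _ [m _ <-].
    by rewrite lee_fin lerBrDr; exact: PQ.
  have pq : p x + q x <= g x + P j + Q j.
    rewrite addrC -lerBrDr -lee_fin qx; apply: ge_ereal_sup => _ [m _ <-].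
    by rewrite lee_fin lerBrDr addrC; exact: pQ.
  have -> : v j x - f x = (P j - p x) - (Q j - q x).
    by rewrite vE /f /P /Q; ring.
  apply: le_trans (ler_norm (g x)); apply: le_trans (ler_normB _ _) _.
  rewrite !ler0_norm ?subr_le0//; lra.
exists f => //; apply: cvge0P => [n|e e0]; first by apply: N0; exact: N_B.
have [j hj] : exists j, K * (eps j + (2 * K)^-1 ^+ j) < e.
  have g1 : `|(2 * K)^-1| < 1.
    by rewrite gtr0_norm// invf_lt1 ?mulr_gt0//; move: K1; lra.
  have := cvg_expr g1 => /cvgrPdist_lt /(_ (e / (2 * K))).
  rewrite divr_gt0// ?mulr_gt0// => /(_ isT) [n0 _ /(_ n0 (leqnn _))].
  rewrite /= sub0r normrN ger0_norm ?exprn_ge0 ?ltW// => h; exists n0.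
  have epsle : eps n0 <= (2 * K)^-1 ^+ n0.
    rewrite /eps exprS ler_piMl ?exprn_ge0 ?(ltW inv2K)//.
    by rewrite invf_le1 ?mulr_gt0//; move: K1; lra.
  move: h; rewrite ltr_pdivlMr ?mulr_gt0//; apply: le_lt_trans.
  rewrite (_ : _ * (2 * K) = K * (2 * (2 * K)^-1 ^+ n0)); last by ring.
  by rewrite ler_pM2l//; lra.
exists (nn j) => n nj.
have sB := N_B (su n) (sv j); have sB' := N_B (sv j) sf.
have -> : (fun x => u n x - f x) = (fun x => (u n x - v j x) + (v j x - f x)).
  by apply/funext => x; ring.
have [_ h] := N_D sB sB'; apply: le_trans h _.
apply: le_trans (_ : (K * (eps j + (2 * K)^-1 ^+ j))%:E <= _)%E; last by rewrite lee_fin ltW.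
rewrite EFinM EFinD lee_pmul2l ?fin_numE ?lte_fin// leeD//.
by apply/ltW/hn_ => //; exact: leq_trans nj.
Qed.

End riesz_fischer.

(** * Functionals of the rearrangement that define quasi-Banach r.i. spaces *)

Definition antitone {R : realType} (g : R -> \bar R) :=
  (forall t, 0 <= g t)%E /\ (forall s t : R, s <= t -> (g t <= g s)%E).

(** Conditions on [J] under which [J (rearr f)] is a quasi-Banach r.i. norm. Functions are compared
    at positive points, since rearrangements may be infinite at 0. [rif_dil] halves the arguments
    because [rearr (f + g) t] is at most [rearr f (t / 2) + rearr g (t / 2)]. [rif_weak] gives
    definiteness and finiteness at positive points, [rif_sup] the Fatou property. *)
Record ri_functional (R : realType) (J : (R -> \bar R) -> \bar R) : Prop := {
  rif_le : forall g h, antitone g -> antitone h ->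
    (forall t, 0 < t -> (g t <= h t)%E) -> (J g <= J h)%E;
  rif_ge0 : forall g, antitone g -> (0 <= J g)%E;
  rifZ : forall (c : R) g, 0 <= c -> antitone g ->
    J (fun t => c%:E * g t)%E = (c%:E * J g)%E;
  rif_weak : exists k : R -> R, (forall t, 0 < t -> 0 < k t) /\
    forall t g, 0 < t -> antitone g -> (g t * (k t)%:E <= J g)%E;
  rif_dil : exists2 K : R, 1 <= K & forall g h, antitone g -> antitone h ->
    (J (fun t => g (t / 2)%R + h (t / 2)%R) <= K%:E * (J g + J h))%E;
  rif_sup : forall g : nat -> R -> \bar R, (forall n, antitone (g n)) ->
    (forall n t, g n t <= g n.+1 t)%E ->
    J (fun t => ereal_sup (range (g ^~ t))) = ereal_sup (range (J \o g));
  rif_step : forall M L : R, 0 < M -> 0 < L ->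
    (J (fun t => if (t < L)%R then M%:E else 0%E) < +oo)%E }.

Section ri_functional.
Context {R : realType}.
Variable J : (R -> \bar R) -> \bar R.
Hypothesis rJ : ri_functional J.
Implicit Types (f : R -> R).
Local Notation I := (@halfline R).
Local Notation mu := (@leb R).
Local Notation LR := (lebesgueType R).
Local Notation N := (fun f => J (rearr f)).

Lemma antitone_rearr f : antitone (rearr f).
Proof. by split => [t|s t st]; [exact: rearr_ge0|exact: le_rearr]. Qed.
Local Hint Resolve antitone_rearr : core.

Lemma antitoneZ (c : R) g : 0 <= c -> antitone g -> antitone (fun t => c%:E * g t)%E.
Proof.
move=> c0 [g0 gh]; split => [t|s t st]; first by rewrite mule_ge0.
by rewrite lee_wpmul2l//; exact: gh.
Qed.

Lemma rif_eq g h : antitone g -> antitone h -> (forall t, 0 < t -> g t = h t) ->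
  J g = J h.
Proof.
by move=> ag ah gh; apply/eqP; rewrite eq_le !(rif_le rJ)// => t t0; rewrite gh.
Qed.

Lemma rif0 g : antitone g -> (forall t, 0 < t -> g t = 0%E) -> J g = 0%E.
Proof.
move=> ag g0; rewrite (@rif_eq g (fun t => 0%:E * g t)%E)//.
- by rewrite (rifZ rJ)// mul0e.
- exact: antitoneZ.
- by move=> t t0; rewrite g0// mule0.
Qed.

Lemma rif_fin g t : antitone g -> (J g < +oo)%E -> 0 < t -> (g t < +oo)%E.
Proof.
move=> ag Jg t0; have [k [k0 h]] := rif_weak rJ.
have := le_lt_trans (h t g t0 ag) Jg.
have [g0 _] := ag; case: (g t) (g0 t) => [r| |] // _; rewrite ?ltry//.
by rewrite gt0_mulye ?lte_fin ?k0.
Qed.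

Lemma rif_quasi_norm : exists2 K : R, 1 <= K & quasi_norm_with K N.
Proof.
have [K K1 hK] := rif_dil rJ; exists K => //; split.
- by move=> f _; exact: (rif_ge0 rJ).
- move=> f mf; split => [Jf|f0].
    have rf0 t : 0 < t -> (rearr f t <= 0%:E)%E.
      move=> t0; have [k [k0 h]] := rif_weak rJ.
      have := h t _ t0 (antitone_rearr f); rewrite Jf.
      have := rearr_ge0 f t; rewrite le_eqVlt => /predU1P[<-//|rf].
      by rewrite leNgt mule_gt0// lte_fin k0.
    have d0 : mu (level f 0) = 0%E.
      apply/eqP; rewrite -measure_le0; apply/lee_addgt0Pr => e e0.
      by rewrite add0e -[leLHS]/(distr f 0) -rearr_le_fin// rf0.
    exists (level f 0); split => //; first exact: measurable_level.
    move=> x /= h; have [Ix fx] : I x /\ f x <> 0 by apply/not_implyP.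
    by split => //; rewrite normr_gt0; exact/eqP.
  have m0 : lmeasurable (fun _ : R => 0 : R) by exact: measurable_cst.
  rewrite (eq_rearr mf m0 f0); apply: rif0 => // t t0.
  have -> : (fun _ : R => 0 : R) = fun x => 0 * (fun _ : R => 0 : R) x.
    by apply/funext => x; rewrite mul0r.
  by rewrite rearrZ ?ltW// normr0 mul0e.
- move=> a f [mf _]; rewrite -(rifZ rJ)//; apply: rif_eq => //; first exact: antitoneZ.
  by move=> t t0; rewrite rearrZ// ltW.
- move=> f g [mf _] [mg _]; apply: le_trans (hK _ _ _ _) => //.
  apply: (rif_le rJ) => //.
    split => [t|s t st]; first by rewrite adde_ge0 ?rearr_ge0.
    by rewrite leeD// le_rearr// ler_pM2r.
  by move=> t t0; rewrite [in leLHS](splitr t) rearrD.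
Qed.

Lemma rif_ideal : ideal_property N.
Proof.
move=> f g [mf Jf] mg gf.
have h : (N g <= N f)%E by apply: (rif_le rJ) => // t t0; exact: rearr_mono.
by split => //; split => //; exact: le_lt_trans Jf.
Qed.

Lemma rif_fatou : fatou_property N.
Proof.
move=> u su ndu supu.
have mu_ n : lmeasurable (u n) by case: (su n).
have supfin t : 0 < t -> (ereal_sup (range (fun n => rearr (u n) t)) < +oo)%E.
  move=> t0; have [k [k0 h]] := rif_weak rJ.
  set S := ereal_sup _ in supu.
  have S0 : (0 <= S)%E.
    by apply: le_trans (rif_ge0 rJ (antitone_rearr (u 0%N))) _; apply: ereal_sup_ubound; exists 0%N.
  have SE : S = (fine S)%:E by rewrite fineK// ge0_fin_numE.
  apply: le_lt_trans (ltry (fine S / k t)).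
  apply: ge_ereal_sup => _ [n _ <-].
  have : (rearr (u n) t * (k t)%:E <= (fine S)%:E)%E.
    by rewrite -SE; apply: le_trans (h _ _ t0 _) _ => //; apply: ereal_sup_ubound; exists n.
  by rewrite EFinM lee_pdivlMr ?k0.
have [f mf fE] := fatou_limit mu_ ndu supfin.
have rfE : rearr f = fun t => ereal_sup (range (fun n => rearr (u n) t)).
  by apply/funext => t; exact: rearr_fatou.
have JfE : N f = ereal_sup (range (fun n => N (u n))).
  rewrite rfE (rif_sup rJ (g := fun n => rearr (u n)))// => n t.
  apply: rearr_mono => //; apply: aeI_mono (ndu n) _ => x _ /andP[u0 un].
  by rewrite !ger0_norm// (le_trans u0).
by exists f; split => //; split => //; rewrite JfE.
Qed.

Lemma finite_set_norm_bounds (A : set R) : finite_set A ->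
  exists m M : R, [/\ 0 < m, 0 < M & forall y, A y ->
    `|y| <= M /\ (y != 0 -> m <= `|y|)].
Proof.
move=> /finite_seqP[s ->]; elim: s => [|a s [m [M [m0 M0 h]]]].
  by exists 1, 1; split.
exists (if a == 0 then m else Num.min m `|a|), (Num.max M `|a|); split.
- by case: eqP => // /eqP a0; rewrite lt_min m0 normr_gt0.
- by rewrite lt_max M0.
- move=> y /=; rewrite inE => /predU1P[->|ys].
    by rewrite le_max lexx orbT; split => // /negbTE ->; rewrite ge_min lexx orbT.
  have [hM hm] := h y ys; rewrite le_max hM; split => // y0.
  by case: eqP => _; rewrite ?ge_min hm.
Qed.

(** The nonzero values of [f] are bounded away from 0, so integrability makes its support of finite
    measure. The rearrangement then lies below a step function, to which [rif_step] applies. *)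
Lemma rif_simple : contains_simple N.
Proof.
move=> f mf /finite_set_norm_bounds[m [M [m0 M0 bd]]] fint; split => //.
have dfin : (distr f 0 < +oo)%E.
  have /integrableP[_ ifin] := fint.
  have ml := measurable_level 0 mf.
  have : (m%:E * distr f 0 <= \int[mu]_(x in I) `|(EFin \o f) x|)%E.
    rewrite /distr -integral_cst//.
    apply: (@le_trans _ _ (\int[mu]_(x in level f 0) `|(EFin \o f) x|)%E).
      apply: ge0_le_integral.
      - exact: ml.
      - by move=> x _; rewrite lee_fin ltW.
      - exact: measurable_cst.
      - apply: (measurable_funS mI) => [x []//|].
        by apply: measurableT_comp => //; exact/measurable_EFinP.
      - move=> x [Ix fx]; rewrite lee_fin.
        have [_ h] : `|f x| <= M /\ (f x != 0 -> m <= `|f x|) by apply: bd; exists x.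
        by apply: h; rewrite -normr_gt0.
    apply: ge0_subset_integral; [exact: ml|exact: mI| |by move=> x _; exact: abse_ge0|by move=> x []].
    by apply: measurableT_comp => //; exact/measurable_EFinP.
  move=> h; have := le_lt_trans h ifin.
  case: (distr f 0) (distr_ge0 f 0) => [r| |] //.
    by move=> _ _; rewrite ltry.
  by rewrite gt0_muley ?lte_fin.
(* The summand 1 keeps [L] positive when [f] vanishes a.e. *)
pose L := fine (distr f 0) + 1.
have L0 : 0 < L by rewrite ltr_wpDl// fine_ge0 ?distr_ge0.
apply: le_lt_trans (rif_step rJ M0 L0); apply: (rif_le rJ) => //.
  split => [t|s t st]; first by case: ifP => _; rewrite ?lee_fin// ltW.
  by case: ifPn => tL; rewrite ?(le_lt_trans st tL)//; case: ifPn => _; rewrite ?lee_fin// ltW.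
move=> t t0; case: ifPn => tL.
  apply: (@rearr_ub R f (fun=> M)) => //; first exact: ltW.
  by apply: aeIW => x Ix _; have [] : `|f x| <= M /\ (f x != 0 -> m <= `|f x|) by apply: bd; exists x.
rewrite -leNgt in tL; rewrite rearr_le_fin//.
apply: le_trans (_ : L%:E <= _)%E; last by rewrite lee_fin.
by rewrite /L EFinD fineK ?ge0_fin_numE ?distr_ge0// leeDl.
Qed.

Lemma rif_invariant : rearrangement_invariant N.
Proof.
split=> [f mf|f [mf Jf]].
  split=> [[_ Jf]|[fin [_ Jf]]].
    have fin t : 0 < t -> (rearr f t < +oo)%E by exact: rif_fin.
    split => //; split; first exact: lmeasurable_fine_rearr.
    by rewrite /= (_ : rearr (fine \o rearr f) = rearr f)//; apply/funext => t; exact: rearr_rearr.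
  split => //; congr (J _ < _)%E: Jf.
  by apply/funext => t; exact: rearr_rearr.
congr J; apply/funext => t; rewrite rearr_rearr// => s; exact: rif_fin.
Qed.

Lemma rif_quasi_banach_ri : quasi_banach_ri N.
Proof.
have [K K1 qN] := rif_quasi_norm; split.
- by exists K.
- exact: riesz_fischer K1 qN rif_ideal rif_fatou.
- split; [exact: rif_ideal|exact: rif_fatou|exact: rif_simple|exact: rif_invariant].
Qed.

End ri_functional.

(** * The fundamental function and its Stieltjes measure *)

Section fundamental_function.
Context {R : realType}.
Variable phi : R -> R.
Hypothesis nphi : normalized_fundamental phi.
Local Notation I := (@halfline R).
Local Notation GR := (measurableTypeR R).
Local Notation F := (right_limit_fun phi).
Local Notation m := (stieltjes phi).
Implicit Types (s t a b c : R).

Lemma phi0 : phi 0 = 0. Proof. by case: nphi. Qed.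

Lemma phi_gt0 t : 0 < t -> 0 < phi t. Proof. by case: nphi => _ + _ _ _; exact. Qed.

Lemma phi_ge0 t : 0 <= t -> 0 <= phi t.
Proof. by rewrite le_eqVlt => /predU1P[<-|/phi_gt0/ltW//]; rewrite phi0. Qed.

Lemma phi_le s t : 0 <= s -> s <= t -> phi s <= phi t.
Proof.
move=> s0 st; case: nphi => _ _ + _ _; apply => //; rewrite inE halflineE//.
exact: le_trans st.
Qed.

Lemma phi_concave a b c : 0 <= a -> a < b -> b < c ->
  (c - b) * phi a + (b - a) * phi c <= (c - a) * phi b.
Proof.
move=> a0 ab bc; have ac : 0 < c - a by rewrite subr_gt0 (lt_trans ab).
case: nphi => _ _ _ /(_ a c) h _.
have l01 : 0 <= (c - b) / (c - a) <= 1.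
  apply/andP; split; first by rewrite divr_ge0// ltW// subr_gt0.
  by rewrite ler_pdivrMr// mul1r lerD2l lerN2 ltW.
have {h} := h _ _ _ l01; rewrite !inE !halflineE a0.
have c0 : 0 <= c by rewrite (le_trans a0)// ltW// (lt_trans ab).
move=> /(_ isT c0).
have -> : (c - b) / (c - a) * a + (1 - (c - b) / (c - a)) * c = b.
  by field; rewrite gt_eqF.
have -> : 1 - (c - b) / (c - a) = (b - a) / (c - a).
  by field; rewrite gt_eqF.
move=> h; rewrite -(ler_pM2l ac) in h.
rewrite (_ : (c - a) * _ = (c - b) * phi a + (b - a) * phi c) in h => //.
by field; rewrite gt_eqF.
Qed.

(** Concavity along a chord from the origin, where [phi] vanishes. This yields the doubling bound
    [phi_scale] and the continuity of [phi] at positive points. *)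
Lemma phi_ratio s t : 0 < s -> s <= t -> s * phi t <= t * phi s.
Proof.
move=> s0; rewrite le_eqVlt => /predU1P[<-//|st].
by have := phi_concave (lexx 0) s0 st; rewrite phi0; lra.
Qed.

Lemma phi_scale (k t : R) : 1 <= k -> 0 < t -> phi (k * t) <= k * phi t.
Proof.
move=> k1 t0; have k0 : 0 < k by apply: lt_le_trans k1.
have tk : t <= k * t by rewrite ler_peMl// ltW.
by have := phi_ratio t0 tk; rewrite mulrAC [leRHS]mulrC ler_pM2l.
Qed.

Lemma right_limit_le x y : 0 <= x -> x < y -> F x <= phi y.
Proof.
move=> x0 xy; rewrite /right_limit_fun ltNge x0/=.
rewrite -[phi y]ger0_norm ?phi_ge0 ?(le_trans x0 (ltW xy))//.
apply: ge_inf; first exact: right_limit_fun_lb.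
by exists y => //=; rewrite in_itv/= xy.
Qed.

Lemma right_limit_ge x (c : R) : 0 <= x -> (forall y, x < y -> c <= phi y) -> c <= F x.
Proof.
move=> x0 h; rewrite /right_limit_fun ltNge x0/=.
apply: lb_le_inf; first exact: right_limit_fun_itvN.
move=> _ [y + <-]; rewrite /= in_itv/= andbT => xy.
by apply: le_trans (h _ xy) (ler_norm _).
Qed.

(** [phi_ratio] excludes a jump to the right of [x]: at [y = x + e * x / phi x] it gives
    [phi y <= phi x + e]. *)
Lemma right_limit_pos x : 0 < x -> F x = phi x.
Proof.
move=> x0; apply/eqP; rewrite eq_le; apply/andP; split; last first.
  by apply: right_limit_ge; [exact: ltW|move=> y /ltW; apply: phi_le; exact: ltW].
apply/ler_addgt0Pr => e e0; have px := phi_gt0 x0.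
have d0 : 0 < e * x / phi x by rewrite divr_gt0// mulr_gt0.
have xy : x < x + e * x / phi x by rewrite ltrDl.
apply: le_trans (right_limit_le (ltW x0) xy) _.
have := phi_ratio x0 (ltW xy).
move=> h; rewrite -(ler_pM2l x0); apply: le_trans h _.
by rewrite le_eqVlt; apply/orP; left; apply/eqP; field; rewrite gt_eqF.
Qed.

Lemma right_limit_neg x : x < 0 -> F x = 0.
Proof. by rewrite /right_limit_fun => ->. Qed.

(** The limit [phi (0+)], which is the mass of the atom of [dphi] at 0. *)
Definition phi0p := F 0.

Lemma phi0p_ge0 : 0 <= phi0p.
Proof. by apply: right_limit_ge => // y y0; rewrite ltW// phi_gt0. Qed.

Lemma phi0p_le t : 0 < t -> phi0p <= phi t.
Proof. exact: right_limit_le. Qed.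

Lemma phi0p_adherent (e : R) : phi0p < e -> exists2 t, 0 < t & phi t < e.
Proof.
move=> he; apply: contrapT => h.
have : e <= phi0p.
  apply: right_limit_ge => // y y0; rewrite leNgt; apply/negP => hy.
  by apply: h; exists y.
by rewrite leNgt he.
Qed.

Lemma stieltjes_oc a b : a <= b -> m `]a, b]%classic = (F b - F a)%:E.
Proof.
move=> ab; rewrite /stieltjes/= /lebesgue_stieltjes_measure/= /measure_extension/=.
rewrite measurable_mu_extE; last exact: is_ocitv.
exact: wlength_itv_bnd.
Qed.

(** The measure is known on half-open intervals []a, b]], so []-1, 0[] is exhausted by those ending
    at [- n.+1%:R^-1]. Removing it from []-1, t]] gives the mass of [[0, t]] with the atom
    included. *)
Lemma stieltjes_neg : m `]-1, 0[%classic = 0%E.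
Proof.
apply/eqP; rewrite -measure_le0.
have -> : `]-1, 0[%classic = \bigcup_n `](-1 : R), - n.+1%:R^-1]%classic.
  apply/seteqP; split => x /=.
    rewrite in_itv/= => /andP[x1 x0].
    have : 0 < - x by rewrite oppr_gt0.
    move=> /ltr_add_invr[n]; rewrite add0r => hn; exists n => //=.
    by rewrite in_itv/= x1/= lerNr ltW.
  move=> [n _]; rewrite /= !in_itv/= => /andP[-> xn]/=.
  by apply: le_lt_trans xn _; rewrite oppr_lt0.
apply: (le_trans (@measure_sigma_subadditive _ R _ m _
  (fun n => `](-1 : R), - n.+1%:R^-1]%classic) _ _ _)) => //=.
- by apply: bigcup_measurable => n _; exact: measurable_itv.
rewrite eseries0// => n _ _; rewrite stieltjes_oc.
  by rewrite !right_limit_neg ?subrr// oppr_lt0.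
by rewrite lerN2 invf_le1// ler1n.
Qed.

Lemma stieltjes_0c t : 0 <= t -> m `[0, t]%classic = (F t)%:E.
Proof.
move=> t0; have n1 : (-1 : R) < 0 by rewrite oppr_lt0.
have : m `]-1, t]%classic = m (`]-1, 0[%classic `|` `[0, t]%classic).
  congr (m _); rewrite -itv_bndbnd_setU// bnd_simp.
rewrite measureU//=; last first.
  by apply/seteqP; split => x //=; rewrite !in_itv/= => -[/andP[_ x0] /andP[]]; rewrite leNgt x0.
rewrite stieltjes_neg add0e stieltjes_oc; last by rewrite (le_trans _ t0)// ltW.
by move=> <-; rewrite (right_limit_neg n1) subr0.
Qed.

Lemma stieltjes_0cE t : 0 < t -> m `[0, t]%classic = (phi t)%:E.
Proof. by move=> t0; rewrite stieltjes_0c ?ltW// right_limit_pos. Qed.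

Lemma stieltjes_set0 : m [set 0] = phi0p%:E.
Proof. by rewrite -[RHS]stieltjes_0c// set_itv1. Qed.

Lemma stieltjes_oo t : 0 <= t -> m `]0, t]%classic = (F t - phi0p)%:E.
Proof. exact: stieltjes_oc. Qed.

Lemma stieltjes_0o t : 0 < t -> ((phi t)%:E <= m `[0%R, t[%classic)%E.
Proof.
move=> t0; apply/lee_addgt0Pr => e e0.
(* By [phi_ratio], moving left by [d] lowers [phi] by at most [d * phi t / t], hence by at most [e];
   the bound [t / 2] keeps [t - d] positive. *)
pose d := Num.min (t / 2) (e * t / phi t).
have pt := phi_gt0 t0.
have d0 : 0 < d by rewrite /d lt_min divr_gt0//= divr_gt0// mulr_gt0.
have dt : d <= t / 2 by rewrite /d ge_min lexx.
have de : d <= e * t / phi t by rewrite /d ge_min lexx orbT.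
have s0 : 0 < t - d by lra.
apply: (@le_trans _ _ (m `[0%R, (t - d)%R]%classic + e%:E)%E); last first.
  rewrite leeD2r// le_measure ?inE//.
  by move=> x /=; rewrite !in_itv/= => /andP[-> h]/=; lra.
rewrite stieltjes_0cE// -EFinD lee_fin.
have h : (t - d) * phi t <= t * phi (t - d) by apply: phi_ratio => //; lra.
rewrite -(ler_pM2l t0) mulrDr; apply: le_trans (_ : (t - d) * phi t + t * e <= _); last by rewrite lerD2r.
move: de; rewrite ler_pdivlMr//; nra.
Qed.

(** [Lam] and [Mst] are [Lambda] and [Mstar] expressed through the fundamental function; they are
    convertible to them when [phi] is [fundamental X]. *)
Definition Lam (f : R -> R) : \bar R := (\int[m]_(t in I) rearr f t)%E.
Definition Mst (f : R -> R) : \bar R := ereal_sup [set ((phi t)%:E * rearr f t)%E | t in I].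
Definition prim (f : R -> R) t : \bar R := (\int[m]_(s in `[0%R, t]) rearr f s)%E.

Lemma sub0I t : `[0, t] `<=` I.
Proof. by move=> x /=; rewrite halflineE in_itv/= => /andP[]. Qed.

Lemma mIG : measurable (I : set GR).
Proof. exact: measurable_itv. Qed.

Lemma measurable_rearr_itv f t : measurable_fun (`[0, t]%classic : set GR) (rearr f).
Proof. by apply: (measurable_funS mIG _ (@measurable_rearr R f)); exact: sub0I. Qed.

Lemma prim_ge0 f t : (0 <= prim f t)%E.
Proof. by apply: integral_ge0 => x _; exact: rearr_ge0. Qed.

Lemma prim_le_Lam f t : (prim f t <= Lam f)%E.
Proof.
apply: ge0_subset_integral => //; [exact: mIG|exact: measurable_rearr|by move=> x _; exact: rearr_ge0|].
exact: sub0I.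
Qed.

Lemma rearr_le_prim f t : 0 < t -> ((phi t)%:E * rearr f t <= prim f t)%E.
Proof.
move=> t0; rewrite muleC -stieltjes_0cE// -integral_cst//.
apply: ge0_le_integral => //.
- by move=> x _; exact: rearr_ge0.
- exact: measurable_rearr_itv.
- by move=> x /=; rewrite in_itv/= => /andP[_]; exact: le_rearr.
Qed.

(** The atom of [dphi] at 0 sees the essential supremum: if [phi0p phi] is positive, [Lam] controls
    the [L^oo] norm. *)
Lemma rearr0_le_Lam f : (phi0p%:E * rearr f 0 <= Lam f)%E.
Proof.
rewrite muleC -stieltjes_set0 -integral_cst; last exact: measurable_set1.
apply: (@le_trans _ _ (\int[m]_(x in [set 0%R]) rearr f x)%E).
  apply: ge0_le_integral => //.
  - by move=> x _; exact: rearr_ge0.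
  - by apply: (measurable_funS mIG _ (@measurable_rearr R f)) => x ->; rewrite halflineE.
  - by move=> x ->.
apply: ge0_subset_integral => //; [exact: mIG|exact: measurable_rearr|by move=> x _; exact: rearr_ge0|].
by move=> x ->; rewrite halflineE.
Qed.

Lemma Lam_ge0 f : (0 <= Lam f)%E.
Proof. by apply: integral_ge0 => x _; exact: rearr_ge0. Qed.

Lemma Mst_ge0 f : (0 <= Mst f)%E.
Proof.
apply: le_ereal_sup_tmp; exists 0%E => //; exists 0; first by rewrite halflineE.
by rewrite phi0 mul0e.
Qed.

Lemma Mst_ub f t : 0 <= t -> ((phi t)%:E * rearr f t <= Mst f)%E.
Proof. by move=> t0; apply: ereal_sup_ubound; exists t => //; rewrite halflineE. Qed.

Lemma Mst_le f (x : \bar R) : (0 <= x)%E ->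
  (forall t, 0 < t -> ((phi t)%:E * rearr f t <= x)%E) -> (Mst f <= x)%E.
Proof.
move=> x0 h; apply: ge_ereal_sup => _ [t It <-]; move: It; rewrite halflineE.
by rewrite [0 <= t]le_eqVlt => /predU1P[<-|/h//]; rewrite phi0 mul0e.
Qed.

Lemma Mst_le_Lam f : (Mst f <= Lam f)%E.
Proof.
apply: Mst_le => [|t t0]; first exact: Lam_ge0.
by apply: le_trans (rearr_le_prim f t0) (prim_le_Lam f t).
Qed.

(** The [dphi]-mean over [[0, t]] of the nonincreasing [rearr f] can only grow as [t] decreases. On
    []t, 1]], [rearr f] is at most [rearr f t], which is at most its mean over [[0, t]]. *)
Lemma prim_average f t : 0 < t -> t <= 1 -> ((phi t)%:E * prim f 1 <= (phi 1)%:E * prim f t)%E.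
Proof.
move=> t0; rewrite le_eqVlt => /predU1P[->//|t1].
have mr := @measurable_rearr R f; move/ltW: (t1) => t1'.
have p0 := phi_gt0 t0; have := phi_le (ltW t0) t1' => pt1.
have sub : `]t, 1] `<=` I.
  by move=> x /=; rewrite halflineE in_itv/= => /andP[/ltW tx _]; rewrite (le_trans (ltW t0)).
have -> : prim f 1 = (prim f t + \int[m]_(s in `]t, 1%R]) rearr f s)%E.
  rewrite /prim -ge0_integral_setU//=.
  - congr (integral _ _ _); rewrite -itv_bndbnd_setU// bnd_simp//.
    exact: ltW.
  - apply: (measurable_funS mIG _ mr); rewrite -itv_bndbnd_setU ?bnd_simp ?ltW//.
    exact: sub0I.
  - by move=> x _; exact: rearr_ge0.
  - rewrite disj_set2E; apply/eqP/seteqP; split => x //=; rewrite !in_itv/=.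
    by move=> [/andP[_ xt] /andP[]]; rewrite ltNge xt.
rewrite ge0_muleDr; [|exact: prim_ge0|by apply: integral_ge0 => x _; exact: rearr_ge0].
apply: (@le_trans _ _ ((phi t)%:E * prim f t + (phi 1 - phi t)%:E * prim f t)%E); last first.
  rewrite [X in (_ <= X * _)%E](_ : _ = ((phi t)%:E + (phi 1 - phi t)%:E)%E).
    by rewrite ge0_muleDl// lee_fin ?subr_ge0// ltW.
  by rewrite -EFinD; congr EFin; ring.
rewrite leeD2l//; apply: (@le_trans _ _ ((phi t)%:E * ((phi 1 - phi t)%:E * rearr f t))%E).
  apply: lee_wpmul2l; first by rewrite lee_fin ltW.
  rewrite [leRHS]muleC.
  rewrite -[X in (_ * X)%E](_ : m `]t, 1]%classic = _); last first.
    by rewrite stieltjes_oc// !right_limit_pos.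
  rewrite -integral_cst//; apply: ge0_le_integral => //.
  - by move=> x _; exact: rearr_ge0.
  - exact: (measurable_funS mIG _ mr).
  - by move=> x /=; rewrite in_itv/= => /andP[/ltW tx _]; exact: le_rearr.
rewrite muleCA lee_wpmul2l ?lee_fin ?subr_ge0//; exact: rearr_le_prim.
Qed.

End fundamental_function.

(** * Truncation, and membership in [LI] from a Hardy inequality *)

Section truncation.
Context {R : realType}.
Variable phi : R -> R.
Hypothesis nphi : normalized_fundamental phi.
Local Notation I := (@halfline R).
Local Notation LR := (lebesgueType R).
Local Notation GR := (measurableTypeR R).
Local Notation m := (stieltjes phi).
Implicit Types (f g : R -> R) (s t c : R) (M : (R -> R) -> \bar R).

Lemma rearr_cst0 t : 0 <= t -> rearr (fun _ : R => 0 : R) t = 0%E.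
Proof.
move=> t0; have m0 : lmeasurable (fun _ : R => 0 : R) by exact: measurable_cst.
have -> : (fun _ : R => 0 : R) = fun x => 0 * (fun _ : R => 0 : R) x.
  by apply/funext => x; rewrite mul0r.
by rewrite rearrZ// normr0 mul0e.
Qed.

Lemma in_Linfty0 : in_space Linfty (fun _ : R => 0 : R).
Proof.
have m0 : lmeasurable (fun _ : R => 0 : R) by exact: measurable_cst.
by split => //; rewrite Linfty_rearr// rearr_cst0.
Qed.

Lemma sum_Linfty_le M f g h : in_space M g -> in_space Linfty h ->
  aeI_eq f (fun x => g x + h x) -> (sum_Linfty M f <= M g + Linfty h)%E.
Proof. by move=> sg sh fE; apply: ereal_inf_lbound; exists g, h; split. Qed.

Lemma sum_Linfty_l M f : in_space M f ->
  in_space (sum_Linfty M) f /\ (sum_Linfty M f <= M f)%E.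
Proof.
move=> sf; have h : (sum_Linfty M f <= M f)%E.
  apply: le_trans (sum_Linfty_le sf in_Linfty0 _) _.
    by apply: aeIW => x _; rewrite addr0.
  rewrite Linfty_rearr ?rearr_cst0 ?adde0//; exact: measurable_cst.
by split => //; split; [case: sf|case: sf => _; exact: le_lt_trans].
Qed.

Lemma sum_Linfty_r M f : (M (fun _ : R => 0%R) <= 0)%E ->
  lmeasurable (fun _ : R => 0 : R) -> in_space Linfty f ->
  (sum_Linfty M f <= Linfty f)%E.
Proof.
move=> M0 m0 sf.
apply: le_trans (sum_Linfty_le (M := M) (g := fun _ => 0) _ sf _) _.
- by split => //; exact: le_lt_trans M0 _.
- by apply: aeIW => x _; rewrite add0r.
by rewrite -[leRHS]add0e; apply: leeD.
Qed.

(** [f1] is [f] clamped to [[-c, c]]. The remainder [f0] is dominated by [f] and lives on the set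
    where [|f|] exceeds [c], of measure at most [t], so its [Lam] norm is an integral over
    [[0, t]]. *)
Lemma truncation f t c : lmeasurable f -> 0 < t -> 0 <= c ->
  (rearr f t <= c%:E)%E ->
  exists f0 f1 : R -> R, [/\ lmeasurable f0, lmeasurable f1,
    f = (fun x => f0 x + f1 x), (rearr f1 0 <= c%:E)%E &
    (Lam phi f0 <= prim phi f t)%E].
Proof.
move=> mf t0 c0 ftc.
pose f1 x := Num.max (- c) (Num.min (f x) c).
have mf1 : lmeasurable f1.
  apply: measurable_maxr; first exact: measurable_cst.
  by apply: measurable_minr => //; exact: measurable_cst.
pose f0 x := f x + -1 * f1 x.
have mf0 : lmeasurable f0 by apply: lmeasurableD => //; exact: lmeasurableZ.
have f1c x : `|f1 x| <= c.
  rewrite /f1 ler_norml le_max lexx/= ge_max ge_min lexx orbT andbT.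
  by rewrite (le_trans _ c0)// oppr_le0.
have f0f x : `|f0 x| <= `|f x|.
  rewrite /f0 /f1; case: (leP (f x) c) => h1; case: (leP (- c) _) => h2.
  - by rewrite mulN1r subrr normr0.
  - by rewrite !ler0_norm; lra.
  - by rewrite !ger0_norm; lra.
  - lra.
have f00 x : `|f x| <= c -> f0 x = 0.
  rewrite ler_norml => /andP[h1 h2]; rewrite /f0 /f1.
  by rewrite (min_idPl h2) (max_idPr h1) mulN1r subrr.
exists f0, f1; split; [exact: mf0|exact: mf1| | |].
- by apply/funext => x; rewrite /f0; ring.
- rewrite rearr_le_fin// /distr (_ : level f1 c = set0) ?measure0//.
  by apply/seteqP; split => x // [_]; rewrite ltNge f1c.
have z s : t <= s -> rearr f0 s = 0%E.
  move=> ts; apply/eqP; rewrite eq_le rearr_ge0 andbT rearr_le_fin//.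
  apply: (@le_trans _ _ (distr f c)).
    apply: le_measure; rewrite ?inE; [exact: measurable_level|exact: measurable_level|].
    move=> x [Ix fx]; split => //; rewrite ltNge; apply/negP => /f00 fx0.
    by move: fx; rewrite fx0 normr0 ltxx.
  apply: (@le_trans _ _ t%:E); last by rewrite lee_fin.
  by rewrite -rearr_le_fin.
have mle s : (rearr f0 s <= rearr f s)%E.
  by apply: rearr_mono => //; apply: aeIW => x _; exact: f0f.
rewrite /Lam.
have -> : I = `[0, t]%classic `|` `]t, +oo[%classic.
  by rewrite -itv_bndbnd_setU// bnd_simp// ltW.
rewrite ge0_integral_setU//=.
- rewrite [X in (_ + X)%E](_ : _ = 0%E) ?adde0.
    apply: ge0_le_integral => //.
    + by move=> x _; exact: rearr_ge0.
    + exact: measurable_rearr_itv.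
    + exact: measurable_rearr_itv.
  apply: integral0_eq => x; rewrite /= in_itv/= andbT => /ltW; exact: z.
- rewrite -itv_bndbnd_setU// ?bnd_simp// ?ltW//; exact: measurable_rearr.
- by move=> x _; exact: rearr_ge0.
- rewrite disj_set2E; apply/eqP/seteqP; split => x //=; rewrite !in_itv/= andbT.
  by move=> [/andP[_ xt]]; rewrite ltNge xt.
Qed.

Lemma Linfty_le f c : lmeasurable f -> (rearr f 0 <= c%:E)%E ->
  in_space Linfty f /\ (Linfty f <= c%:E)%E.
Proof.
move=> mf fc; rewrite /in_space Linfty_rearr//; split => //; split => //.
exact: le_lt_trans fc (ltry _).
Qed.

(* [prim phi f] plays the role of the K-functional of the couple
   [(Lambda(X), L^oo)] at [phi t]. *)
Lemma interpolation_bound (T : (R -> R) -> (R -> R)) :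
  linear_op (sum_Linfty (Lam phi)) (sum_Linfty (Mst phi)) T ->
  bounded_op (Lam phi) (Mst phi) T -> bounded_op Linfty Linfty T ->
  exists2 C : R, 0 < C & forall f, in_space (sum_Linfty (Lam phi)) f ->
    lmeasurable (T f) /\ forall t, 0 < t ->
      ((phi t)%:E * rearr (T f) t <= C%:E * prim phi f t)%E.
Proof.
move=> [Tsp Tae Tlin] [C0 C00 T0] [C1 C10 T1].
exists (C0 + C1); first exact: addr_gt0.
move=> f sf; have [mTf _] := Tsp _ sf; split => // t t0.
have [mf _] := sf; have pt := phi_gt0 nphi t0.
have := prim_ge0 phi f t; case eH : (prim phi f t) => [H| |] // H0; last first.
  by rewrite gt0_muley ?leey// lte_fin addr_gt0.
have rH : ((phi t)%:E * rearr f t <= H%:E)%E by rewrite -eH; exact: rearr_le_prim.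
have rfin : rearr f t \is a fin_num.
  rewrite ge0_fin_numE ?rearr_ge0//; move: rH; case: (rearr f t) => [r| |] //.
    by rewrite ltry.
  by rewrite gt0_muley.
pose c := fine (rearr f t).
have c0 : 0 <= c by rewrite fine_ge0 ?rearr_ge0.
have cE : rearr f t = c%:E by rewrite fineK.
have [|f0 [f1 [mf0 mf1 fE f1c Lf0]]] := truncation mf t0 c0 _; first by rewrite cE.
have sf0 : in_space (Lam phi) f0.
  by split => //; apply: le_lt_trans Lf0 _; rewrite eH ltry.
have [sf1 Lf1] := Linfty_le mf1 f1c.
have [sTf0 Tf0] := T0 _ sf0; have [sTf1 Tf1] := T1 _ sf1.
have [s0 _] := sum_Linfty_l sf0.
have s1 : in_space (sum_Linfty (Lam phi)) f1.
  split => //; have m0 : lmeasurable (fun _ : R => 0 : R) by exact: measurable_cst.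
  apply: le_lt_trans (sum_Linfty_r _ m0 sf1) _; last by case: sf1.
  rewrite /Lam integral0_eq// => x; rewrite halflineE => x0.
  exact: rearr_cst0.
have mTf0 : lmeasurable (T f0) by case: sTf0.
have mTf1 : lmeasurable (T f1) by case: sTf1.
have -> : rearr (T f) t = rearr (fun x => T f0 x + T f1 x) t.
  congr (_ t); apply: eq_rearr => //; first exact: lmeasurableD.
  have := Tlin 1 _ _ s0 s1.
  rewrite (_ : (fun x => 1 * f0 x + f1 x) = f); last first.
    by rewrite fE; apply/funext => x; rewrite mul1r.
  by move/aeI_mono; apply => x _ ->; rewrite mul1r.
(* The image of the bounded part is bounded, so its rearrangement is taken at 0. Splitting [t] as
   [t + 0] leaves the argument [t] without dilation. *)
have : (rearr (fun x => (T f0 x + T f1 x)%R) t <= rearr (T f0) t + rearr (T f1) 0)%E.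
  by have := rearrD t 0 mTf0 mTf1; rewrite addr0.
move=> /(lee_wpmul2l (x := (phi t)%:E)); rewrite lee_fin => /(_ (ltW pt)) h.
apply: le_trans h _.
rewrite ge0_muleDr ?rearr_ge0// EFinD ge0_muleDl ?lee_fin ?(ltW C00) ?(ltW C10)//; apply: leeD.
  apply: le_trans (Mst_ub _ _ (ltW t0)) _; apply: le_trans Tf0 _.
  by rewrite -eH lee_pmul2l ?lte_fin.
rewrite -Linfty_rearr//.
apply: (@le_trans _ _ ((phi t)%:E * (C1%:E * c%:E))%E).
  rewrite lee_pmul2l ?lte_fin//; apply: le_trans Tf1 _.
  by rewrite lee_pmul2l ?lte_fin.
by rewrite muleCA lee_pmul2l ?lte_fin// -cE.
Qed.

Variable J : (R -> \bar R) -> \bar R.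
Hypothesis rJ : ri_functional J.
(** Stated for any antitone [g] below the Hardy transform [prim phi f t / phi t], so that it applies
    directly to a multiple of [rearr (T f)] and to the test functions below. *)
Hypothesis hardy : exists2 C : R, 0 < C &
  forall (f : R -> R) (g : R -> \bar R), lmeasurable f -> antitone g ->
  (forall t, 0 < t -> ((phi t)%:E * g t <= prim phi f t)%E) ->
  (J g <= C%:E * J (rearr f))%E.
Local Notation N := (fun f => J (rearr f)).


Lemma embeds_sum : exists2 C : R, 0 < C & forall f, in_space N f ->
  in_space (sum_Linfty (Lam phi)) f /\ (sum_Linfty (Lam phi) f <= C%:E * N f)%E.
Proof.
have [C C0 hC] := hardy; have [k [k0 hk]] := rif_weak rJ.
have p1 : 0 < phi 1 by exact: phi_gt0.
have ex : exists2 C' : R, 0 < C' & forall f, in_space N f -> (prim phi f 1 <= C'%:E * N f)%E.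
  exists (phi 1 / k 1 * C); first by rewrite mulr_gt0// divr_gt0// k0.
  move=> f [mf Jf].
  (* The mean of [rearr f] over [[0, 1]], as a step on the nonnegative axis. It lies below the Hardy
     transform by [prim_average], and [rif_weak] at 1 then reads off [prim phi f 1]. *)
  pose g t : \bar R := if t <= 1 then ((phi 1)^-1%:E * prim phi f 1)%E else 0%E.
  have g0 t : (0 <= g t)%E.
    by rewrite /g; case: ifP => // _; rewrite mule_ge0 ?prim_ge0// lee_fin invr_ge0 ltW.
  have ag : antitone g.
    split => // s t st; rewrite {1}/g; case: ifPn => [t1|_]; last exact: g0.
    by rewrite /g (le_trans st t1).
  have Jg : (J g <= C%:E * N f)%E.
    apply: hC => // t t0; rewrite /g; case: ifPn => [t1|_]; last by rewrite mule0 prim_ge0.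
    by rewrite muleCA lee_pdivrMl//; exact: prim_average.
  have := le_trans (hk 1 g ltr01 ag) Jg.
  rewrite {1}/g lexx muleAC -EFinM -lee_pdivlMl; last by rewrite mulr_gt0 ?invr_gt0 ?k0.
  move=> /le_trans; apply; rewrite muleA -EFinM.
  by rewrite invfM invrK.
have [C' C'0 h'] := ex; exists (C' + (phi 1)^-1 * C').
  by rewrite addr_gt0// mulr_gt0// invr_gt0.
move=> f sf; have [mf Jf] := sf; have h := h' f sf.
have N0 : (0 <= N f)%E by apply: (rif_ge0 rJ); exact: antitone_rearr.
have NfE : N f = (fine (N f))%:E by rewrite fineK// ge0_fin_numE.
have rc : (rearr f 1 <= ((phi 1)^-1 * (C' * fine (N f)))%:E)%E.
  rewrite EFinM lee_pdivlMl//; apply: le_trans (rearr_le_prim nphi f ltr01) _.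
  by rewrite EFinM -NfE.
have [|f0 [f1 [mf0 mf1 fE f1c Lf0]]] := truncation mf ltr01 _ rc.
  by rewrite mulr_ge0 ?invr_ge0 ?(ltW p1)// mulr_ge0 ?(ltW C'0)// fine_ge0.
have sf0 : in_space (Lam phi) f0.
  split => //; apply: le_lt_trans Lf0 _; apply: le_lt_trans h _.
  by rewrite NfE -EFinM ltry.
have [sf1 Lf1] := Linfty_le mf1 f1c.
have le1 : (sum_Linfty (Lam phi) f <= (C' + (phi 1)^-1 * C')%:E * N f)%E.
  apply: le_trans (sum_Linfty_le sf0 sf1 _) _; first by rewrite fE; exact: aeIW.
  rewrite NfE -EFinM mulrDl EFinD; apply: leeD.
    by apply: le_trans Lf0 _; rewrite EFinM -NfE.
  by apply: le_trans Lf1 _; rewrite lee_fin mulrA.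
split => //; split => //; apply: le_lt_trans le1 _; by rewrite NfE -EFinM ltry.
Qed.

(** A function of norm [n] in the intersection satisfies [phi t * rearr f t <= n * min (phi t) 1].
    The right side is at most a multiple of [prim phi chi t], so the Hardy inequality bounds [N f]
    by a multiple of [n * N chi]. *)
Lemma embeds_cap : embeds (cap_Linfty (Mst phi)) N.
Proof.
have [C C0 hC] := hardy.
have p1 : 0 < phi 1 by exact: phi_gt0.
pose chi : R -> R := \1_(`[0, 1]%classic : set R).
have mchi : lmeasurable chi.
  by apply: measurable_indic; exact: lebesgue_itv.
have Nchi : (N chi < +oo)%E.
  apply: (le_lt_trans _ (rif_step rJ ltr01 (@ltr0n R 2 : 0 < 2%:R))).
  apply: (rif_le rJ); first exact: antitone_rearr.
    split => [t|s t st]; first by case: ifP => _; rewrite ?lee_fin.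
    by case: ifPn => tL; rewrite ?(le_lt_trans st tL)//; case: ifPn => _; rewrite ?lee_fin.
  move=> t t0; case: ifPn => [_|].
    apply: (@rearr_ub R chi (fun=> 1)) => //; apply: aeIW => x _ _.
    by rewrite /chi indicE ger0_norm// lern1 leq_b1.
  rewrite -leNgt => t2; rewrite rearr_le_fin//.
  apply: (@le_trans _ _ ((@leb R) `[0, 1]%classic)); last first.
    by rewrite leb_itv/= lte_fin ltr01 sube0 lee_fin; lra.
  apply: le_measure; rewrite ?inE; [exact: measurable_level|exact: lebesgue_itv|].
  move=> x [_]; rewrite /chi indicE normr_gt0; case: (boolP (x \in _)); first by rewrite inE.
  by rewrite eqxx.
have rchi t : t < 1 -> (1%:E <= rearr chi t)%E.
  move=> t1; apply: (@rearr_lb R chi `[0, 1]%classic) => //; first exact: lebesgue_itv.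
  - exact: sub0I.
  - by rewrite leb_itv/= lte_fin ltr01 sube0 lte_fin.
  - by move=> x x01; rewrite /chi indicE mem_set// normr1.
(* For [t < 1] the factor 1 suffices, as [rearr chi t >= 1]; for [t >= 1] the integral is at least
   [phi 1], and [D * phi 1 >= 1]. *)
pose D := Num.max 1 (phi 1)^-1.
have D1 : 1 <= D by rewrite le_max lexx.
have D0 : 0 < D by apply: lt_le_trans D1.
have primchi t : 0 < t -> ((Num.min (phi t) 1%R)%:E <= D%:E * prim phi chi t)%E.
  move=> t0; have pt := phi_gt0 nphi t0.
  have [t1|t1] := ltP t 1.
    apply: (@le_trans _ _ (1%:E * (phi t)%:E)%E); first by rewrite mul1e lee_fin ge_min lexx.
    apply: lee_pmul => //; rewrite ?lee_fin// ?(ltW pt)//.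
    by apply: le_trans (rearr_le_prim nphi _ t0); rewrite -[leLHS]mule1 lee_pmul2l ?lte_fin// rchi.
  have h1 : ((phi 1)%:E <= prim phi chi 1)%E.
    apply: le_trans (stieltjes_0o nphi ltr01) _.
    rewrite -[leLHS]mul1e -integral_cst//.
    apply: (@le_trans _ _ (\int[m]_(x in `[0%R, 1%R[) rearr chi x)%E).
      apply: ge0_le_integral => //.
      + apply: measurable_funS (@measurable_rearr R chi); first exact: mIG.
        by move=> x /=; rewrite halflineE in_itv/= => /andP[].
      + by move=> x /=; rewrite in_itv/= => /andP[_]; exact: rchi.
    apply: ge0_subset_integral => //.
    + exact: measurable_rearr_itv.
    + by move=> x _; exact: rearr_ge0.
    + by move=> x /=; rewrite !in_itv/= => /andP[-> /ltW].
  apply: (@le_trans _ _ (D%:E * (phi 1)%:E)%E).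
    rewrite -EFinM lee_fin; apply: (@le_trans _ _ 1); first by rewrite ge_min lexx orbT.
    by rewrite -ler_pdivrMr// div1r /D le_max lexx orbT.
  rewrite lee_pmul2l ?lte_fin//; apply: le_trans h1 _.
  apply: ge0_subset_integral => //.
  + exact: measurable_rearr_itv.
  + by move=> x _; exact: rearr_ge0.
  + by move=> x /=; rewrite !in_itv/= => /andP[-> /le_trans]; apply.
have Nchi0 : (0 <= N chi)%E by apply: (rif_ge0 rJ); exact: antitone_rearr.
(* The summand 1 makes the constant positive without a lower bound on [N chi]. *)
exists (C * D * (fine (N chi) + 1)); first by rewrite !mulr_gt0// ltr_wpDl// fine_ge0.
move=> f [mf]; rewrite /cap_Linfty gt_max => /andP[Mf Lf].
set n := maxe (Mst phi f) (Linfty f).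
have n0 : (0 <= n)%E by rewrite /n le_max Mst_ge0.
have nfin : (n < +oo)%E by rewrite /n gt_max Mf.
have nE : n = (fine n)%:E by rewrite fineK// ge0_fin_numE.
have fn0 : 0 <= fine n by rewrite fine_ge0.
pose F x := D * fine n * chi x.
have mF : lmeasurable F by exact: lmeasurableZ.
have h : (N f <= C%:E * N F)%E.
  apply: hC => //; first exact: antitone_rearr.
  move=> t t0; have pt := phi_gt0 nphi t0.
  have -> : prim phi F t = ((D * fine n)%:E * prim phi chi t)%E.
    rewrite /prim -ge0_integralZl//.
    - apply: eq_integral => x; rewrite inE/= in_itv/= => /andP[x0 _].
      by rewrite rearrZ// ger0_norm// mulr_ge0// ltW.
    - exact: measurable_rearr_itv.
    - by move=> x _; exact: rearr_ge0.
    - by rewrite lee_fin mulr_ge0// ltW.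
  rewrite mulrC EFinM -muleA; apply: le_trans (_ : (fine n)%:E * (Num.min (phi t) 1%R)%:E <= _)%E; last first.
    by apply: lee_wpmul2l; [rewrite lee_fin|exact: primchi].
  have b1 : ((phi t)%:E * rearr f t <= n)%E.
    by rewrite /n le_max (Mst_ub _ _ (ltW t0)).
  have b2 : (rearr f t <= n)%E.
    rewrite /n le_max -[X in _ || X]/(_ <= Linfty f)%E Linfty_rearr//.
    by rewrite [X in _ || X]le_rearr ?orbT// ltW.
  rewrite /Num.min; case: ifP => _; last by rewrite mule1 -nE.
  rewrite muleC -nE; apply: lee_wpmul2r => //; by rewrite lee_fin ltW.
have NF : N F = ((D * fine n)%:E * N chi)%E.
  have Dn : 0 <= D * fine n by rewrite mulr_ge0// ltW.
  rewrite -(rifZ rJ)//; last exact: antitone_rearr.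
  apply: (rif_eq rJ); [exact: antitone_rearr| |].
    by apply: antitoneZ => //; exact: antitone_rearr.
  by move=> t t0; rewrite rearrZ// ?ltW// ger0_norm.
have fin : (N f <= (C * D * (fine (N chi) + 1))%:E * n)%E.
  apply: le_trans h _; rewrite NF nE -(fineK (_ : N chi \is a fin_num)) ?ge0_fin_numE//.
  rewrite -!EFinM lee_fin /=.
  rewrite (_ : C * (D * fine n * fine (N chi)) = (C * D * fine n) * fine (N chi)); last by ring.
  rewrite (_ : C * D * (fine (N chi) + 1) * fine n = (C * D * fine n) * (fine (N chi) + 1)); last by ring.
  by rewrite ler_wpM2l ?lerDl// !mulr_ge0// ltW.
split => //; split => //; apply: le_lt_trans fin _; by rewrite nE -EFinM ltry.
Qed.

(** Since [Mst] is at most [Lam], the intersection embedding for [Mst] implies the one for [Lam],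
    and the sum embedding for [Lam] implies the one for [Mst]. The operator bound is
    [interpolation_bound] followed by the Hardy inequality. *)
Lemma LI_of_hardy : LI (Lam phi) (Mst phi) N N.
Proof.
have qb := rif_quasi_banach_ri rJ; have [E E0 hE] := embeds_sum.
have [D D0 hD] := embeds_cap.
split => //.
- split; last by exists E.
  exists D => // f [mf]; rewrite /cap_Linfty gt_max => /andP[Lf If].
  have Mf : in_space (cap_Linfty (Mst phi)) f.
    by split => //; rewrite /cap_Linfty gt_max If andbT (le_lt_trans (Mst_le_Lam nphi f)).
  have [sf h] := hD f Mf; split => //; apply: le_trans h _.
  rewrite lee_pmul2l ?lte_fin// /cap_Linfty ge_max !le_max lexx orbT.
  by rewrite Mst_le_Lam.
- split; first by exists D.
  exists E => // f sf; have [[mf sumf] h] := hE f sf.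
  have le : (sum_Linfty (Mst phi) f <= sum_Linfty (Lam phi) f)%E.
    apply: le_ereal_inf_tmp => _ [g [k [sg sk fE ->]]].
    apply: le_trans (sum_Linfty_le (M := Mst phi) (g := g) _ sk fE) _.
      by case: sg => mg Lg; split => //; exact: le_lt_trans (Mst_le_Lam nphi g) Lg.
    by rewrite leeD2r// Mst_le_Lam.
  by split; [split => //; exact: le_lt_trans le _|exact: le_trans le h].
- move=> T lT bT iT; have [C C0 hC] := interpolation_bound lT bT iT.
  have [K K0 hK] := hardy; exists (C * K); first exact: mulr_gt0.
  move=> f sf; have [mf Jf] := sf; have [sumf _] := hE f sf.
  have [mTf hT] := hC f sumf.
  have ag : antitone (fun t => (C^-1)%:E * rearr (T f) t)%E.
    by apply: antitoneZ; [rewrite invr_ge0 ltW|exact: antitone_rearr].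
  have := hK f _ mf ag; rewrite (rifZ rJ); [|by rewrite invr_ge0 ltW|exact: antitone_rearr].
  have hT' t : 0 < t -> ((phi t)%:E * ((C^-1)%:E * rearr (T f) t) <= prim phi f t)%E.
    by move=> t0; rewrite muleCA lee_pdivrMl//; exact: hT.
  move=> /(_ hT'); rewrite lee_pdivrMl// muleA -EFinM => h.
  split => //; split => //; apply: le_lt_trans h _.
  by rewrite lte_mul_pinfty// lee_fin mulr_ge0// ltW.
Qed.

End truncation.

(** * Powers of extended reals *)

Section power.
Context {R : realType}.
Implicit Types (x y : \bar R) (r : R).

Lemma lee_poweR x y r : 0 <= r -> (0 <= x)%E -> (x <= y)%E -> (poweR x r <= poweR y r)%E.
Proof.
move=> r0 x0 xy; apply: gt0_ler_poweR => //; rewrite in_itv/= leey andbT//.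
exact: le_trans xy.
Qed.

Lemma poweRK x r : 0 < r -> (0 <= x)%E -> poweR (poweR x r) r^-1 = x.
Proof. by move=> r0 x0; rewrite -poweRrM divff ?gt_eqF// poweRe1. Qed.

Lemma poweRVK x r : 0 < r -> (0 <= x)%E -> poweR (poweR x r^-1) r = x.
Proof. by move=> r0 x0; rewrite -poweRrM mulVf ?gt_eqF// poweRe1. Qed.

Lemma poweR_sup (u : nat -> \bar R) r : 0 < r -> (forall n, 0 <= u n)%E ->
  poweR (ereal_sup (range u)) r = ereal_sup (range (fun n => poweR (u n) r)).
Proof.
move=> r0 u0; apply/eqP; rewrite eq_le; apply/andP; split; last first.
  apply: ge_ereal_sup => _ [n _ <-]; apply: lee_poweR; [exact: ltW|exact: u0|].
  by apply: ereal_sup_ubound; exists n.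
pose y := ereal_sup (range (fun n => poweR (u n) r)); rewrite -/y.
have y0 : (0 <= y)%E.
  by apply: le_ereal_sup_tmp; exists (poweR (u 0%N) r); [exists 0%N|exact: poweR_ge0].
rewrite -[leRHS](poweRVK r0 y0); apply: lee_poweR; first exact: ltW.
  by apply: le_ereal_sup_tmp; exists (u 0%N); [exists 0%N|].
apply: ge_ereal_sup => _ [n _ <-].
rewrite -[leLHS](poweRK r0 (u0 n)); apply: lee_poweR; first by rewrite invr_ge0 ltW.
  exact: poweR_ge0.
by apply: ereal_sup_ubound; exists n.
Qed.

Lemma poweR_add_le x y r : 1 <= r -> (0 <= x)%E -> (0 <= y)%E ->
  (poweR (x + y) r <= (2 `^ r)%:E * (poweR x r + poweR y r))%E.
Proof.
move=> r1 x0 y0; have r0 : 0 < r by apply: lt_le_trans r1.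
wlog xy : x y x0 y0 / (x <= y)%E.
  move=> h; have [/h|/ltW/h] := leP x y; first exact.
  by rewrite addeC [X in (_ <= _ * X)%E]addeC; exact.
apply: (@le_trans _ _ (poweR (2%:E * y) r)%E).
  apply: lee_poweR; [exact: ltW|exact: adde_ge0|].
  rewrite (_ : 2%:E = 1%:E + 1%:E)%E; last by rewrite -EFinD.
  by rewrite ge0_muleDl// mul1e leeD2r.
rewrite poweRM// poweR_EFin lee_wpmul2l ?lee_fin ?powR_ge0// leeDr//.
exact: poweR_ge0.
Qed.

End power.

(** * The weighted [L^q] functional for finite [q] *)

Section Lq_functional.
Context {R : realType}.
Variables (q : R) (v : R -> R).
Local Notation I := (@halfline R).
Local Notation mu := (@leb R).
Local Notation LR := (lebesgueType R).
Implicit Types (t r : R) (g h : R -> \bar R).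

Definition primw t : \bar R := (\int[mu]_(x in `[0%R, t]) (v x)%:E)%E.
Local Notation W := primw.

Hypotheses (q1 : 1 <= q) (v0 : forall x, 0 <= v x) (mv : lmeasurable v).
Hypotheses (Wfin : forall t, (W t < +oo)%E)
  (Winf : (\int[mu]_(x in I) (v x)%:E = +oo)%E)
  (Wpos : forall t, 0 < t -> (0 < W t)%E).

Let q0 : 0 < q. Proof. exact: lt_le_trans q1. Qed.

Lemma aeI_pos : aeI (fun x : R => 0 < x).
Proof.
exists [set 0]; split; [exact: borel_lebesgue (measurable_set1 _)|exact: leb_set1|].
move=> x /= h; apply: contrapT => x0; apply: h; rewrite halflineE le_eqVlt.
by case/predU1P => // e; case: x0.
Qed.

Let mve : measurable_fun (I : set LR) (fun x => (v x)%:E).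
Proof. by apply/measurable_EFinP. Qed.

Lemma itvI (b : bool) t r : 0 <= t ->
  [set` Interval (BSide b t) (BRight r)] `<=` I.
Proof.
move=> t0 x /=; rewrite halflineE in_itv/=; case: b => /=.
  by move=> /andP[/(le_trans t0)].
by move=> /andP[/ltW/(le_trans t0)].
Qed.

Lemma mve_sub (A : set R) : A `<=` I ->
  measurable_fun (A : set LR) (fun x => (v x)%:E).
Proof. by move=> AI; apply: measurable_funS mve => //; exact: mI. Qed.

Lemma primw_ge0 t : (0 <= W t)%E.
Proof. by apply: integral_ge0 => x _; rewrite lee_fin. Qed.

Lemma primw_fin t : W t \is a fin_num.
Proof. by rewrite ge0_fin_numE ?primw_ge0. Qed.

Lemma le_intw (A B : set R) : measurable (A : set LR) -> measurable (B : set LR) ->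
  A `<=` B -> B `<=` I ->
  (\int[mu]_(x in A) (v x)%:E <= \int[mu]_(x in B) (v x)%:E)%E.
Proof.
move=> mA mB AB BI; apply: ge0_subset_integral; [exact: mA|exact: mB|exact: mve_sub| |exact: AB].
by move=> x _; rewrite lee_fin.
Qed.

Lemma primw_le t r : t <= r -> (W t <= W r)%E.
Proof.
move=> tr; apply: le_intw; [exact: lebesgue_itv|exact: lebesgue_itv| |exact: sub0I].
by move=> x /=; rewrite !in_itv/= => /andP[-> /le_trans]; apply.
Qed.

Lemma primw_oc t r : 0 <= t -> t <= r ->
  W r = (W t + \int[mu]_(x in `]t, r]) (v x)%:E)%E.
Proof.
move=> t0 tr; rewrite /primw -ge0_integral_setU.
- by congr (integral _ _ _); rewrite -itv_bndbnd_setU// bnd_simp.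
- exact: lebesgue_itv.
- exact: lebesgue_itv.
- apply: mve_sub => x []; last exact: itvI.
  exact: sub0I.
- by move=> x _; rewrite lee_fin.
- rewrite disj_set2E; apply/eqP/seteqP; split => x //=; rewrite !in_itv/=.
  by move=> [/andP[_ xt] /andP[]]; rewrite ltNge xt.
Qed.

Lemma int_primw_o r : 0 < r -> (\int[mu]_(x in `[0%R, r[) (v x)%:E)%E = W r.
Proof.
move=> r0; apply/eqP; rewrite eq_le le_intw ?lebesgue_itv//=; last first.
- exact: sub0I.
- by move=> x /=; rewrite !in_itv/= => /andP[-> /ltW].
- exact: lebesgue_itv.
- exact: lebesgue_itv.
apply: (@le_trans _ _ (\int[mu]_(x in `[0%R, r] `\` [set r]) (v x)%:E)%E).
  rewrite /primw [leLHS](@ge0_negligible_integral _ LR R mu `[0, r]%classic [set r]).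
  - exact: lexx.
  - exact: borel_lebesgue (measurable_set1 _).
  - exact: lebesgue_itv.
  - by apply: mve_sub; exact: sub0I.
  - by move=> x _; rewrite lee_fin.
  - exact: leb_set1.
apply: le_intw.
- by apply: measurableD; [exact: lebesgue_itv|exact: borel_lebesgue (measurable_set1 _)].
- exact: lebesgue_itv.
- by move=> x [] /=; rewrite !in_itv/= => /andP[-> xr] /eqP xr'; rewrite lt_neqAle xr xr'.
- by move=> x /=; rewrite in_itv/= halflineE => /andP[].
Qed.

Lemma primw_large (A : R) : exists2 t, 1 <= t & (A%:E < W t)%E.
Proof.
apply: contrapT => h.
have hA t : 1 <= t -> (W t <= A%:E)%E.
  by move=> t1; rewrite leNgt; apply/negP => tA; apply: h; exists t.
pose F (n : nat) := `[0, n.+1%:R]%classic : set R.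
have ndF : nondecreasing_seq F.
  move=> m n mn; apply/subsetPset => x; rewrite /F/= !in_itv/= => /andP[-> /= xm].
  by apply: le_trans xm _; rewrite ler_nat.
have UF : \bigcup_n F n = I.
  apply/seteqP; split => x; first by move=> [n _]; exact: sub0I.
  rewrite halflineE => x0; exists (Num.truncn x) => //=.
  by rewrite /F/= in_itv/= x0/= ltW// truncnS_gt.
have := @ge0_nondecreasing_set_cvg_integral _ LR R F (fun x => (v x)%:E) mu ndF
  (fun n => lebesgue_itv _) (fun n => mve_sub (@sub0I R n.+1%:R)) (fun n x _ => _).
move=> /(_ _ _) H.
have {}H : (W n.+1%:R @[n --> \oo] --> \int[mu]_(x in I) (v x)%:E)%E.
  by rewrite -UF; apply: H => x; rewrite lee_fin.
have : (\int[mu]_(x in I) (v x)%:E <= A%:E)%E.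
  rewrite -(cvg_lim _ H)//; apply: lime_le; first by apply/cvg_ex; eexists; exact: H.
  by apply: nearW => n; apply: hA; rewrite ler1n.
by rewrite Winf leNgt ltry.
Qed.

Lemma primw0 : W 0 = 0%E.
Proof.
rewrite /primw [LHS](@ge0_negligible_integral _ LR R mu `[0, 0]%classic `[0, 0]%classic).
- by rewrite setDv integral_set0.
- exact: lebesgue_itv.
- exact: lebesgue_itv.
- by apply: mve_sub; exact: sub0I.
- by move=> x _; rewrite lee_fin.
- by have := @leb_itv R `[0, 0]; rewrite /= ltxx.
Qed.

Lemma primw_small (e : R) : 0 < e -> exists2 t, 0 < t & (W t < e%:E)%E.
Proof.
move=> e0; apply: contrapT => h.
have he t : 0 < t -> (e%:E <= W t)%E.
  by move=> t0; rewrite leNgt; apply/negP => tA; apply: h; exists t.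
pose F (n : nat) := `]n.+1%:R^-1, 1]%classic : set R.
have FI n : F n `<=` I by apply: itvI.
have ndF : nondecreasing_seq F.
  move=> m n mn; apply/subsetPset => x; rewrite /F/= !in_itv/= => /andP[mx ->].
  by rewrite andbT (le_lt_trans _ mx)// lef_pV2 ?posrE// ler_nat.
have UF : \bigcup_n F n = `]0, 1]%classic.
  apply/seteqP; split => x; rewrite /= in_itv/=.
    by move=> [n _]; rewrite /F/= in_itv/= => /andP[nx ->]; rewrite andbT (lt_trans _ nx).
  move=> /andP[x0 x1]; have := x0 => /ltr_add_invr[n]; rewrite add0r => hn.
  by exists n => //; rewrite /F/= in_itv/= x1 hn.
have H : (\int[mu]_(x in F n) (v x)%:E @[n --> \oo] --> \int[mu]_(x in `]0%R, 1%R]) (v x)%:E)%E.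
  rewrite -UF; apply: ge0_nondecreasing_set_cvg_integral.
  - exact: ndF.
  - by move=> n; exact: lebesgue_itv.
  - by move=> n; exact: mve_sub.
  - by move=> n x _; rewrite lee_fin.
have W1 : W 1 = (W 0 + \int[mu]_(x in `]0%R, 1%R]) (v x)%:E)%E by exact: primw_oc.
have Hn n : (\int[mu]_(x in F n) (v x)%:E <= (fine (W 1) - e)%:E)%E.
  have n0 : 0 < n.+1%:R^-1 :> R by [].
  have n1 : n.+1%:R^-1 <= 1 :> R by rewrite invf_le1// ler1n.
  have := primw_oc (ltW n0) n1; rewrite -/(F n).
  have := he _ n0; have := primw_fin n.+1%:R^-1.
  case: (W n.+1%:R^-1) => [a| |] // _; rewrite lee_fin => ea.
  have : (0 <= \int[mu]_(x in F n) (v x)%:E)%E.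
    by apply: integral_ge0 => x _; rewrite lee_fin.
  move=> _ W1E; have := primw_fin 1; rewrite W1E.
  case: (\int[mu]_(x in F n) (v x)%:E)%E => [b| |] // _.
  by rewrite -EFinD /= lee_fin; lra.
have : (\int[mu]_(x in `]0%R, 1%R]) (v x)%:E <= (fine (W 1) - e)%:E)%E.
  rewrite -(cvg_lim _ H)//; apply: lime_le; first by apply/cvg_ex; eexists; exact: H.
  by apply: nearW => n; exact: Hn.
have := primw_oc (lexx 0) ler01; rewrite primw0 add0e => <-.
by rewrite -[X in (X <= _)%E](fineK (primw_fin 1)) lee_fin; lra.
Qed.

Definition Phiq g : \bar R := (\int[mu]_(t in I) (poweR (g t) q * (v t)%:E))%E.

Definition Lq g : \bar R := poweR (Phiq g) q^-1.

Lemma measurable_antitone_poweR g : antitone g ->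
  measurable_fun (I : set LR) (fun t => poweR (g t) q).
Proof.
move=> [_ ag]; apply: (@measurableT_comp _ _ _ _ _ _ (fun x => poweR x q)).
  exact: measurable_poweR.
apply: measurable_antitone_leb; first exact: interval_is_interval.
by move=> x y _ _; exact: ag.
Qed.

Lemma measurable_integrand g : antitone g ->
  measurable_fun (I : set LR) (fun t => poweR (g t) q * (v t)%:E)%E.
Proof. by move=> ag; apply: emeasurable_funM; [exact: measurable_antitone_poweR|exact: mve]. Qed.

Lemma integrand_ge0 (x : \bar R) t : (0 <= poweR x q * (v t)%:E)%E.
Proof. by rewrite mule_ge0 ?poweR_ge0// lee_fin. Qed.

Lemma Phiq_ge0 g : (0 <= Phiq g)%E.
Proof. by apply: integral_ge0 => t _; exact: integrand_ge0. Qed.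

Lemma Phiq_le g h : antitone g -> antitone h ->
  (forall t, 0 < t -> (g t <= h t)%E) -> (Phiq g <= Phiq h)%E.
Proof.
move=> ag ah gh; apply: ae_ge0_le_integral.
- exact: mI.
- by move=> t _; exact: integrand_ge0.
- exact: measurable_integrand.
- by move=> t _; exact: integrand_ge0.
- exact: measurable_integrand.
- apply: aeI_mono aeI_pos _ => t _ t0; apply: lee_wpmul2r; first by rewrite lee_fin.
  by apply: lee_poweR; [exact: ltW|case: ag|exact: gh].
Qed.

Lemma Lq_le g h : antitone g -> antitone h ->
  (forall t, 0 < t -> (g t <= h t)%E) -> (Lq g <= Lq h)%E.
Proof.
move=> ag ah gh; apply: lee_poweR; [by rewrite invr_ge0 ltW|exact: Phiq_ge0|].
exact: Phiq_le.
Qed.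

Lemma LqK g : poweR (Lq g) q = Phiq g.
Proof. by rewrite poweRVK ?Phiq_ge0. Qed.

Lemma LqZ (c : R) g : 0 <= c -> antitone g -> Lq (fun t => c%:E * g t)%E = (c%:E * Lq g)%E.
Proof.
move=> c0 ag; rewrite /Lq.
have -> : Phiq (fun t => c%:E * g t)%E = (poweR c%:E q * Phiq g)%E.
  rewrite /Phiq -ge0_integralZl.
  - apply: eq_integral => t _; rewrite poweRM ?lee_fin//; last by case: ag.
    by rewrite muleA.
  - exact: mI.
  - exact: measurable_integrand.
  - by move=> t _; exact: integrand_ge0.
  - exact: poweR_ge0.
by rewrite poweRM ?poweR_ge0 ?Phiq_ge0// poweRK ?lee_fin.
Qed.

Lemma Phiq_weak t g : 0 < t -> antitone g -> (poweR (g t) q * W t <= Phiq g)%E.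
Proof.
move=> t0 ag; rewrite /primw -ge0_integralZl; last 4 first.
- exact: lebesgue_itv.
- by apply: mve_sub; exact: sub0I.
- by move=> x _; rewrite lee_fin.
- exact: poweR_ge0.
apply: (@le_trans _ _ (\int[mu]_(x in `[0%R, t]) (poweR (g x) q * (v x)%:E))%E).
  apply: ge0_le_integral.
  - exact: lebesgue_itv.
  - by move=> x _; rewrite mule_ge0 ?poweR_ge0// lee_fin.
  - by apply: measurable_funeM; apply: mve_sub; exact: sub0I.
  - apply: measurable_funS (measurable_integrand ag); [exact: mI|exact: sub0I].
  - move=> x /=; rewrite in_itv/= => /andP[_ xt]; apply: lee_wpmul2r; first by rewrite lee_fin.
    by apply: lee_poweR; [exact: ltW|case: ag|case: ag => _; exact].
apply: ge0_subset_integral; [exact: lebesgue_itv|exact: mI| | |exact: sub0I].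
  exact: measurable_integrand.
by move=> x _; exact: integrand_ge0.
Qed.

(** By the layer-cake comparison it suffices to treat superlevel sets. Those of [g] are initial
    intervals, of endpoint [r] say; those of [g \o del] lie in the set where [del t <= r], hence in
    [[0, r']]. *)
Lemma Phiq_dilation (del : R -> R) (C : R) g : 0 < C -> antitone g ->
  (forall t, 0 <= t -> 0 <= del t) -> (forall t, 0 < t -> 0 < del t) ->
  (forall s t, 0 <= s -> s <= t -> del s <= del t) ->
  (forall r, 0 < r -> exists2 r', (forall t, 0 <= t -> del t <= r -> t <= r') &
    (W r' <= C%:E * W r)%E) ->
  (Phiq (g \o del) <= C%:E * Phiq g)%E.
Proof.
move=> C0 ag del0 delpos delmono delW.
have mgd : measurable_fun (I : set LR) (fun t => poweR (g (del t)) q).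
  apply: (@measurableT_comp _ _ _ _ _ _ (fun x => poweR x q)).
    exact: measurable_poweR.
  apply: measurable_antitone_leb; first exact: interval_is_interval.
  move=> x y; rewrite !halflineE => x0 y0 xy; case: ag => _; apply; exact: delmono.
apply: (@le_integral_layer _ _ _ _ R mu mu I I (fun t => poweR (g (del t)) q) (fun t => (v t)%:E)
  (fun t => poweR (g t) q) (fun t => (v t)%:E)).
- exact: mI.
- exact: mgd.
- exact: mve.
- by move=> t _; exact: poweR_ge0.
- by move=> t _; rewrite lee_fin.
- exact: mI.
- exact: measurable_antitone_poweR.
- exact: mve.
- by move=> t _; exact: poweR_ge0.
- by move=> t _; rewrite lee_fin.
- exact: ltW.
move=> s s0.
set S := I `&` [set x | (s%:E < poweR (g x) q)%E].
set S' := I `&` _.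
have mS : measurable (S : set LR).
  by apply: emeasurable_fun_o_infty; [exact: mI|exact: measurable_antitone_poweR].
have mS' : measurable (S' : set LR).
  by apply: emeasurable_fun_o_infty => //; exact: mI.
have Sdown x y : S x -> 0 <= y -> y <= x -> S y.
  move=> [Ix sx] y0 yx; split; first by rewrite halflineE.
  apply: lt_le_trans sx _; apply: lee_poweR; [exact: ltW|case: ag => //|].
  by case: ag => _; exact.
have S'E t : S' t -> 0 <= t /\ S (del t).
  by move=> [It st]; rewrite halflineE in It; split => //; split => //; rewrite halflineE del0.
have S'I : S' `<=` I by move=> x [].
have SI : S `<=` I by move=> x [].
(* An unbounded superlevel set is the whole half-line, where the integral of [v] is infinite by
   [Winf], and the bound is trivial. *)
have [bS|ubS] := pselect (exists b, forall x, S x -> x <= b); last first.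
  have -> : S = I.
    apply/seteqP; split => // x Ix; apply: contrapT => nSx; apply: ubS; exists x => y Sy.
    rewrite leNgt; apply/negP => xy; apply: nSx; apply: Sdown Sy _ (ltW xy).
    by move: Ix; rewrite halflineE.
  by rewrite Winf gt0_muley ?lte_fin// leey.
have [S0|/set0P [x0 Sx0]] := eqVneq S set0.
  have -> : S' = set0 by apply/seteqP; split => // t /S'E[_]; rewrite S0.
  by rewrite S0 !integral_set0 mule0.
have hsS : has_sup S by split; [exists x0|case: bS => b hb; exists b => x; exact: hb].
have ler x : S x -> x <= sup S by move=> Sx; apply: ub_le_sup => //; case: hsS.
have r0 : 0 <= sup S by apply: le_trans (ler _ Sx0); case: Sx0; rewrite halflineE.
have [rpos|] := ltP 0 (sup S).
  have [r' r'h Wr'] := delW _ rpos.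
  apply: (@le_trans _ _ (W r')).
    apply: le_intw => //; [exact: lebesgue_itv| |exact: sub0I].
    move=> t /S'E[t0 Sdt]; rewrite /= in_itv/= t0/=; apply: r'h => //; exact: ler.
  (* [S] may omit its supremum; [int_primw_o] lets [[0, sup S[] be used instead of the closed
     interval. *)
  apply: le_trans Wr' _; rewrite lee_pmul2l ?lte_fin// -int_primw_o//.
  apply: le_intw => //; first exact: lebesgue_itv.
  move=> t /=; rewrite in_itv/= => /andP[t0 tS].
  have d0 : 0 < sup S - t by rewrite subr_gt0.
  have [y Sy] := sup_adherent d0 hsS; rewrite opprB addrC subrK => ty; exact: Sdown Sy t0 (ltW ty).
(* Here [S] reduces to the point 0. As [del] is positive at positive points, the same holds for
   [S'], which is negligible. *)
move=> r0'; have S'0 : S' `<=` `[0, 0]%classic.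
  move=> t /S'E[t0 Sdt]; rewrite /= in_itv/= t0/= leNgt; apply/negP => tpos.
  by have := lt_le_trans (delpos t tpos) (le_trans (ler _ Sdt) r0'); rewrite ltxx.
apply: (@le_trans _ _ (W 0)); last by rewrite primw0 mule_ge0 ?lee_fin ?(ltW C0)//; apply: integral_ge0 => x _; rewrite lee_fin.
by apply: le_intw => //; [exact: lebesgue_itv|exact: sub0I].
Qed.

Hypothesis Wdouble : exists2 D : R, 0 < D & forall t, 0 < t -> (W (2 * t) <= D%:E * W t)%E.

Lemma antitone_half g : antitone g -> antitone (fun t => g (t / 2)).
Proof. by move=> [g0 ag]; split => // s t st; apply: ag; rewrite ler_pM2r. Qed.

Lemma antitoneD g h : antitone g -> antitone h -> antitone (fun t => g t + h t)%E.
Proof.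
move=> [g0 ag] [h0 ah]; split => [t|s t st]; first exact: adde_ge0.
by apply: leeD; [exact: ag|exact: ah].
Qed.

Lemma PhiqD g h : antitone g -> antitone h ->
  (\int[mu]_(t in I) (poweR (g t) q * (v t)%:E + poweR (h t) q * (v t)%:E))%E =
  (Phiq g + Phiq h)%E.
Proof.
move=> ag ah; apply: ge0_integralD.
- exact: mI.
- by move=> t _; exact: integrand_ge0.
- exact: measurable_integrand.
- by move=> t _; exact: integrand_ge0.
- exact: measurable_integrand.
Qed.

Lemma Lq_ri_functional : ri_functional Lq.
Proof.
split.
- exact: Lq_le.
- by move=> g _; exact: poweR_ge0.
- exact: LqZ.
- exists (fun t => fine (W t) `^ q^-1); split.
    by move=> t t0; rewrite powR_gt0// fine_gt0// Wpos//= Wfin.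
  move=> t g t0 ag; rewrite -poweR_EFin fineK ?primw_fin//.
  rewrite -[X in (X * _)%E](poweRK q0); last by case: ag.
  rewrite -poweRM ?poweR_ge0 ?primw_ge0//; apply: lee_poweR.
  + by rewrite invr_ge0 ltW.
  + by rewrite mule_ge0 ?poweR_ge0 ?primw_ge0.
  + exact: Phiq_weak.
- have [D D0 hD] := Wdouble.
  pose K := (2 `^ q * D * 2) `^ q^-1.
  have K0 : 0 <= K by exact: powR_ge0.
  exists (1 + K); first by rewrite lerDl.
  move=> g h ag ah.
  have half k : antitone k -> (Phiq (fun t => k (t / 2)%R) <= D%:E * Phiq k)%E.
    move=> ak; apply: (@Phiq_dilation (fun t => t / 2)) => //.
    + by move=> t t0; rewrite divr_ge0.
    + by move=> t t0; rewrite divr_gt0.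
    + by move=> s t _ st; rewrite ler_pM2r.
    + move=> r r0; exists (2 * r); last exact: hD.
      by move=> t _; rewrite ler_pdivrMr// mulrC.
  have agh : antitone (fun t => g (t / 2)%R + h (t / 2)%R)%E.
    by apply: antitoneD; exact: antitone_half.
  have P1 : (Phiq (fun t => g (t / 2)%R + h (t / 2)%R) <=
      (2 `^ q * D)%:E * (Phiq g + Phiq h))%E.
    apply: (@le_trans _ _ ((2 `^ q)%:E * (Phiq (fun t => g (t / 2)%R) + Phiq (fun t => h (t / 2)%R)))%E).
      have ag2 := antitone_half ag; have ah2 := antitone_half ah.
      rewrite -PhiqD// /Phiq.
      rewrite -ge0_integralZl; [|exact: mI|by apply: emeasurable_funD; exact: measurable_integrand|by move=> t _; apply: adde_ge0; exact: integrand_ge0|by rewrite lee_fin powR_ge0].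
      apply: ge0_le_integral; [exact: mI|by move=> t _; exact: integrand_ge0|exact: (measurable_integrand agh)| |].
        by apply: measurable_funeM; apply: emeasurable_funD; exact: measurable_integrand.
      move=> t _; rewrite -ge0_muleDl ?poweR_ge0// muleA; apply: lee_wpmul2r; first by rewrite lee_fin.
      by apply: poweR_add_le => //; [case: ag|case: ah].
    rewrite EFinM -muleA lee_pmul2l ?lte_fin ?powR_gt0// ge0_muleDr ?Phiq_ge0//.
    by apply: leeD; exact: half.
  have L0 k : (0 <= Lq k)%E by exact: poweR_ge0.
  apply: (@le_trans _ _ (K%:E * (Lq g + Lq h))%E); last first.
    by apply: lee_wpmul2r; [exact: adde_ge0|rewrite lee_fin lerDr].
  have -> : (K%:E * (Lq g + Lq h) = poweR ((2 `^ q * D * 2)%:E * poweR (Lq g + Lq h) q) q^-1)%E.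
    rewrite poweRM ?poweR_ge0//; last by rewrite lee_fin !mulr_ge0 ?powR_ge0// ltW.
    by rewrite poweRK ?adde_ge0// poweR_EFin.
  apply: lee_poweR; [by rewrite invr_ge0 ltW|exact: Phiq_ge0|].
  apply: le_trans P1 _; rewrite [X in (_ <= X * _)%E]EFinM -muleA lee_pmul2l; last first.
  + by rewrite lte_fin mulr_gt0// powR_gt0.
  + by [].
  rewrite -!LqK (_ : 2%:E = 1%:E + 1%:E)%E; last by rewrite -EFinD.
  rewrite ge0_muleDl// mul1e; apply: leeD; apply: lee_poweR; rewrite ?(ltW q0)//.
    by rewrite leeDl.
  by rewrite leeDr.
- move=> g ag ndg.
  have ndg' m n t : (m <= n)%N -> (g m t <= g n t)%E.
    by move=> /subnKC <-; elim: (n - m)%N => [|k IH]; rewrite ?addn0// addnS (le_trans IH).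
  have ndp t m n : (m <= n)%N -> (poweR (g m t) q * (v t)%:E <= poweR (g n t) q * (v t)%:E)%E.
    move=> mn; apply: lee_wpmul2r; first by rewrite lee_fin.
    by apply: lee_poweR; [exact: ltW|case: (ag m)|exact: ndg'].
  rewrite /Lq; have -> : Phiq (fun t => ereal_sup (range (g^~ t))) = ereal_sup (range (fun n => Phiq (g n))).
    have := @monotone_convergence _ LR R mu I mI (fun n t => poweR (g n t) q * (v t)%:E)%E.
    move=> /(_ (fun n => measurable_integrand (ag n)) (fun n t _ => integrand_ge0 (g n t) t) (fun t _ m n => ndp t m n)).
    have ndPhi : nondecreasing_seq (fun n => Phiq (g n)).
      by move=> m n mn; apply: Phiq_le => // t _; exact: ndg'.
    rewrite -[X in _ = X -> _]/(limn (fun n => Phiq (g n))).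
    rewrite (cvg_lim _ (ereal_nondecreasing_cvgn ndPhi))// => <-.
    apply: eq_integral => t _.
    have ndt : nondecreasing_seq (fun n => poweR (g n t) q * (v t)%:E)%E by exact: ndp.
    rewrite (cvg_lim _ (ereal_nondecreasing_cvgn ndt))// poweR_sup//; last by move=> n; case: (ag n).
    rewrite muleC; have := v0 t; rewrite le_eqVlt => /predU1P[<-|vt].
      rewrite mul0e; apply/eqP; rewrite eq_le; apply/andP; split.
        by apply: le_ereal_sup_tmp; exists 0%E => //; exists 0%N => //; rewrite mule0.
      by apply: ge_ereal_sup => _ [n _ <-]; rewrite mule0.
    rewrite -ereal_sup_pZl//; congr ereal_sup; apply/seteqP; split.
      by move=> _ [_ [n _ <-] <-]; exists n => //; rewrite muleC.
    by move=> _ [n _ <-]; exists (poweR (g n t) q); [exists n|rewrite muleC].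
  by apply: poweR_sup; [rewrite invr_gt0|move=> n; exact: Phiq_ge0].
- move=> M L M0 L0; apply: poweR_lty.
  set g := (fun t => _).
  have ag : antitone g.
    split => [t|s t st]; first by rewrite /g; case: ifP => _; rewrite ?lee_fin// ltW.
    by rewrite /g; case: ifPn => tL; rewrite ?(le_lt_trans st tL)//; case: ifPn => _; rewrite ?lee_fin// ltW.
  apply: (@le_lt_trans _ _ ((M `^ q)%:E * W L)%E); last first.
    by rewrite lte_mul_pinfty ?lee_fin ?powR_ge0.
  rewrite /primw -ge0_integralZl; [|exact: lebesgue_itv|by apply: mve_sub; exact: sub0I|by move=> x _; rewrite lee_fin|by rewrite lee_fin powR_ge0].
  rewrite /Phiq [leLHS]integral_mkcond [leRHS]integral_mkcond.
  apply: (@ge0_le_integral _ LR R mu setT measurableT).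
  + by move=> t _; apply: erestrict_ge0 => x _; exact: integrand_ge0.
  + apply/(measurable_restrictT _ _).1; [exact: mI|exact: measurable_integrand].
  + apply/(measurable_restrictT _ _).1; [exact: lebesgue_itv|].
    by apply: measurable_funeM; apply: mve_sub; exact: sub0I.
  + move=> t _; rewrite !patchE; case: ifPn => [|_]; last first.
      by case: ifPn => // _; rewrite mule_ge0 ?lee_fin ?powR_ge0.
    rewrite inE halflineE => t0; rewrite /g; case: ifPn => tL.
      by rewrite mem_set ?poweR_EFin//= in_itv/= t0 ltW.
    rewrite poweR0r ?gt_eqF// mul0e.
    by case: ifPn => // _; rewrite mule_ge0 ?lee_fin ?powR_ge0.
Qed.

End Lq_functional.

(** * Hardy inequality for finite [q] *)

(** A discrete Gronwall argument: [V k <= B * a k] is exactly what makes [V k + l * a k] at most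
    [(B + l) / (1 + B)] times [V k + a k], so the sums [V k + a k] contract. *)
Lemma geometric_decay (R : realType) (B l : R) (a V : nat -> R) :
  0 < B -> 0 < l < 1 -> (forall k, 0 <= V k) -> (forall k, 0 <= a k) ->
  (forall k, V k <= B * a k) -> (forall k, V k.+1 + a k.+1 <= V k + l * a k) ->
  forall k, a k <= ((B + l) / (1 + B)) ^+ k * ((1 + B) * a 0).
Proof.
move=> B0 /andP[l0 l1] V0 a0 Va step k.
have B1 : 0 < 1 + B by lra.
suff : V k + a k <= ((B + l) / (1 + B)) ^+ k * ((1 + B) * a 0).
  by apply: le_trans; rewrite lerDr.
elim: k => [|k IH]; first by rewrite expr0 mul1r; have := Va 0; lra.
apply: le_trans (step k) _.
rewrite exprS -mulrA; apply: le_trans (_ : (B + l) / (1 + B) * (V k + a k) <= _); last first.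
  by rewrite ler_wpM2l// divr_ge0//; lra.
rewrite mulrAC ler_pdivlMr//; have := Va k; nra.
Qed.

Section hardy.
Context {R : realType}.
Variables (q : R) (v : R -> R) (phi : R -> R).
Local Notation I := (@halfline R).
Local Notation mu := (@leb R).
Local Notation LR := (lebesgueType R).
Local Notation GR := (measurableTypeR R).
Local Notation m := (stieltjes phi).
Local Notation W := (primw v).
Implicit Types (t r s : R) (g h : R -> \bar R).
Hypotheses (q1 : 1 <= q) (v0 : forall x, 0 <= v x) (mv : lmeasurable v).
Hypotheses (Wfin : forall t, (W t < +oo)%E)
  (Winf : (\int[mu]_(x in I) (v x)%:E = +oo)%E)
  (Wpos : forall t, 0 < t -> (0 < W t)%E).
Hypothesis nphi : normalized_fundamental phi.
Variable B : R.
Hypothesis B0 : 0 < B.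
Hypothesis cond : forall t, 0 < t ->
  (\int[mu]_(x in `[t, +oo[) (v x / phi x `^ q)%:E <= (B / phi t `^ q)%:E * W t)%E.

Let q0 : 0 < q. Proof. exact: lt_le_trans q1. Qed.

Let V t : \bar R := (\int[mu]_(x in `[t, +oo[) (v x / phi x `^ q)%:E)%E.

Lemma phi_pow_gt0 t : 0 < t -> 0 < phi t `^ q.
Proof. by move=> t0; rewrite powR_gt0// phi_gt0. Qed.

Lemma phi_pow_le s t : 0 < s -> s <= t -> phi s `^ q <= phi t `^ q.
Proof.
move=> s0 st; apply: ge0_ler_powR; first exact: ltW.
- by rewrite nnegrE ltW// phi_gt0.
- by rewrite nnegrE ltW// phi_gt0// (lt_le_trans s0).
- by apply: phi_le => //; exact: ltW.
Qed.

Lemma measurable_inv_phi : measurable_fun (`]0, +oo[%classic : set LR)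
  (fun x => ((phi x `^ q)^-1)%:E).
Proof.
apply: measurable_antitone_leb; first exact: interval_is_interval.
move=> x y; rewrite /= !in_itv/= !andbT => x0 y0 xy.
by rewrite lee_fin lef_pV2 ?posrE ?phi_pow_gt0// phi_pow_le.
Qed.

Lemma measurable_v_phi (A : set R) : A `<=` `]0, +oo[%classic ->
  measurable_fun (A : set LR) (fun x => (v x / phi x `^ q)%:E).
Proof.
move=> A0; under eq_fun do rewrite EFinM; apply: emeasurable_funM.
  apply: mve_sub => // x /A0; rewrite halflineE/= in_itv/= andbT; exact: ltW.
by apply: measurable_funS measurable_inv_phi; [exact: lebesgue_itv|exact: A0].
Qed.

Lemma v_phi_ge0 x : (0 <= (v x / phi x `^ q)%:E)%E.
Proof. by rewrite lee_fin divr_ge0// powR_ge0. Qed.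

Lemma V_ge0 t : (0 <= V t)%E.
Proof. by apply: integral_ge0 => x _; exact: v_phi_ge0. Qed.

Lemma V_fin t : 0 < t -> V t \is a fin_num.
Proof.
move=> t0; rewrite ge0_fin_numE ?V_ge0//; apply: le_lt_trans (cond t0) _.
by rewrite lte_mul_pinfty// lee_fin divr_ge0 ?(ltW B0)// powR_ge0.
Qed.

Lemma fineW t : (fine (W t))%:E = W t.
Proof. by rewrite fineK// primw_fin. Qed.

Lemma fineW_ge0 t : 0 <= fine (W t).
Proof. by rewrite fine_ge0// primw_ge0. Qed.

Lemma fineW_le s t : s <= t -> fine (W s) <= fine (W t).
Proof. by move=> st; rewrite -lee_fin !fineW primw_le. Qed.

Lemma V_cond t : 0 < t -> fine (V t) <= B / phi t `^ q * fine (W t).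
Proof. by move=> t0; rewrite -lee_fin EFinM fineW; have /fineK -> := V_fin t0; exact: cond. Qed.

Lemma V_step s t : 0 < s -> s <= t ->
  (fine (W t) - fine (W s)) / phi t `^ q + fine (V t) <= fine (V s).
Proof.
move=> s0 st; have t0 : 0 < t by apply: lt_le_trans st.
have sub0 : `[s, t[ `<=` `]0, +oo[%classic.
  by move=> x /=; rewrite !in_itv/= andbT => /andP[/(lt_le_trans s0)].
have sub1 : `[t, +oo[ `<=` `]0, +oo[%classic.
  by move=> x /=; rewrite !in_itv/= !andbT => /(lt_le_trans t0).
have VE : V s = (\int[mu]_(x in `[s, t[) (v x / phi x `^ q)%:E + V t)%E.
  rewrite /V -ge0_integral_setU.
  - by congr (integral _ _ _); rewrite -itv_bndbnd_setU// bnd_simp.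
  - exact: lebesgue_itv.
  - exact: lebesgue_itv.
  - by apply: measurable_v_phi => x [/sub0|/sub1].
  - by move=> x _; exact: v_phi_ge0.
  - rewrite disj_set2E; apply/eqP/seteqP; split => x //=; rewrite !in_itv/= andbT.
    by move=> [/andP[_ xt]]; rewrite leNgt xt.
have WE : W t = (W s + \int[mu]_(x in `[s, t[) (v x)%:E)%E.
  rewrite -(int_primw_o v0 mv s0) -(int_primw_o v0 mv t0) -ge0_integral_setU.
  - by congr (integral _ _ _); rewrite -itv_bndbnd_setU// bnd_simp// ltW.
  - exact: lebesgue_itv.
  - exact: lebesgue_itv.
  - by apply: mve_sub => // x [] /=; rewrite in_itv/= halflineE => /andP[]// /(le_trans (ltW s0)).
  - by move=> x _; rewrite lee_fin.
  - rewrite disj_set2E; apply/eqP/seteqP; split => x //=; rewrite !in_itv/=.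
    by move=> [/andP[_ xt] /andP[]]; rewrite leNgt xt.
have h : (((phi t `^ q)^-1)%:E * \int[mu]_(x in `[s, t[) (v x)%:E <=
    \int[mu]_(x in `[s, t[) (v x / phi x `^ q)%:E)%E.
  rewrite -ge0_integralZl.
  - apply: ge0_le_integral.
    + exact: lebesgue_itv.
    + by move=> x _; rewrite mule_ge0 ?lee_fin ?invr_ge0 ?powR_ge0.
    + apply: measurable_funeM; apply: mve_sub => // x /=; rewrite in_itv/= halflineE.
      by move=> /andP[/(le_trans (ltW s0))].
    + exact: measurable_v_phi.
    + move=> x /=; rewrite in_itv/= => /andP[sx xt]; have x0 := lt_le_trans s0 sx.
      rewrite -EFinM lee_fin mulrC ler_wpM2l// lef_pV2 ?posrE ?phi_pow_gt0//.
      by rewrite phi_pow_le// ltW.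
  - exact: lebesgue_itv.
  - apply: mve_sub => // x /=; rewrite in_itv/= halflineE.
    by move=> /andP[/(le_trans (ltW s0))].
  - by move=> x _; rewrite lee_fin.
  - by rewrite lee_fin invr_ge0 powR_ge0.
have Wst : (\int[mu]_(x in `[s, t[) (v x)%:E)%E = (fine (W t) - fine (W s))%:E.
  move: WE; rewrite -(fineW t) -(fineW s).
  case: (\int[mu]_(x in `[s, t[) (v x)%:E)%E => [b [->]| |] //=.
  by congr EFin; ring.
rewrite Wst -EFinM in h.
rewrite -lee_fin EFinD !fineK ?V_fin// VE leeD2r// mulrC; exact: h.
Qed.

Lemma phi0p_eq0 : phi0p phi = 0.
Proof.
have := phi0p_ge0 nphi; rewrite le_eqVlt => /predU1P[//|d0].
have [M M1 WM] := primw_large v0 mv Winf (fine (W 1)).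
have WM' : 0 < fine (W M) - fine (W 1) by rewrite subr_gt0 -lte_fin (fineW M).
have M0 : 0 < M by lra.
pose c := (fine (W M) - fine (W 1)) / phi M `^ q.
have c0 : 0 < c by rewrite divr_gt0// phi_pow_gt0.
pose d := phi0p phi `^ q.
have d0' : 0 < d by exact: powR_gt0.
have e0 : 0 < c * d / B by rewrite divr_gt0// mulr_gt0.
have [t' t'0 Wt'] := primw_small v0 mv Wfin e0.
pose t := Num.min t' 1.
have t0 : 0 < t by rewrite /t lt_min t'0 ltr01.
have t1 : t <= 1 by rewrite /t ge_min lexx orbT.
have Wt : fine (W t) < c * d / B.
  by rewrite -lte_fin fineW; apply: le_lt_trans Wt'; apply: primw_le; rewrite // /t ge_min lexx.
have h1 := V_step ltr01 M1; have h2 := V_step t0 t1; have h3 := V_cond t0.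
have VM0 : 0 <= fine (V M) by rewrite fine_ge0 ?V_ge0.
have h4 : 0 <= (fine (W 1) - fine (W t)) / phi 1 `^ q.
  by rewrite divr_ge0 ?powR_ge0// subr_ge0 fineW_le.
have h5 : B / phi t `^ q * fine (W t) <= B / d * fine (W t).
  rewrite ler_wpM2r ?fineW_ge0// ler_pM2l// lef_pV2 ?posrE ?phi_pow_gt0//.
  apply: ge0_ler_powR; [exact: ltW| | |exact: phi0p_le].
  - by rewrite nnegrE phi0p_ge0.
  - by rewrite nnegrE ltW// phi_gt0.
have h6 : B / d * fine (W t) < c.
  by rewrite mulrAC ltr_pdivrMr// mulrC -ltr_pdivlMr.
by rewrite -/c in h1; lra.
Qed.

Lemma phi_unbounded (A : R) : exists2 t, 0 < t & A < phi t.
Proof.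
apply: contrapT => h.
have hA t : 0 < t -> phi t <= A.
  by move=> t0; rewrite leNgt; apply/negP => At; apply: h; exists t.
have p1 := phi_gt0 nphi (@ltr01 R).
have A0 : 0 < A by apply: lt_le_trans p1 (hA _ ltr01).
have Aq : 0 < A `^ q by exact: powR_gt0.
have [T T1 WT] := primw_large v0 mv Winf
  (fine (W 1) + A `^ q * (B / phi 1 `^ q * fine (W 1))).
have T0 : 0 < T by lra.
rewrite -(fineW T) lte_fin in WT.
have h1 := V_step ltr01 T1; have h3 := V_cond (@ltr01 R).
have VT0 : 0 <= fine (V T) by rewrite fine_ge0 ?V_ge0.
have h2 : (fine (W T) - fine (W 1)) / A `^ q <= (fine (W T) - fine (W 1)) / phi T `^ q.
  rewrite ler_wpM2l ?subr_ge0 ?fineW_le// lef_pV2 ?posrE ?phi_pow_gt0//.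
  apply: ge0_ler_powR; [exact: ltW| | |exact: hA].
  - by rewrite nnegrE ltW// phi_gt0.
  - by rewrite nnegrE ltW.
have : (fine (W T) - fine (W 1)) / A `^ q <= B / phi 1 `^ q * fine (W 1) by lra.
by rewrite ler_pdivrMr//; lra.
Qed.

Lemma phi_lt_cancel s t : 0 <= t -> phi s < phi t -> s < t.
Proof.
by move=> t0; rewrite !ltNge; apply: contra; apply: phi_le.
Qed.

(** The supremum of the set where [phi <= y] is the preimage: right continuity gives
    [phi (sup E) >= y], and concavity excludes a jump from the left. The two preceding facts make
    the set contain a positive point and be bounded. *)
Lemma phi_surjective (y : R) : 0 < y -> exists2 t, 0 < t & phi t = y.
Proof.
move=> y0; pose E := [set t | 0 <= t /\ phi t <= y].
have [b b0 yb] := phi_unbounded y.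
have ubE : ubound E b.
  move=> t [t0 ty]; apply: ltW; apply: phi_lt_cancel (ltW b0) _.
  exact: le_lt_trans ty yb.
have [a a0 ay] : exists2 t, 0 < t & phi t < y.
  by apply: phi0p_adherent => //; rewrite phi0p_eq0.
have Ea : E a by split; exact: ltW.
have hsE : has_sup E by split; [exists a|exists b].
have le_sup t : E t -> t <= sup E by move=> Et; apply: ub_le_sup => //; case: hsE.
have s0 : 0 < sup E by apply: lt_le_trans a0 (le_sup _ Ea).
exists (sup E) => //; apply/eqP; rewrite eq_le; apply/andP; split; last first.
  rewrite -(right_limit_pos nphi s0); apply: right_limit_ge; first exact: ltW.
  move=> t st; rewrite leNgt; apply/negP => ty.
  have /le_sup : E t by split; [rewrite ltW// (lt_trans s0)|exact: ltW].
  by rewrite leNgt st.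
rewrite leNgt; apply/negP => ys.
have ps := phi_gt0 nphi s0.
(* The midpoint of [sup E * y / phi (sup E)] and [sup E]. As [phi t <= y], [phi_ratio] would force
   [t] to be at most the first of these. *)
pose t := sup E * ((1 + y / phi (sup E)) / 2).
have yps : y / phi (sup E) < 1 by rewrite ltr_pdivrMr// mul1r.
have yps0 : 0 < y / phi (sup E) by rewrite divr_gt0.
have ts : t < sup E by rewrite /t gtr_pMr//; lra.
have t0 : 0 < t by rewrite /t mulr_gt0//; lra.
have d0 : 0 < sup E - t by rewrite subr_gt0.
have [u [u0 uy]] := sup_adherent d0 hsE.
rewrite opprB addrC subrK => tu.
have h := phi_ratio nphi t0 (ltW ts).
have ptu : phi t <= y by apply: le_trans uy; apply: phi_le => //; exact: ltW.
have : t * phi (sup E) <= sup E * y by apply: le_trans h _; rewrite ler_pM2l.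
rewrite /t -mulrA ler_pM2l// mulrAC mulrDl mul1r -mulrA mulVf ?gt_eqF// mulr1.
by lra.
Qed.

Lemma phi_inverse : exists iphi : R -> R, forall y, 0 < y -> 0 < iphi y /\ phi (iphi y) = y.
Proof.
have /choice[f hf] : forall y : R, exists t, 0 < y -> 0 < t /\ phi t = y.
  move=> y; have [y0|y0] := ltP 0 y; last by exists 0.
  by have [t t0 ty] := phi_surjective y0; exists t.
by exists f.
Qed.

(** [l] is the factor by which [phi] to the power [-q] shrinks when [phi] doubles; [th] is the
    contraction factor of [geometric_decay]. *)
Let l := (2 `^ q)^-1.
Let th := (B + l) / (1 + B).

Let l0 : 0 < l. Proof. by rewrite invr_gt0 powR_gt0. Qed.
Let l1 : l < 1.
Proof.
rewrite /l invf_lt1 ?powR_gt0//; apply: lt_le_trans (_ : 2 <= _); first by lra.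
by apply: le1r_powR => //; lra.
Qed.
Let th0 : 0 < th. Proof. by rewrite /th divr_gt0//; move: B0 l0; lra. Qed.
Let th1 : th < 1.
Proof. by rewrite /th ltr_pdivrMr; move: B0 l1; lra. Qed.

Lemma pow2_phi k (y : R) : 0 < y -> (2 ^+ k * y) `^ q = l ^- k * y `^ q.
Proof.
move=> y0; rewrite powRM ?exprn_ge0 ?(ltW y0)//; congr (_ * _).
rewrite /l -exprVn invrK; have p2 : 0 <= 2 `^ q :> R by exact: powR_ge0.
elim: k => [|k IH]; first by rewrite !expr0 powR1.
by rewrite !exprS powRM ?IH// exprn_ge0.
Qed.

(** [geometric_decay] along points where [phi] takes the values [2 ^+ n * phi r], applied to [V] and
    [W / phi^q], both multiplied by [phi r]^ q[. The rate]th / l[is below]2 [^ q] by the factor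
    [th]. *)
Lemma weight_growth (iphi : R -> R) r k :
  (forall y, 0 < y -> 0 < iphi y /\ phi (iphi y) = y) -> 0 < r ->
  (W (iphi (2 ^+ k.+1 * phi r)%R) <= (((th / l) ^+ k.+1) * (1 + B))%:E * W r)%E.
Proof.
move=> hi r0; have pr := phi_gt0 nphi r0.
(* [rho 0] is set to [r], since [iphi (phi r)] may be another preimage; this is why the statement
   starts at exponent [k.+1]. *)
pose rho n := if n is n'.+1 then iphi (2 ^+ n * phi r) else r.
have p2 n : 0 < 2 ^+ n * phi r by rewrite mulr_gt0// exprn_gt0.
have rho0 n : 0 < rho n by case: n => [//|n]; case: (hi _ (p2 n.+1)).
have phirho n : phi (rho n) = 2 ^+ n * phi r.
  by case: n => [|n]; rewrite ?expr0 ?mul1r//; case: (hi _ (p2 n.+1)).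
have rhoS n : rho n <= rho n.+1.
  apply: ltW; apply: phi_lt_cancel; first exact: ltW.
  by rewrite !phirho ltr_pM2r// exprS ltr_pMl ?exprn_gt0//; lra.
pose P := phi r `^ q.
have P0 : 0 < P by exact: powR_gt0.
have := @geometric_decay R B l (fun n => l ^+ n * fine (W (rho n)))
  (fun n => P * fine (V (rho n))) B0.
rewrite l0 l1 => /(_ isT) H.
have ln n : 0 < l ^+ n by rewrite exprn_gt0.
have HV n : P * fine (V (rho n)) <= B * (l ^+ n * fine (W (rho n))).
  have := V_cond (rho0 n); rewrite phirho pow2_phi// invfM invrK.
  move=> h; apply: le_trans (_ : P * (B * (l ^+ n / P) * fine (W (rho n))) <= _).
    by rewrite ler_pM2l.
  rewrite le_eqVlt; apply/orP; left; apply/eqP; field; rewrite gt_eqF//.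
have HS n : P * fine (V (rho n.+1)) + l ^+ n.+1 * fine (W (rho n.+1)) <=
    P * fine (V (rho n)) + l * (l ^+ n * fine (W (rho n))).
  have := V_step (rho0 n) (rhoS n); rewrite phirho pow2_phi// invfM invrK.
  rewrite -(ler_pM2l P0) mulrDr.
  rewrite (_ : P * ((fine (W (rho n.+1)) - fine (W (rho n))) * (l ^+ n.+1 / phi r `^ q)) =
    l ^+ n.+1 * fine (W (rho n.+1)) - l * (l ^+ n * fine (W (rho n)))).
    lra.
  by rewrite -/P exprS; field; rewrite gt_eqF.
have {H} := H _ _ HV HS k.+1; rewrite expr0 mul1r -/th => H.
have H' : l ^+ k.+1 * fine (W (rho k.+1)) <= th ^+ k.+1 * ((1 + B) * fine (W r)).
  apply: H => n; apply: mulr_ge0.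
  - exact: ltW.
  - by apply: fine_ge0; exact: V_ge0.
  - exact: ltW (ln n).
  - exact: fineW_ge0.
rewrite -(fineW (iphi _)) -(fineW r) -EFinM lee_fin.
rewrite -(ler_pM2l (ln k.+1)); apply: le_trans H' _.
rewrite le_eqVlt; apply/orP; left; apply/eqP.
rewrite (expr_div_n th l); move: (l ^+ k.+1) (ln k.+1) (th ^+ k.+1) => X X0 Y.
by field; rewrite gt_eqF.
Qed.

(** The gain [th] is split as [ka * ka]. The ratio [sg], whose power [q] is [ka], sums the shells of
    [prim phi f t]; the remaining [ka] sums the integrals of the dilations. *)
Let ka := Num.sqrt th.
Let sg := ka `^ q^-1.

Let ka0 : 0 < ka. Proof. by rewrite sqrtr_gt0. Qed.
Let kaE : ka ^+ 2 = th. Proof. by rewrite sqr_sqrtr// ltW. Qed.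
Let ka1 : ka < 1.
Proof. by have := kaE; rewrite expr2; move: ka0 th1; nra. Qed.
Let sg0 : 0 < sg. Proof. exact: powR_gt0. Qed.
Let sgq : sg `^ q = ka.
Proof. by rewrite /sg -powRrM mulVf ?gt_eqF// powRr1// ltW. Qed.
Let sg1 : sg < 1.
Proof.
rewrite ltNge; apply/negP => s1; have : 1 `^ q <= sg `^ q.
  by apply: ge0_ler_powR; rewrite ?nnegrE// ltW.
by rewrite powR1 sgq leNgt ka1.
Qed.

(* The shell []phi^-1(2^-k-1 phi t), phi^-1(2^-k phi t)]] has [dphi]-mass
   [2^-k-1 phi t]. *)
Lemma prim_shells (iphi : R -> R) (f : R -> R) t (y : R) :
  (forall y, 0 < y -> 0 < iphi y /\ phi (iphi y) = y) -> 0 < t -> 0 <= y ->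
  (forall k, (rearr f (iphi (2^-1 ^+ k.+1 * phi t)%R) <= ((2 * sg) ^+ k.+1 * y)%:E)%E) ->
  (prim phi f t <= (phi t * (y / (1 - sg)))%:E)%E.
Proof.
move=> hi t0 y0 hy; have pt := phi_gt0 nphi t0.
pose e n := if n is n'.+1 then iphi (2^-1 ^+ n * phi t) else t.
have p2 n : 0 < 2^-1 ^+ n * phi t by rewrite mulr_gt0// exprn_gt0.
have e0 n : 0 < e n by case: n => [//|n]; case: (hi _ (p2 n.+1)).
have phie n : phi (e n) = 2^-1 ^+ n * phi t.
  by case: n => [|n]; rewrite ?expr0 ?mul1r//; case: (hi _ (p2 n.+1)).
have eS n : e n.+1 <= e n.
  apply: ltW; apply: phi_lt_cancel; first exact: ltW.
  by rewrite !phie ltr_pM2r// exprS gtr_pMl ?exprn_gt0//; lra.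
have eN n m : (n <= m)%N -> e m <= e n.
  by move=> /subnKC <-; elim: (m - n)%N => [|k IH]; rewrite ?addn0// addnS (le_trans _ IH).
have et n : e n <= t by exact: (eN 0%N).
have mr (A : set R) : measurable (A : set GR) -> A `<=` I -> measurable_fun (A : set GR) (rearr f).
  by move=> mA AI; apply: measurable_funS (@measurable_rearr R f) => //; exact: mIG.
have subI a b : 0 < a -> `]a, b] `<=` I.
  by move=> a0 x /=; rewrite in_itv/= halflineE => /andP[/(lt_trans a0)/ltW].
have shell n : (\int[m]_(x in `]e n.+1, e n]) rearr f x <= (phi t * y * sg ^+ n.+1)%:E)%E.
  apply: (@le_trans _ _ (\int[m]_(x in `]e n.+1, e n]) (cst ((2 * sg) ^+ n.+1 * y)%:E) x)%E).
    apply: ge0_le_integral.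
    - exact: measurable_itv.
    - by move=> x _; exact: rearr_ge0.
    - by apply: mr; [exact: measurable_itv|exact: subI].
    - exact: measurable_cst.
    - move=> x /=; rewrite in_itv/= => /andP[/ltW ex _].
      by apply: le_trans (hy n); exact: le_rearr.
  rewrite integral_cst; last exact: measurable_itv.
  rewrite stieltjes_oc// !right_limit_pos// !phie -EFinM lee_fin.
  rewrite exprMn exprS (_ : _ * _ - _ = 2^-1 ^+ n.+1 * phi t); last by rewrite exprS; field.
  rewrite exprVn -exprS.
  rewrite (_ : _ * y * _ = phi t * y * sg ^+ n.+1)//.
  have : 2 ^+ n.+1 != 0 :> R by rewrite expf_neq0.
  by move: (2 ^+ n.+1) (sg ^+ n.+1) => X Y X0; field.
have s1 : 0 < 1 - sg by rewrite subr_gt0.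
have part n : (\int[m]_(x in `]e n, t]) rearr f x <= (phi t * y * ((1 - sg ^+ n) / (1 - sg)))%:E)%E.
  elim: n => [|n IH].
    by rewrite /= set_itvoc0 integral_set0 expr0 subrr mul0r mulr0.
  have -> : (\int[m]_(x in `]e n.+1, t]) rearr f x =
      \int[m]_(x in `]e n.+1, e n]) rearr f x + \int[m]_(x in `]e n, t]) rearr f x)%E.
    rewrite -ge0_integral_setU.
    - by congr (integral _ _ _); rewrite -itv_bndbnd_setU// bnd_simp.
    - exact: measurable_itv.
    - exact: measurable_itv.
    - apply: mr; first by apply: measurableU; exact: measurable_itv.
      by move=> x []; exact: subI.
    - by move=> x _; exact: rearr_ge0.
    - rewrite disj_set2E; apply/eqP/seteqP; split => x //=; rewrite !in_itv/=.
      by move=> [/andP[_ xt] /andP[]]; rewrite ltNge xt.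
  apply: le_trans (leeD (shell n) IH) _; rewrite -EFinD lee_fin -mulrDr.
  rewrite ler_wpM2l ?mulr_ge0 ?(ltW pt)//.
  rewrite -(ler_pM2r s1) mulrDl !divfK ?gt_eqF// exprS.
  have : 0 <= sg ^+ n * (1 - sg) ^+ 2 by rewrite mulr_ge0 ?exprn_ge0 ?(ltW sg0) ?(ltW s1).
  by move: (sg ^+ n) => X; rewrite expr2; lra.
(* The shells miss the point 0, which [prim] includes; it has [dphi]-mass [phi0p phi], which
   vanishes by [phi0p_eq0]. *)
have -> : prim phi f t = (\int[m]_(x in `]0%R, t]) rearr f x)%E.
  rewrite /prim [LHS](@ge0_negligible_integral _ GR R m `[0, t]%classic [set 0]).
  - congr (integral _ _ _); apply/seteqP; split => x /=; rewrite !in_itv/=.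
      by move=> [/andP[x0 ->] /eqP x0']; rewrite andbT lt_neqAle eq_sym x0' x0.
    by move=> /andP[x0 ->]; rewrite ltW//; split => //; apply/eqP; rewrite gt_eqF.
  - exact: measurable_set1.
  - exact: measurable_itv.
  - exact: measurable_rearr_itv.
  - by move=> x _; exact: rearr_ge0.
  - by rewrite [LHS]stieltjes_set0// phi0p_eq0.
pose F n := `]e n, t]%classic : set R.
have ndF : nondecreasing_seq F.
  move=> i j ij; apply/subsetPset => x; rewrite /F/= !in_itv/= => /andP[ix ->].
  by rewrite andbT (le_lt_trans _ ix)// eN.
have UF : \bigcup_n F n = `]0, t]%classic.
  apply/seteqP; split => x; rewrite /= in_itv/=.
    by move=> [n _]; rewrite /F/= in_itv/= => /andP[nx ->]; rewrite andbT (lt_trans _ nx).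
  move=> /andP[x0 xt]; have px := phi_gt0 nphi x0.
  have h1 : `|2^-1 : R| < 1 by rewrite gtr0_norm//; lra.
  have := cvg_expr h1 => /cvgrPdist_lt /(_ (phi x / phi t)).
  rewrite divr_gt0// => /(_ isT) [n _ /(_ n (leqnn _))].
  rewrite /= sub0r normrN ger0_norm ?exprn_ge0// => hn.
  exists n => //; rewrite /F/= in_itv/= xt andbT.
  by apply: phi_lt_cancel; [exact: ltW|rewrite phie -ltr_pdivlMr].
have H : (\int[m]_(x in F n) rearr f x @[n --> \oo] --> \int[m]_(x in `]0%R, t]) rearr f x)%E.
  rewrite -UF; apply: ge0_nondecreasing_set_cvg_integral.
  - exact: ndF.
  - by move=> n; exact: measurable_itv.
  - by move=> n; apply: mr; [exact: measurable_itv|exact: subI].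
  - by move=> n x _; exact: rearr_ge0.
rewrite -(cvg_lim _ H)//; apply: lime_le; first by apply/cvg_ex; eexists; exact: H.
apply: nearW => n; apply: le_trans (part n) _.
rewrite lee_fin mulrA ler_wpM2l ?mulr_ge0 ?(ltW pt)//.
rewrite -[leRHS]mul1r ler_wpM2r ?invr_ge0 ?(ltW s1)// gerBl exprn_ge0//; exact: ltW.
Qed.

(** A pointwise bound takes the place of Minkowski's inequality: by [prim_shells], the power [q] of
    the Hardy transform is at most a multiple of the series of [be k] times the power [q] of
    [rearr f (del k t)]. Integrating term by term leaves dilations, each bounded by
    [weight_growth]. *)
Lemma hardy_Lq : exists2 C : R, 0 < C & forall (f : R -> R) g, lmeasurable f ->
  antitone g -> (forall t, 0 < t -> ((phi t)%:E * g t <= prim phi f t)%E) ->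
  (Lq q v g <= C%:E * Lq q v (rearr f))%E.
Proof.
have [iphi hi] := phi_inverse.
have s1 : 0 < 1 - sg by rewrite subr_gt0.
pose G := (1 - sg)^-1; have G0 : 0 < G by rewrite invr_gt0.
pose Gq := G `^ q; have Gq0 : 0 < Gq by exact: powR_gt0.
(* [del k t] is a point where [phi] equals [2^-1 ^+ k.+1 * phi t]; the value 0 off the positive axis
   keeps [del k] nondecreasing. *)
pose del k t := if 0 < t then iphi (2^-1 ^+ k.+1 * phi t) else 0.
pose b := (2 * sg)^-1; have b0 : 0 < b by rewrite invr_gt0 mulr_gt0.
pose be k := (b ^+ k.+1) `^ q.
have be0 k : 0 <= be k by exact: powR_ge0.
have beE k : be k = (l / ka) ^+ k.+1.
  rewrite /be -(@powR_mulrn _ b k.+1) ?(ltW b0)// powRAC powR_mulrn ?powR_ge0//.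
  congr (_ ^+ _); rewrite /b invfM powRM ?invr_ge0 ?(ltW sg0)//.
  have powRV x : 0 < x -> x^-1 `^ q = (x `^ q)^-1.
    move=> x0; have xq : x `^ q != 0 by rewrite gt_eqF// powR_gt0.
    apply: (mulIf xq); rewrite -powRM ?invr_ge0 ?(ltW x0)//.
    by rewrite mulVf ?gt_eqF// powR1 mulVf.
  by rewrite !powRV// sgq.
have p2 k t : 0 < t -> 0 < 2^-1 ^+ k.+1 * phi t.
  by move=> t0; rewrite mulr_gt0 ?exprn_gt0// phi_gt0.
have delpos k t : 0 < t -> 0 < del k t.
  by move=> t0; rewrite /del t0; case: (hi _ (p2 k t t0)).
have del0 k t : 0 <= t -> 0 <= del k t.
  by rewrite /del; case: ifP => // t0 _; case: (hi _ (p2 k t t0)) => /ltW.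
have phidel k t : 0 < t -> phi (del k t) = 2^-1 ^+ k.+1 * phi t.
  by move=> t0; rewrite /del t0; case: (hi _ (p2 k t t0)).
have delmono k s t : s <= t -> del k s <= del k t.
  move=> st; have [s0|s0] := ltP 0 s; last first.
    rewrite {1}/del ltNge s0/=; rewrite /del; case: ifP => // t0.
    by have := delpos k _ t0; rewrite /del t0 => /ltW.
  have t0 : 0 < t by exact: lt_le_trans st.
  have := phi_le nphi (ltW s0) st; rewrite le_eqVlt => /predU1P[e|lt].
    by rewrite /del s0 t0 e.
  apply: ltW; apply: phi_lt_cancel; first exact/ltW/delpos.
  by rewrite !phidel// ltr_pM2l// exprn_gt0.
(* From [del k t <= r] follows [phi t <= 2 ^+ k.+1 * phi r]. The exponent [k.+2] makes the
   inequality strict, as [phi_lt_cancel] requires. *)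
pose c k := (th / l) ^+ k.+2 * (1 + B).
have B1 : 0 < 1 + B by have := B0; lra.
have thl : 0 < th / l by rewrite divr_gt0.
have c0 k : 0 < c k by rewrite /c mulr_gt0// exprn_gt0.
have dil k h : antitone h -> (Phiq q v (h \o del k) <= (c k)%:E * Phiq q v h)%E.
  move=> ah; apply: Phiq_dilation => //.
  - exact: (del0 k).
  - exact: (delpos k).
  - by move=> s t _; exact: delmono.
  - move=> r r0; have pr := phi_gt0 nphi r0.
    exists (iphi (2 ^+ k.+2 * phi r)); last exact: weight_growth.
    have p2r : 0 < 2 ^+ k.+2 * phi r by rewrite mulr_gt0// exprn_gt0.
    have [i0 iE] := hi _ p2r.
    move=> t; rewrite le_eqVlt => /predU1P[<- _|t0 dr]; first exact: ltW.
    apply: ltW; apply: phi_lt_cancel; first exact: ltW.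
    have := phi_le nphi (ltW (delpos k t t0)) dr; rewrite phidel// iE exprVn.
    rewrite mulrC ler_pdivrMr ?exprn_gt0// => h'; apply: le_lt_trans h' _.
    by rewrite mulrC ltr_pM2r// [ltRHS]exprS ltr_pMl ?exprn_gt0//; lra.
pose C1 := Gq * (1 + B) * (th / l) / (1 - ka).
have ka1' : 0 < 1 - ka by rewrite subr_gt0.
have A10 : 0 < Gq * (1 + B) * (th / l) by apply: mulr_gt0 => //; exact: mulr_gt0.
have C10 : 0 < C1 by exact: divr_gt0.
exists (C1 `^ q^-1); first exact: powR_gt0.
move=> f g mf ag hg; set P := Phiq q v (rearr f).
have P0 : (0 <= P)%E by exact: Phiq_ge0.
suff main : (Phiq q v g <= C1%:E * P)%E.
  rewrite /Lq -poweR_EFin -poweRM ?lee_fin ?(ltW C10)//.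
  by apply: lee_poweR => //; [rewrite invr_ge0 ltW|exact: Phiq_ge0].
case PE : P P0 => [p| |] // p0; last by rewrite gt0_muley ?leey// lte_fin.
pose u k t := poweR (rearr f (del k t)) q.
have u0 k t : (0 <= u k t)%E by exact: poweR_ge0.
have bu0 k t : (0 <= (be k)%:E * u k t)%E.
  by apply: mule_ge0; [rewrite lee_fin; exact: be0|exact: u0].
pose F k t := ((Gq * be k)%:E * (u k t * (v t)%:E))%E.
have F0 k t : (0 <= F k t)%E.
  apply: mule_ge0; first by rewrite lee_fin; apply: mulr_ge0; [exact: ltW|exact: be0].
  by apply: mule_ge0; [exact: u0|rewrite lee_fin].
have adel k : antitone (rearr f \o del k).
  split => [t|s t st] /=; first exact: rearr_ge0.
  by apply: le_rearr; exact: delmono.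
have mF k : measurable_fun (I : set LR) (F k).
  apply: measurable_funeM; exact: (measurable_integrand q mv (adel k)).
have pointwise t : 0 < t -> (poweR (g t) q * (v t)%:E <= \sum_(k <oo) F k t)%E.
  move=> t0; have pt := phi_gt0 nphi t0.
  have -> : (\sum_(k <oo) F k t = (Gq * v t)%:E * \sum_(k <oo) ((be k)%:E * u k t))%E.
    rewrite -nneseriesZl; last by move=> k _; exact: bu0.
    apply: eq_eseriesr => k _; rewrite /F !EFinM [(u k t * _)%E]muleC.
    exact: muleACA.
  rewrite EFinM muleAC; apply: lee_wpmul2r; first by rewrite lee_fin.
  have : (0 <= \sum_(k <oo) ((be k)%:E * u k t))%E by apply: nneseries_ge0 => k _ _; exact: bu0.
  case YE : (\sum_(k <oo) ((be k)%:E * u k t))%E => [Y| |] // Y0; last first.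
    by rewrite gt0_muley ?leey// lte_fin.
  rewrite lee_fin in Y0.
  (* Each term is at most the whole series [Y], so with [y] the root of order [q] of [Y] every shell
     satisfies the hypothesis of [prim_shells]. *)
  have term k : ((be k)%:E * u k t <= Y%:E)%E.
    rewrite -YE; apply: le_trans (@nneseries_lim_ge _ _ xpredT 0%N k.+1 _).
      by rewrite big_nat_recr//= leeDr// sume_ge0.
    by move=> i _ _; exact: bu0.
  pose y := Y `^ q^-1; have y0 : 0 <= y by exact: powR_ge0.
  have hy k : (rearr f (iphi (2^-1 ^+ k.+1 * phi t)%R) <= ((2 * sg) ^+ k.+1 * y)%:E)%E.
    have -> : iphi (2^-1 ^+ k.+1 * phi t) = del k t by rewrite /del t0.
    have bk : 0 < b ^+ k.+1 by rewrite exprn_gt0.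
    have -> : (2 * sg) ^+ k.+1 = (b ^+ k.+1)^-1 by rewrite /b exprVn invrK.
    rewrite EFinM lee_pdivlMl//.
    have h0 : (0 <= (b ^+ k.+1)%:E * rearr f (del k t))%E.
      by rewrite mule_ge0 ?rearr_ge0// lee_fin ltW.
    rewrite -[leLHS](poweRK q0 h0) /y -poweR_EFin; apply: lee_poweR.
    - by rewrite invr_ge0 ltW.
    - exact: poweR_ge0.
    - rewrite poweRM ?rearr_ge0// ?lee_fin ?(ltW bk)// poweR_EFin; exact: term.
  have hs := prim_shells hi t0 y0 hy.
  have gy : (g t <= (y * G)%:E)%E.
    have := le_trans (hg t t0) hs; rewrite [in leRHS]EFinM.
    by rewrite lee_pmul2l ?lte_fin.
  apply: le_trans (lee_poweR (ltW q0) _ gy) _; first by case: ag.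
  rewrite poweR_EFin powRM ?(ltW G0)// -/Gq EFinM muleC; apply: lee_wpmul2l.
    by rewrite lee_fin ltW.
  by rewrite lee_fin /y -powRrM mulVf ?gt_eqF// powRr1.
(* The weight [be k] is [(l / ka) ^+ k.+1] and the dilation costs [(th / l) ^+ k.+2 * (1 + B)]. In
   the product the powers of [l] cancel up to one factor [th / l], and [th / ka = ka] is left with
   exponent [k.+1]. *)
have intF k : (\int[mu]_(t in I) F k t <= (Gq * (1 + B) * (th / l) * p * ka ^+ k.+1)%:E)%E.
  rewrite /F ge0_integralZl.
  - apply: le_trans (_ : (Gq * be k)%:E * ((c k)%:E * P) <= _)%E.
      apply: lee_wpmul2l; first by rewrite lee_fin mulr_ge0// ltW.
      exact: (dil k _ (antitone_rearr f)).
    rewrite PE -!EFinM lee_fin beE /c (exprS (th / l) k.+1).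
    rewrite [X in _ <= _ * X ^+ _](_ : ka = th / ka); last first.
      by rewrite -kaE expr2 mulfK// gt_eqF.
    rewrite (expr_div_n l ka) (expr_div_n th l) (expr_div_n th ka).
    have lk : 0 < l ^+ k.+1 by rewrite exprn_gt0.
    have kk : 0 < ka ^+ k.+1 by rewrite exprn_gt0.
    rewrite le_eqVlt; apply/orP; left; apply/eqP.
    move: (l ^+ k.+1) (ka ^+ k.+1) (th ^+ k.+1) (th / l) lk kk => X Y Z T X0 Y0.
    by field; rewrite !gt_eqF.
  - exact: mI.
  - exact: (measurable_integrand q mv (adel k)).
  - by move=> t _; apply: mule_ge0 => //; rewrite lee_fin.
  - by rewrite lee_fin mulr_ge0// ltW.
apply: (@le_trans _ _ (\int[mu]_(t in I) (\sum_(k <oo) F k t))%E).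
  apply: ae_ge0_le_integral.
  - exact: mI.
  - by move=> t _; apply: integrand_ge0.
  - exact: measurable_integrand.
  - by move=> t _; apply: nneseries_ge0 => k _ _; exact: F0.
  - apply: ge0_emeasurable_sum => [k t _ _|k _]; [exact: F0|exact: mF].
  - by apply: aeI_mono (@aeI_pos R) _ => t _; exact: pointwise.
rewrite integral_nneseries; last 3 first.
- exact: mI.
- exact: mF.
- by move=> k t _; exact: F0.
apply: (@le_trans _ _ (\sum_(k <oo) (Gq * (1 + B) * (th / l) * p * ka ^+ k.+1)%:E)%E).
  apply: lee_nneseries => [k _ _|k _]; last exact: intF.
  by apply: integral_ge0 => t _; exact: F0.
rewrite lee_fin in p0.
have A0 : 0 <= Gq * (1 + B) * (th / l) * p.
  by apply: mulr_ge0 => //; exact: ltW.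
apply: lime_le.
  by apply: is_cvg_nneseries => k _ _; rewrite lee_fin mulr_ge0// exprn_ge0// ltW.
apply: nearW => n; rewrite -EFinM sumEFin lee_fin -mulr_sumr.
have -> : C1 * p = Gq * (1 + B) * (th / l) * p * (1 - ka)^-1 by rewrite /C1; ring.
apply: ler_wpM2l => //.
apply: (@le_trans _ _ ((1 - ka ^+ n) / (1 - ka))); last first.
  by rewrite -[leRHS]mul1r ler_wpM2r ?invr_ge0 ?(ltW ka1')// gerBl exprn_ge0//; exact: ltW.
elim: n => [|n IH]; first by rewrite big_nil expr0 subrr mul0r.
rewrite big_nat_recr//=; apply: le_trans (_ : (1 - ka ^+ n) / (1 - ka) + ka ^+ n.+1 <= _).
  by rewrite lerD2r.
rewrite -(ler_pM2r ka1') mulrDl !divfK ?gt_eqF// exprS.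
have : 0 <= ka ^+ n * (1 - ka) ^+ 2 by rewrite mulr_ge0 ?exprn_ge0 ?(ltW ka0) ?(ltW ka1').
by move: (ka ^+ n) => X; rewrite expr2; lra.
Qed.

End hardy.

(** * The weighted supremum functional and its Hardy inequality *)

Lemma ae_eq_aeI (R : realType) (D : set R) (g h : R -> \bar R) : D `<=` @halfline R ->
  aeI (fun x => g x = h x) -> ae_eq (@leb R) (D : set (lebesgueType R)) g h.
Proof. by move=> DI; rewrite /ae_eq /aeI; apply: filterS => x h' /DI/h'. Qed.

Section sup_functional.
Context {R : realType}.
Variable w : R -> R.
Local Notation I := (@halfline R).
Local Notation mu := (@leb R).
Local Notation LR := (lebesgueType R).
Local Notation GR := (measurableTypeR R).
Implicit Types (t r s : R) (g h : R -> \bar R).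
Hypotheses (w0 : forall t, 0 < t -> 0 < w t)
  (w_le : forall s t, 0 < s -> s <= t -> w s <= w t).

Definition Lsup g : \bar R := ereal_sup [set (g t * (w t)%:E)%E | t in `]0, +oo[].

Lemma Lsup_ub g t : 0 < t -> (g t * (w t)%:E <= Lsup g)%E.
Proof. by move=> t0; apply: ereal_sup_ubound; exists t => //=; rewrite in_itv/= t0. Qed.

Lemma Lsup_le g (x : \bar R) :
  (forall t, 0 < t -> (g t * (w t)%:E <= x)%E) -> (Lsup g <= x)%E.
Proof.
by move=> h; apply: ge_ereal_sup => _ [t /= + <-]; rewrite in_itv/= andbT; exact: h.
Qed.

Lemma Lsup_ge0 g : antitone g -> (0 <= Lsup g)%E.
Proof.
move=> [g0 _]; apply: le_trans (Lsup_ub g (@ltr01 R)).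
by apply: mule_ge0; [exact: g0|rewrite lee_fin ltW// w0].
Qed.

Lemma Lsup_ri_functional :
  (exists2 D : R, 0 < D & forall t, 0 < t -> w (2 * t) <= D * w t) ->
  ri_functional Lsup.
Proof.
move=> [D D0 hD]; split.
- move=> g h _ _ gh; apply: Lsup_le => t t0; apply: le_trans (Lsup_ub h t0).
  by apply: lee_wpmul2r; [rewrite lee_fin ltW ?w0|exact: gh].
- by move=> g; exact: Lsup_ge0.
- move=> c g; rewrite le_eqVlt => /predU1P[<-|c0] ag.
    rewrite mul0e; apply/eqP; rewrite eq_le; apply/andP; split.
      by apply: Lsup_le => t _; rewrite !mul0e.
    by apply: Lsup_ge0; split => [t|s t _]; rewrite !mul0e.
  rewrite /Lsup -ereal_sup_pZl//; congr ereal_sup; apply/seteqP; split.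
    move=> _ [t t0 <-]; exists (g t * (w t)%:E)%E; first by exists t.
    by rewrite muleA.
  by move=> _ [_ [t t0 <-] <-]; exists t => //; rewrite muleA.
- by exists w; split => // t g t0 _; exact: Lsup_ub.
- exists (Num.max 1 D) => [|g h ag ah]; first by rewrite le_max lexx.
  have gh0 : (0 <= Lsup g + Lsup h)%E by apply: adde_ge0; exact: Lsup_ge0.
  apply: (@le_trans _ _ (D%:E * (Lsup g + Lsup h))%E); last first.
    by apply: lee_wpmul2r => //; rewrite lee_fin le_max lexx orbT.
  apply: Lsup_le => t t0; have t20 : 0 < t / 2 by rewrite divr_gt0.
  have wt : w t <= D * w (t / 2).
    by have := hD _ t20; rewrite (_ : 2 * (t / 2) = t)//; field.
  apply: (@le_trans _ _ ((g (t / 2)%R + h (t / 2)%R) * (D * w (t / 2)%R)%:E)%E).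
    apply: lee_wpmul2l; last by rewrite lee_fin.
    by apply: adde_ge0; [case: ag|case: ah].
  rewrite EFinM muleCA; apply: lee_wpmul2l; first by rewrite lee_fin ltW.
  rewrite ge0_muleDl; [|by case: ag|by case: ah].
  by apply: leeD; exact: Lsup_ub.
- move=> g ag gn; apply/eqP; rewrite eq_le; apply/andP; split.
    apply: Lsup_le => t t0; rewrite muleC -ereal_sup_pZl ?w0//.
    apply: ge_ereal_sup => _ [_ [n _ <-] <-].
    apply: le_ereal_sup_tmp; exists (Lsup (g n)); first by exists n.
    by rewrite muleC; exact: Lsup_ub.
  apply: ge_ereal_sup => _ [n _ <-]; apply: Lsup_le => t t0.
  apply: le_trans (Lsup_ub _ t0); apply: lee_wpmul2r; first by rewrite lee_fin ltW ?w0.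
  by apply: ereal_sup_ubound; exists n.
- move=> M L M0 L0; apply: le_lt_trans (ltry (M * w L)).
  apply: Lsup_le => t t0; case: ifP => tL; last by rewrite mul0e lee_fin mulr_ge0// ltW ?w0.
  by rewrite -EFinM lee_fin ler_pM2l// w_le// ltW.
Qed.

Let winf := inf [set w y | y in `]0, +oo[].

Lemma winf_lb : has_inf [set w y | y in `]0, +oo[].
Proof.
split; first by exists (w 1), 1 => //=; rewrite in_itv/= ltr01.
by exists 0 => _ [y /= + <-]; rewrite in_itv/= andbT => y0; rewrite ltW ?w0.
Qed.

Lemma winf_ge0 : 0 <= winf.
Proof.
apply: lb_le_inf; first by case: winf_lb.
by move=> _ [y /= + <-]; rewrite in_itv/= andbT => y0; rewrite ltW ?w0.
Qed.

Lemma winf_le t : 0 < t -> winf <= w t.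
Proof.
move=> t0; apply: ge_inf; first by case: winf_lb.
by exists t => //=; rewrite in_itv/= t0.
Qed.

Lemma weight_at_pos t : 0 < t -> weight_at w t = w t.
Proof. by move=> t0; rewrite /weight_at gt_eqF. Qed.

Lemma weight_at_ge0 t : 0 <= t -> 0 <= weight_at w t.
Proof.
rewrite /weight_at le_eqVlt => /predU1P[<-|t0]; first by rewrite eqxx winf_ge0.
by rewrite gt_eqF// ltW// w0.
Qed.

Lemma weight_at_le s t : 0 <= s -> s <= t -> weight_at w s <= weight_at w t.
Proof.
rewrite le_eqVlt => /predU1P[<-|s0 st]; last first.
  by rewrite !weight_at_pos ?w_le// (lt_le_trans s0).
rewrite le_eqVlt => /predU1P[<-//|t0].
by rewrite (weight_at_pos t0) /weight_at eqxx winf_le.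
Qed.

Lemma measurable_inv_weight_at t :
  measurable_fun (`[0, t]%classic : set GR) (fun x => ((weight_at w x)%:E^-1)%E).
Proof.
apply: measurable_antitone; first exact: interval_is_interval.
move=> x y; rewrite /= !in_itv/= => /andP[x0 _] /andP[y0 _] xy.
rewrite lee_pV2 ?inE/= ?lee_fin ?weight_at_ge0//.
exact: weight_at_le.
Qed.

(** At positive points this is the definition of the norm. The point 0 matters because [dphi] may
    charge it; there the bound is obtained from positive points, with [w (0+)] as the weight. *)
Lemma rearr_le_weight f (n : R) x : lmeasurable f -> 0 <= x ->
  (Lsup (rearr f) <= n%:E)%E -> (rearr f x <= n%:E * ((weight_at w x)%:E^-1))%E.
Proof.
move=> mf + fn.
have pos y : 0 < y -> (rearr f y <= (n / w y)%:E)%E.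
  move=> y0; rewrite EFinM lee_pdivlMr ?w0//; apply: le_trans fn; exact: Lsup_ub.
have n0 : 0 <= n.
  by rewrite -lee_fin; apply: le_trans fn; apply: Lsup_ge0; exact: antitone_rearr.
rewrite le_eqVlt => /predU1P[<-|x0]; last first.
  by rewrite weight_at_pos// inver gt_eqF ?w0// -EFinM pos.
have i0 : (0 <= ((weight_at w 0)%:E^-1))%E by rewrite inve_ge0 lee_fin weight_at_ge0.
(* A level [s] below [rearr f 0] has a level set of positive measure, so it is already below
   [rearr f y] for some [y > 0]. *)
apply: lee_distr; first exact: rearr_ge0; last by apply: mule_ge0; rewrite ?lee_fin.
move=> s s0; rewrite rearr_gt// => df.
have [y y0 yd] : exists2 y : R, 0 < y & (y%:E < distr f s)%E.
  case: (distr f s) df => [d| |] //; last by move=> _; exists 1; rewrite ?ltry.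
  by rewrite lte_fin => d0; exists (d / 2); rewrite ?divr_gt0// lte_fin ltr_pdivrMr//; lra.
have /lt_le_trans/(_ (pos _ y0)) : (s%:E < rearr f y)%E by rewrite rearr_gt.
rewrite lte_fin => sy.
(* If [w (0+) = 0], the extended inverse is [+oo]; the product is then infinite because [n > 0], as
   [0 <= s < n / w y]. *)
have := winf_ge0; rewrite /weight_at eqxx -/winf inver le_eqVlt => /predU1P[<-|a0].
  rewrite eqxx gt0_muley ?ltry// lte_fin; apply: lt_le_trans (_ : 0 < n / w y * w y) _.
    by rewrite mulr_gt0 ?w0// (le_lt_trans s0).
  by rewrite divfK// gt_eqF// w0.
rewrite gt_eqF// -EFinM lte_fin; apply: lt_le_trans sy _.
by rewrite ler_wpM2l// lef_pV2 ?posrE ?w0// winf_le.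
Qed.

Lemma hardy_Lsup (phi : R -> R) : normalized_fundamental phi ->
  (exists2 C : R, 0 < C & forall t, 0 < t ->
    (\int[stieltjes phi]_(x in `[0%R, t]) ((weight_at w x)%:E)^-1 <=
     (C * (phi t / w t))%:E)%E) ->
  exists2 C : R, 0 < C & forall (f : R -> R) g, lmeasurable f -> antitone g ->
    (forall t, 0 < t -> ((phi t)%:E * g t <= prim phi f t)%E) ->
    (Lsup g <= C%:E * Lsup (rearr f))%E.
Proof.
move=> nphi [C C0 cond]; exists C => // f g mf ag hg.
have := Lsup_ge0 (antitone_rearr f).
case NE : (Lsup (rearr f)) => [n| |] //; last first.
  by rewrite gt0_muley ?leey// lte_fin.
rewrite lee_fin => n0; apply: Lsup_le => t t0.
have pt := phi_gt0 nphi t0; have wt := w0 t0.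
rewrite -lee_pdivlMr// -EFinM -(@lee_pmul2l _ (phi t)%:E) ?lte_fin//.
apply: le_trans (hg t t0) _.
apply: (@le_trans _ _ (n%:E * \int[stieltjes phi]_(x in `[0%R, t]) ((weight_at w x)%:E)^-1)%E); last first.
  apply: le_trans (lee_wpmul2l _ (cond t t0)) _; first by rewrite lee_fin.
  by rewrite -!EFinM lee_fin le_eqVlt; apply/orP; left; apply/eqP; ring.
have i0 x : `[0, t]%classic x -> (0 <= ((weight_at w x)%:E^-1))%E.
  by rewrite /= in_itv/= => /andP[x0 _]; rewrite inve_ge0 lee_fin weight_at_ge0.
rewrite -ge0_integralZl.
- apply: ge0_le_integral.
  + exact: measurable_itv.
  + by move=> x _; exact: rearr_ge0.
  + exact: measurable_rearr_itv.
  + apply: measurable_funeM; exact: measurable_inv_weight_at.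
  + move=> x; rewrite /= in_itv/= => /andP[x0 _].
    by apply: rearr_le_weight => //; rewrite NE.
- exact: measurable_itv.
- exact: measurable_inv_weight_at.
- exact: i0.
- by rewrite lee_fin.
Qed.

Lemma measurable_halfline d (U : measurableType d) (h : R -> U) :
  measurable_fun (`]0, +oo[%classic : set LR) h -> measurable_fun (I : set LR) h.
Proof.
move=> mh; have -> : I = [set 0] `|` `]0, +oo[%classic.
  apply/seteqP; split => x; rewrite halflineE/= in_itv/= andbT.
    by rewrite le_eqVlt => /predU1P[<-|]; [left|right].
  by move=> [->|/ltW].
apply/measurable_funU; first by apply: borel_lebesgue; exact: measurable_set1.
  exact: lebesgue_itv.
by split => //; exact: measurable_fun_set1.
Qed.

Lemma lmeasurable_inv_weight : lmeasurable (fun x => (w x)^-1).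
Proof.
apply: measurable_halfline.
suff : measurable_fun (`]0, +oo[%classic : set LR) (EFin \o (fun x => (w x)^-1)).
  by move/measurable_EFinP.
apply: measurable_antitone_leb; first exact: interval_is_interval.
move=> x y; rewrite /= !in_itv/= !andbT => x0 y0 xy.
by rewrite lee_fin lef_pV2 ?posrE ?w0// w_le.
Qed.

(** The value 0 off the positive axis makes the function nonnegative everywhere, while [w] is
    controlled at positive points. *)
Definition inv_weight x : R := if 0 < x then (w x)^-1 else 0.

Lemma lmeasurable_inv_weight0 : lmeasurable inv_weight.
Proof.
apply: measurable_halfline; apply: eq_measurable_fun (measurable_funS _ _ lmeasurable_inv_weight).
- by move=> x; rewrite inE/= in_itv/= andbT /inv_weight => ->.
- exact: mI.
- by move=> x /=; rewrite in_itv/= halflineE andbT => /ltW.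
Qed.

Lemma inv_weight_ge0 x : 0 <= inv_weight x.
Proof. by rewrite /inv_weight; case: ifP => // x0; rewrite invr_ge0 ltW ?w0. Qed.

(** By monotonicity the integral of [1 / w] over [[0, 2 t]] is at least [t / w t], its part over
    []0, t]]. Inserting this in [A1] at [2 * t] compares [w (2 t)] with [w t]. *)
Lemma A1_doubling : A1 w -> exists2 D : R, 0 < D & forall t, 0 < t -> w (2 * t) <= D * w t.
Proof.
move=> [C C0 hC]; exists (2 * C) => [|t t0]; first by rewrite mulr_gt0.
have t20 : 0 < 2 * t by rewrite mulr_gt0.
have sub r : `[0, r]%classic `<=` I by exact: sub0I.
have mi r : measurable_fun (`[0, r]%classic : set LR) (fun x => (inv_weight x)%:E).
  apply: measurable_funS mI (sub r) _; apply/measurable_EFinP; exact: lmeasurable_inv_weight0.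
have E : (\int[mu]_(x in `[0%R, (2 * t)%R]) (w x)^-1%:E =
    \int[mu]_(x in `[0%R, (2 * t)%R]) (inv_weight x)%:E)%E.
  apply: ae_eq_integral.
  - exact: lebesgue_itv.
  - apply: measurable_funS mI (sub _) _; apply/measurable_EFinP; exact: lmeasurable_inv_weight.
  - exact: mi.
  - by apply: ae_eq_aeI (sub _) _; apply: aeI_mono (@aeI_pos R) _ => x _ x0; rewrite /inv_weight x0.
have := hC _ t20; rewrite E => h.
have : (((w t)^-1 * t)%:E <= \int[mu]_(x in `[0%R, (2 * t)%R]) (inv_weight x)%:E)%E.
  apply: (@le_trans _ _ (\int[mu]_(x in `]0%R, t]) (inv_weight x)%:E)%E).
    apply: (@le_trans _ _ (\int[mu]_(x in `]0%R, t]) (cst (w t)^-1%:E) x)%E).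
      rewrite integral_cst; last exact: lebesgue_itv.
      by rewrite [X in (_ <= _ * X)%E](leb_itv `]0, t])/= lte_fin t0 -EFinD subr0 -EFinM.
    apply: ge0_le_integral.
    - exact: lebesgue_itv.
    - by move=> x _; rewrite lee_fin invr_ge0 ltW// w0.
    - exact: measurable_cst.
    - apply: measurable_funS (lebesgue_itv _) _ (mi t) => x /=.
      by rewrite !in_itv/= => /andP[/ltW -> ->].
    - move=> x; rewrite /= in_itv/= => /andP[x0 xt].
      by rewrite lee_fin /inv_weight x0 lef_pV2 ?posrE ?w0// w_le.
  apply: ge0_subset_integral.
  - exact: lebesgue_itv.
  - exact: lebesgue_itv.
  - exact: mi.
  - by move=> x _; rewrite lee_fin inv_weight_ge0.
  - move=> x /=; rewrite !in_itv/= => /andP[/ltW -> xt]/=; apply: le_trans xt _.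
    by rewrite ler_peMl ?(ltW t0)//; lra.
move=> h'; have wt := w0 t0; have w2t := w0 t20.
have := le_trans (lee_wpmul2l _ h') h.
rewrite lee_fin divr_ge0 ?(ltW w2t) ?(ltW t20)// => /(_ isT).
rewrite -EFinM lee_fin.
rewrite (_ : w (2 * t) / (2 * t) * ((w t)^-1 * t) = w (2 * t) / w t / 2); last first.
  by field; rewrite !gt_eqF.
rewrite ler_pdivrMr// ler_pdivrMr// => h2; apply: le_trans h2 _.
by rewrite le_eqVlt; apply/orP; left; apply/eqP; ring.
Qed.

End sup_functional.

(** * A monotone density comparable with [dphi] *)

Section density.
Context {R : realType}.
Variable phi : R -> R.
Hypothesis nphi : normalized_fundamental phi.
Local Notation I := (@halfline R).
Local Notation mu := (@leb R).
Local Notation LR := (lebesgueType R).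
Local Notation GR := (measurableTypeR R).
Local Notation m := (stieltjes phi).
Implicit Types (a t r s x y : R).

(** The slope of [phi] over [[x, 2 x]], a pointwise substitute for [phi'] that sees the concavity of
    [phi] directly. *)
Definition dens x := if 0 < x then (phi (2 * x) - phi x) / x else 0.

Lemma dens_ge0 x : 0 <= dens x.
Proof.
rewrite /dens; case: ifP => // x0; rewrite divr_ge0 ?(ltW x0)// subr_ge0.
by apply: phi_le => //; lra.
Qed.

Lemma dens_le x y : 0 < x -> x <= y -> dens y <= dens x.
Proof.
move=> x0; rewrite le_eqVlt => /predU1P[<-//|xy]; have y0 := lt_trans x0 xy.
rewrite /dens x0 y0 ler_pdivrMr// mulrAC ler_pdivlMr//.
(* Concavity at [x < 2 x < 2 y] and at [x < y < 2 y]. Adding [y] times the first to [x] times the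
   second produces the common factor [2 * y - x]. *)
have h1 : (2 * y - 2 * x) * phi x + (2 * x - x) * phi (2 * y) <= (2 * y - x) * phi (2 * x).
  by apply: phi_concave => //; lra.
have h2 : (2 * y - y) * phi x + (y - x) * phi (2 * y) <= (2 * y - x) * phi y.
  by apply: phi_concave => //; lra.
have yx : 0 < 2 * y - x by lra.
rewrite -(ler_pM2l yx).
have := ler_wpM2l (ltW y0) h1; have := ler_wpM2l (ltW x0) h2.
by move: (phi x) (phi y) (phi (2 * x)) (phi (2 * y)) => *; lra.
Qed.

Lemma lmeasurable_dens : lmeasurable dens.
Proof.
apply: measurable_halfline; apply/measurable_EFinP; apply: measurable_antitone_leb.
  exact: interval_is_interval.
by move=> x y; rewrite /= !in_itv/= !andbT => x0 _ xy; rewrite lee_fin dens_le.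
Qed.

Lemma measurable_dens (A : set R) : A `<=` I ->
  measurable_fun (A : set LR) (fun x => (dens x)%:E).
Proof. by move=> AI; apply: mve_sub => //; exact: lmeasurable_dens. Qed.

Lemma int_oc_split (h : R -> \bar R) a b c : a <= b -> b <= c ->
  measurable_fun (`]a, c]%classic : set LR) h -> (forall x, 0 <= h x)%E ->
  (\int[mu]_(x in `]a, c]) h x = \int[mu]_(x in `]a, b]) h x + \int[mu]_(x in `]b, c]) h x)%E.
Proof.
move=> ab bc mh h0.
have E : `]a, c]%classic = `]a, b] `|` `]b, c] by rewrite -itv_bndbnd_setU// bnd_simp.
rewrite [in LHS]E ge0_integral_setU//.
- exact: lebesgue_itv.
- exact: lebesgue_itv.
- by rewrite -E.
- rewrite disj_set2E; apply/eqP/seteqP; split => x //=; rewrite !in_itv/=.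
  by move=> [/andP[_ xt] /andP[]]; rewrite ltNge xt.
Qed.

Lemma int_cst_oc a b (c : R) : a < b ->
  (\int[mu]_(x in `]a, b]) (cst c%:E) x = (c * (b - a))%:E)%E.
Proof.
move=> ab; rewrite integral_cst; last exact: lebesgue_itv.
by rewrite [X in (_ * X)%E](leb_itv `]a, b])/= lte_fin ab -EFinD -EFinM.
Qed.

(** On the shell [dens] lies between its values at the two ends. Both are slopes of [phi], so the
    bounds are increments of [phi] that telescope when [a] is halved repeatedly. *)
Lemma int_dens_shell a : 0 < a ->
  ((2^-1 * (phi (2 * a) - phi a))%:E <= \int[mu]_(x in `](a / 2)%R, a]) (dens x)%:E)%E /\
  (\int[mu]_(x in `](a / 2)%R, a]) (dens x)%:E <= (phi a - phi (a / 2))%:E)%E.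
Proof.
move=> a0; have a20 : 0 < a / 2 by lra.
have aa : a / 2 < a by lra.
have md : measurable_fun (`]a / 2, a]%classic : set LR) (fun x => (dens x)%:E).
  by apply: measurable_dens => x /=; rewrite in_itv/= halflineE => /andP[/(lt_trans a20)/ltW].
split.
- apply: (@le_trans _ _ (\int[mu]_(x in `](a / 2)%R, a]) (cst (dens a)%:E) x)%E).
    rewrite int_cst_oc// lee_fin /dens a0 le_eqVlt; apply/orP; left; apply/eqP.
    by field; rewrite gt_eqF.
  apply: ge0_le_integral.
  + exact: lebesgue_itv.
  + by move=> x _; rewrite lee_fin dens_ge0.
  + exact: measurable_cst.
  + exact: md.
  + move=> x; rewrite /= in_itv/= => /andP[ax xa]; rewrite lee_fin.
    by apply: dens_le => //; exact: lt_trans ax.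
- apply: (@le_trans _ _ (\int[mu]_(x in `](a / 2)%R, a]) (cst (dens (a / 2))%:E) x)%E).
    apply: ge0_le_integral.
    + exact: lebesgue_itv.
    + by move=> x _; rewrite lee_fin dens_ge0.
    + exact: md.
    + exact: measurable_cst.
    + move=> x; rewrite /= in_itv/= => /andP[ax xa]; rewrite lee_fin.
      by apply: dens_le => //; exact: ltW.
  rewrite int_cst_oc// lee_fin /dens a20 (_ : 2 * (a / 2) = a); last by field.
  rewrite le_eqVlt; apply/orP; left; apply/eqP.
  by field; rewrite gt_eqF.
Qed.

Let e a n : R := 2^-1 ^+ n * a.

Let e0 a n : 0 < a -> 0 < e a n.
Proof. by move=> a0; rewrite /e mulr_gt0// exprn_gt0. Qed.

Let eS a n : e a n.+1 = e a n / 2.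
Proof. by rewrite /e exprS; field. Qed.

Let ele a n : 0 < a -> e a n <= a.
Proof. by move=> a0; rewrite /e ger_pMl// exprn_ile1//; lra. Qed.

Let int_dens_shells a n : 0 < a ->
  ((2^-1 * (phi (2 * a) - phi (2 * e a n)))%:E <= \int[mu]_(x in `]e a n, a]) (dens x)%:E)%E /\
  (\int[mu]_(x in `]e a n, a]) (dens x)%:E <= (phi a - phi (e a n))%:E)%E.
Proof.
move=> a0; elim: n => [|n [IH1 IH2]].
  by rewrite /e expr0 mul1r set_itvoc0 integral_set0 !subrr mulr0.
have en0 := e0 n a0.
rewrite (@int_oc_split _ _ (e a n)); last 4 first.
- by rewrite eS; move: en0; lra.
- exact: ele.
- by apply: measurable_dens => x /=; rewrite in_itv/= halflineE => /andP[/(lt_trans (e0 _ a0))/ltW].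
- by move=> x; rewrite lee_fin dens_ge0.
have [h1 h2] := int_dens_shell en0; rewrite eS; split.
- apply: le_trans (leeD h1 IH1); rewrite -EFinD lee_fin (_ : 2 * (e a n / 2) = e a n); last by field.
  by lra.
- by apply: le_trans (leeD h2 IH2) _; rewrite -EFinD lee_fin; lra.
Qed.

Let e_small a (d : R) : 0 < a -> 0 < d -> exists n, e a n < d.
Proof.
move=> a0 d0; have h1 : `|2^-1 : R| < 1 by rewrite gtr0_norm//; lra.
have := cvg_expr h1 => /cvgrPdist_lt /(_ (d / a)).
rewrite divr_gt0// => /(_ isT) [n _ /(_ n (leqnn _))].
rewrite /= sub0r normrN ger0_norm ?exprn_ge0// ltr_pdivlMr// => hn.
by exists n.
Qed.

Lemma int_dens_ub a : 0 < a ->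
  (\int[mu]_(x in `]0%R, a]) (dens x)%:E <= (phi a - phi0p phi)%:E)%E.
Proof.
move=> a0; pose F n := `]e a n, a]%classic : set R.
have ndF : nondecreasing_seq F.
  apply/nondecreasing_seqP => n; apply/subsetPset => x; rewrite /F/= !in_itv/= => /andP[ix ->].
  by rewrite andbT; apply: lt_trans ix; rewrite eS; have := e0 n a0; lra.
have UF : \bigcup_n F n = `]0, a]%classic.
  apply/seteqP; split => x; rewrite /= in_itv/=.
    by move=> [n _]; rewrite /F/= in_itv/= => /andP[nx ->]; rewrite andbT (lt_trans _ nx)// e0.
  move=> /andP[x0 xt]; have [n en] := e_small a0 x0.
  by exists n => //; rewrite /F/= in_itv/= en xt.
have H : (\int[mu]_(x in F n) (dens x)%:E @[n --> \oo] --> \int[mu]_(x in `]0%R, a]) (dens x)%:E)%E.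
  rewrite -UF; apply: ge0_nondecreasing_set_cvg_integral.
  - exact: ndF.
  - by move=> n; exact: lebesgue_itv.
  - by move=> n; apply: measurable_dens => x; rewrite /F/= in_itv/= halflineE => /andP[/(lt_trans (e0 _ a0))/ltW].
  - by move=> n x _; rewrite lee_fin dens_ge0.
rewrite -(cvg_lim _ H)//; apply: lime_le; first by apply/cvg_ex; eexists; exact: H.
apply: nearW => n; apply: le_trans (int_dens_shells n a0).2 _.
by rewrite lee_fin lerB// phi0p_le// e0.
Qed.

Lemma int_dens_lb a : 0 < a ->
  ((2^-1 * (phi (2 * a) - phi0p phi))%:E <= \int[mu]_(x in `]0%R, a]) (dens x)%:E)%E.
Proof.
move=> a0; apply/lee_addgt0Pr => d d0.
have [t t0 td] : exists2 t, 0 < t & phi t < phi0p phi + d.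
  by apply: phi0p_adherent => //; rewrite ltrDl.
have [n en] := e_small a0 (divr_gt0 t0 (@ltr0Sn R 1)).
apply: (@le_trans _ _ (\int[mu]_(x in `]e a n, a]) (dens x)%:E + d%:E)%E); last first.
  rewrite leeD2r//; apply: ge0_subset_integral.
  - exact: lebesgue_itv.
  - exact: lebesgue_itv.
  - by apply: measurable_dens => x /=; rewrite in_itv/= halflineE => /andP[/ltW].
  - by move=> x _; rewrite lee_fin dens_ge0.
  - by move=> x /=; rewrite !in_itv/= => /andP[/(lt_trans (e0 n a0)) -> ->].
apply: (@le_trans _ _ ((2^-1 * (phi (2 * a) - phi (2 * e a n)))%:E + d%:E)%E); last first.
  by rewrite leeD2r// (int_dens_shells n a0).1.
have h : phi (2 * e a n) <= phi t.
  by apply: phi_le => //; [rewrite mulr_ge0// ltW// e0|move: en; rewrite ltr_pdivlMr//; lra].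
by rewrite -EFinD lee_fin; lra.
Qed.

Lemma int_dens_0c a : (\int[mu]_(x in `[0%R, a]) (dens x)%:E = \int[mu]_(x in `]0%R, a]) (dens x)%:E)%E.
Proof.
rewrite [LHS](@ge0_negligible_integral _ LR R mu `[0, a]%classic [set 0]).
- congr (integral _ _ _); apply/seteqP; split => x /=; rewrite !in_itv/=.
    by move=> [/andP[x0 ->] /eqP x0']; rewrite andbT lt_neqAle eq_sym x0' x0.
  by move=> /andP[x0 ->]; rewrite ltW//; split => //; apply/eqP; rewrite gt_eqF.
- by apply: borel_lebesgue; exact: measurable_set1.
- exact: lebesgue_itv.
- by apply: measurable_dens; exact: sub0I.
- by move=> x _; rewrite lee_fin dens_ge0.
- exact: leb_set1.
Qed.

(** The part of [E] in [[0, r]] contributes at most [phi r]. Beyond [r] the density is at most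
    [dens r], and [r * dens r = phi (2 r) - phi r]. The total is at most [phi (2 r)], hence at most
    [2 * phi r]. *)
Lemma int_dens_le (E : set R) r : measurable (E : set LR) -> E `<=` I ->
  0 < r -> (mu E <= r%:E)%E -> (\int[mu]_(x in E) (dens x)%:E <= (2 * phi r)%:E)%E.
Proof.
move=> mE EI r0 Er.
have d0 x : (0 <= (dens x)%:E)%E by rewrite lee_fin dens_ge0.
have mr : measurable (`[0, r]%classic : set LR) by exact: lebesgue_itv.
have -> : E = (E `&` `[0, r]) `|` (E `\` `[0, r]) by rewrite setUIDK.
rewrite ge0_integral_setU.
- apply: (@le_trans _ _ ((phi r)%:E + (dens r)%:E * r%:E)%E).
    apply: leeD.
      apply: le_trans (_ : \int[mu]_(x in `[0%R, r]) (dens x)%:E <= _)%E.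
        apply: ge0_subset_integral.
        + exact: measurableI.
        + exact: mr.
        + by apply: measurable_dens; exact: sub0I.
        + by move=> x _; exact: d0.
        + by move=> x [].
      rewrite int_dens_0c; apply: le_trans (int_dens_ub r0) _.
      by rewrite lee_fin gerBl phi0p_ge0.
    apply: le_trans (_ : \int[mu]_(x in E `\` `[0%R, r]) (cst (dens r)%:E) x <= _)%E.
      apply: ge0_le_integral.
      + exact: measurableD.
      + by move=> x _; exact: d0.
      + by apply: measurable_dens => x [/EI].
      + exact: measurable_cst.
      + move=> x [/EI]; rewrite halflineE/= in_itv/= => x0 /negP; rewrite x0/= -ltNge => rx.
        by rewrite lee_fin dens_le// ltW.
    rewrite integral_cst; last exact: measurableD.
    apply: lee_wpmul2l; first exact: d0.
    apply: le_trans Er; apply: le_measure; rewrite ?inE//; first exact: measurableD.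
  rewrite -EFinM -EFinD lee_fin /dens r0 divfK ?gt_eqF//.
  by have := @phi_scale _ _ nphi 2 r; rewrite ler1n => /(_ isT r0); lra.
- exact: measurableI.
- exact: measurableD.
- by apply: measurable_dens => x [[/EI]|[/EI]].
- by move=> x _; exact: d0.
- by rewrite disj_set2E; apply/eqP/seteqP; split => x //= [[_ h] [_ /(_ h)]].
Qed.

End density.

(** * The averaging operator and its endpoint bounds *)

Section averaging_operator.
Context {R : realType}.
Variable phi : R -> R.
Hypothesis nphi : normalized_fundamental phi.
Local Notation I := (@halfline R).
Local Notation mu := (@leb R).
Local Notation LR := (lebesgueType R).
Local Notation GR := (measurableTypeR R).
Local Notation m := (stieltjes phi).
Local Notation d := (dens phi).
Implicit Types (f g h : R -> R) (a t r s x y c : R).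

Lemma sum_Linfty_lt M f (y : \bar R) : (sum_Linfty M f < y)%E -> exists g h,
  [/\ in_space M g, in_space Linfty h, aeI_eq f (fun x => g x + h x) &
    (M g + Linfty h < y)%E].
Proof. by move=> /ereal_inf_lt[_ [g [h [Mg Lh fE ->]]] sy]; exists g, h; split. Qed.

Lemma ae_norm_le f c : lmeasurable f -> 0 <= c -> (rearr f 0 <= c%:E)%E ->
  aeI (fun x => `|f x| <= c).
Proof.
move=> mf c0; rewrite rearr_le_fin// => fc; exists (level f c); split.
- exact: measurable_level.
- apply/eqP; rewrite eq_le measure_ge0 andbT; exact: fc.
- move=> x /= /not_implyP[Ix /negP]; rewrite -ltNge => cx; split => //.
Qed.

Let d0 x : (0 <= (d x)%:E)%E. Proof. by rewrite lee_fin dens_ge0. Qed.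

Let fd0 f x : (0 <= (`|f x| * d x)%:E)%E.
Proof. by rewrite lee_fin mulr_ge0// dens_ge0. Qed.

Lemma measurable_mul_dens f (A : set R) : lmeasurable f -> A `<=` I ->
  measurable_fun (A : set LR) (fun x => f x * d x).
Proof.
move=> mf AI; apply: (measurable_funS mI AI); apply: measurable_funM => //.
exact: lmeasurable_dens.
Qed.

Let measurable_norm_dens f (A : set R) : lmeasurable f -> A `<=` I ->
  measurable_fun (A : set LR) (fun x => (`|f x| * d x)%:E).
Proof.
move=> mf AI; apply/measurable_EFinP; apply: (measurable_funS mI AI).
apply: measurable_funM; first exact: lmeasurable_norm.
exact: lmeasurable_dens.
Qed.

(** Covers level sets of infinite measure in [int_level_dens]. *)
Lemma int_dens_I : (\int[mu]_(x in I) (d x)%:E <= m I)%E.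
Proof.
pose F (n : nat) := `[0, n.+1%:R]%classic : set R.
have ndF : nondecreasing_seq F.
  move=> i j ij; apply/subsetPset => x; rewrite /F/= !in_itv/= => /andP[-> /= xm].
  by apply: le_trans xm _; rewrite ler_nat.
have UF : \bigcup_n F n = I.
  apply/seteqP; split => x; first by move=> [n _]; exact: sub0I.
  rewrite halflineE => x0; exists (Num.truncn x) => //=.
  by rewrite /F/= in_itv/= x0/= ltW// truncnS_gt.
have H : (\int[mu]_(x in F n) (d x)%:E @[n --> \oo] --> \int[mu]_(x in I) (d x)%:E)%E.
  rewrite -UF; apply: ge0_nondecreasing_set_cvg_integral.
  - exact: ndF.
  - by move=> n; exact: lebesgue_itv.
  - by move=> n; apply: measurable_dens => //; exact: sub0I.
  - by move=> n x _; exact: d0.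
rewrite -(cvg_lim _ H)//; apply: lime_le; first by apply/cvg_ex; eexists; exact: H.
apply: nearW => n; rewrite /F int_dens_0c//.
have n0 : 0 < n.+1%:R :> R by rewrite ltr0n.
apply: le_trans (int_dens_ub nphi n0) _.
apply: (@le_trans _ _ (phi n.+1%:R)%:E); first by rewrite lee_fin gerBl phi0p_ge0.
rewrite -(stieltjes_0cE nphi n0); apply: le_measure; rewrite ?inE.
- exact: measurable_itv.
- exact: mIG.
- exact: sub0I.
Qed.

Lemma int_level_dens f s : lmeasurable f -> 0 <= s ->
  (\int[mu]_(x in level f s) (d x)%:E <=
   2%:E * m [set t | I t /\ (t%:E < distr f s)%E])%E.
Proof.
move=> mf s0; have mL := measurable_level s mf.
have LI : level f s `<=` I by move=> x [].
have mdl : measurable_fun (level f s : set LR) (fun x => (d x)%:E).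
  exact: measurable_dens.
have := distr_ge0 f s; case E : (distr f s) => [r| |] //.
- rewrite lee_fin le_eqVlt => /predU1P[r0|r0].
    have -> : (\int[mu]_(x in level f s) (d x)%:E = 0)%E.
      by apply: null_set_integral; [exact: mL|exact: mdl|rewrite -r0 in E; exact: E].
    by apply: mule_ge0 => //; rewrite lee_fin.
  apply: le_trans (int_dens_le nphi mL LI r0 _) _; first by rewrite -E.
  rewrite EFinM; apply: lee_wpmul2l => //; apply: le_trans (stieltjes_0o nphi r0) _.
  rewrite (_ : [set t | _] = `[0, r[%classic)//.
  apply/seteqP; split => t /=; rewrite halflineE in_itv/= lte_fin.
    by move=> [-> ->].
  by move=> /andP[].
- move=> _; have -> : [set t | I t /\ (t%:E < +oo)%E] = I.
    by apply/seteqP; split => t /=; [case|rewrite ltry].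
  apply: (@le_trans _ _ (\int[mu]_(x in I) (d x)%:E)%E).
    apply: ge0_subset_integral.
    + exact: mL.
    + exact: mI.
    + by apply: measurable_dens.
    + by move=> x _; exact: d0.
    + exact: LI.
  apply: le_trans int_dens_I _; rewrite -[leLHS]mul1e; apply: lee_wpmul2r => //.
  by rewrite lee_fin ler1n.
Qed.

(** A Hardy-Littlewood inequality: a level set of measure [r] has [dens]-integral at most
    [2 * phi r], while the corresponding level set of [rearr f] is [[0, r[], of [dphi]-mass at least
    [phi r]. *)
Lemma int_norm_dens_Lam f : lmeasurable f ->
  (\int[mu]_(x in I) (`|f x| * d x)%:E <= 2%:E * Lam phi f)%E.
Proof.
move=> mf; have -> : (\int[mu]_(x in I) (`|f x| * d x)%:E =
    \int[mu]_(x in I) ((`|f x|)%:E * (d x)%:E))%E.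
  by apply: eq_integral => x _; rewrite EFinM.
have -> : (Lam phi f = \int[m]_(x in I) (rearr f x * cst 1%E x))%E.
  by apply: eq_integral => x _; rewrite mule1.
apply: (@le_integral_layer _ _ _ _ R mu
  (lebesgue_stieltjes_measure (right_limit_fun phi)) I I
  (fun x => (`|f x|)%:E) (fun x => (d x)%:E) (rearr f) (cst 1%E) 2).
- exact: mI.
- by apply/measurable_EFinP; exact: lmeasurable_norm.
- exact: measurable_dens.
- by move=> x _; rewrite lee_fin.
- by move=> x _; exact: d0.
- exact: mIG.
- exact: measurable_rearr.
- exact: measurable_cst.
- by move=> x _; exact: rearr_ge0.
- by move=> x _.
- by [].
move=> s s0; rewrite rearr_level// integral_cst; last exact: measurable_rearr_level.
rewrite mul1e (_ : I `&` _ = level f s); first exact: int_level_dens.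
by apply/seteqP; split => x /= [Ix]; rewrite lte_fin.
Qed.

Lemma int_norm_dens_sup f c t : lmeasurable f -> 0 <= c -> 0 < t ->
  aeI (fun x => `|f x| <= c) ->
  (\int[mu]_(x in `[0%R, t]) (`|f x| * d x)%:E <= (c * phi t)%:E)%E.
Proof.
move=> mf c0 t0 fc; have sub := @sub0I R t.
apply: (@le_trans _ _ (\int[mu]_(x in `[0%R, t]) (c%:E * (d x)%:E))%E).
  apply: ae_ge0_le_integral.
  - exact: lebesgue_itv.
  - by move=> x _; exact: fd0.
  - exact: measurable_norm_dens.
  - by move=> x _; rewrite mule_ge0.
  - by apply: measurable_funeM; exact: measurable_dens.
  - move: fc; rewrite /aeI; apply: filterS => x h /sub /h xc.
    by rewrite -EFinM lee_fin ler_wpM2r// dens_ge0.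
rewrite ge0_integralZl.
- rewrite EFinM; apply: lee_wpmul2l => //; rewrite int_dens_0c//.
  apply: le_trans (int_dens_ub nphi t0) _.
  by rewrite lee_fin gerBl phi0p_ge0.
- exact: lebesgue_itv.
- exact: measurable_dens.
- by move=> x _; exact: d0.
- by rewrite lee_fin.
Qed.

Lemma Linfty_ae f : in_space Linfty f -> exists2 c, 0 <= c &
  (Linfty f = c%:E) /\ aeI (fun x => `|f x| <= c).
Proof.
move=> [mf]; rewrite Linfty_rearr//; have := rearr_ge0 f 0.
case E : (rearr f 0) => [c| |] //; rewrite lee_fin => c0 _.
by exists c => //; split => //; apply: ae_norm_le => //; rewrite E.
Qed.

Lemma Lam_fin f : in_space (Lam phi) f -> exists2 c, 0 <= c & Lam phi f = c%:E.
Proof.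
move=> [mf]; have := @Lam_ge0 _ phi f.
by case E : (Lam phi f) => [c| |] //; rewrite lee_fin => c0 _; exists c.
Qed.

Lemma int_norm_dens_le_Lam f t : lmeasurable f ->
  (\int[mu]_(x in `[0%R, t]) (`|f x| * d x)%:E <= 2%:E * Lam phi f)%E.
Proof.
move=> mf; apply: le_trans (int_norm_dens_Lam mf); apply: ge0_subset_integral.
- exact: lebesgue_itv.
- exact: mI.
- exact: measurable_norm_dens.
- by move=> x _; exact: fd0.
- exact: sub0I.
Qed.

(** Makes the real-valued integral in [avg] linear on the whole sum space. The [Lam] part is
    integrable on the half-line, the bounded part on every [[0, t]]. *)
Lemma integrable_mul_dens f t : in_space (sum_Linfty (Lam phi)) f ->
  mu.-integrable (`[0, t]%classic : set LR) (EFin \o (fun x => f x * d x)).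
Proof.
move=> [mf /sum_Linfty_lt[g [h [sg sh fE _]]]]; have sub := @sub0I R t.
have [t0|t0] := leP t 0.
  apply/integrableP; split.
    by apply/measurable_EFinP; exact: measurable_mul_dens.
  rewrite null_set_integral; [exact: ltry|exact: lebesgue_itv| |].
    apply: measurableT_comp => //.
    by apply/measurable_EFinP; exact: measurable_mul_dens.
  rewrite [LHS](leb_itv `[0, t])/= lte_fin ltNge t0//.
have [[mg _] [mh _]] := (sg, sh).
have [c c0 [_ hc]] := Linfty_ae sh; have [b b0 gb] := Lam_fin sg.
apply/integrableP; split; first by apply/measurable_EFinP; exact: measurable_mul_dens.
apply: (@le_lt_trans _ _ (\int[mu]_(x in `[0%R, t]) ((`|g x| * d x)%:E + (`|h x| * d x)%:E))%E).
  apply: ae_ge0_le_integral.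
  - exact: lebesgue_itv.
  - by move=> x _; exact: abse_ge0.
  - by apply: measurableT_comp => //; apply/measurable_EFinP; exact: measurable_mul_dens.
  - by move=> x _; apply: adde_ge0; exact: fd0.
  - by apply: emeasurable_funD; exact: measurable_norm_dens.
  - move: fE; rewrite /aeI_eq /aeI; apply: filterS => x hx /sub /hx /= ->.
    rewrite -EFinD lee_fin normrM (ger0_norm (dens_ge0 nphi x)) -mulrDl.
    by rewrite ler_wpM2r ?dens_ge0// ler_normD.
rewrite ge0_integralD.
- apply: (@le_lt_trans _ _ (2%:E * b%:E + (c * phi t)%:E)%E); last by rewrite -EFinM -EFinD ltry.
  by apply: leeD; [rewrite -gb; exact: int_norm_dens_le_Lam|exact: int_norm_dens_sup].
- exact: lebesgue_itv.
- by move=> x _; exact: fd0.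
- exact: measurable_norm_dens.
- by move=> x _; exact: fd0.
- exact: measurable_norm_dens.
Qed.

Definition avg f t : R := (phi t)^-1 * (\int[mu]_(x in `[0%R, t]) (f x * d x))%R.

Lemma measurable_int_0c (F : R -> \bar R) : measurable_fun (I : set LR) F ->
  (forall x, 0 <= F x)%E ->
  measurable_fun (I : set LR) (fun t => \int[mu]_(x in `[0%R, t]) F x)%E.
Proof.
move=> mF F0; pose G t := (\int[mu]_(x in `[0%R, t]) F x)%E.
have -> : (fun t => \int[mu]_(x in `[0%R, t]) F x)%E = (fun t => - - G t)%E.
  by apply/funext => t; rewrite oppeK.
apply: (measurableT_comp (@oppe_measurable R setT)); apply: measurable_antitone_leb.
  exact: interval_is_interval.
move=> x y _ _ xy; rewrite leeN2; apply: ge0_subset_integral.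
- exact: lebesgue_itv.
- exact: lebesgue_itv.
- by apply: measurable_funS mI _ mF; exact: sub0I.
- by move=> z _; exact: F0.
- by move=> z /=; rewrite !in_itv/= => /andP[-> /le_trans -> ].
Qed.

Lemma lmeasurable_inv_phi : lmeasurable (fun t => (phi t)^-1).
Proof.
apply: measurable_halfline; apply/measurable_EFinP; apply: measurable_antitone_leb.
  exact: interval_is_interval.
move=> x y; rewrite /= !in_itv/= !andbT => x0 y0 xy.
by rewrite lee_fin lef_pV2 ?posrE ?phi_gt0// phi_le// ltW.
Qed.

Lemma lmeasurable_avg f : lmeasurable f -> lmeasurable (avg f).
Proof.
move=> mf; apply: measurable_funM; first exact: lmeasurable_inv_phi.
have mF : measurable_fun (I : set LR) (fun x => (f x * d x)%:E).
  by apply/measurable_EFinP; exact: measurable_mul_dens.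
apply: (@measurable_comp _ _ _ _ _ _ setT fine); [exact: measurableT|by []|exact: fine_measurable|].
(* Measurability in [t] comes from monotonicity: the integrals of the positive and of the negative
   part over [[0, t]] are both nondecreasing in [t]. *)
rewrite (_ : (fun t => _) = (fun t => \int[mu]_(x in `[0%R, t]) ((fun x => (f x * d x)%:E)^\+)%E x -
  \int[mu]_(x in `[0%R, t]) ((fun x => (f x * d x)%:E)^\-)%E x)%E); last first.
  by apply/funext => t; rewrite integralE.
apply: emeasurable_funB; apply: measurable_int_0c.
- exact: measurable_funepos.
- by move=> x; exact: funepos_ge0.
- exact: measurable_funeneg.
- by move=> x; exact: funeneg_ge0.
Qed.

Lemma avg_eq f g t : lmeasurable f -> lmeasurable g -> aeI_eq f g -> avg f t = avg g t.
Proof.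
move=> mf mg fg; rewrite /avg /Rintegral; congr (_ * fine _).
apply: ae_eq_integral.
- exact: lebesgue_itv.
- by apply/measurable_EFinP; apply: measurable_mul_dens => //; exact: sub0I.
- by apply/measurable_EFinP; apply: measurable_mul_dens => //; exact: sub0I.
- by apply: ae_eq_aeI; [exact: sub0I|apply: aeI_mono fg _ => x _ ->].
Qed.

Lemma avg_linear f g c t : in_space (sum_Linfty (Lam phi)) f ->
  in_space (sum_Linfty (Lam phi)) g ->
  avg (fun x => c * f x + g x) t = c * avg f t + avg g t.
Proof.
move=> sf sg; rewrite /avg mulrCA -mulrDr; congr (_ * _).
have fi := integrable_mul_dens t sf; have gi := integrable_mul_dens t sg.
rewrite -RintegralZl; [|exact: lebesgue_itv|exact: fi].
rewrite -RintegralD; [|exact: lebesgue_itv| |exact: gi].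
  by apply: eq_Rintegral => x _; ring.
have -> : EFin \o (fun x => c * (f x * d x)) = (fun x => c%:E * (EFin \o (fun x => (f x * d x)%R)) x)%E.
  by apply/funext => x /=; rewrite EFinM.
exact: (integrableZl (lebesgue_itv _) c fi).
Qed.

Lemma norm_avg_le f t (b : R) : 0 < t -> in_space (sum_Linfty (Lam phi)) f ->
  (\int[mu]_(x in `[0%R, t]) (`|f x| * d x)%:E <= b%:E)%E ->
  `|avg f t| <= b / phi t.
Proof.
move=> t0 sf hb; have pt := phi_gt0 nphi t0.
rewrite /avg normrM (ger0_norm (_ : 0 <= (phi t)^-1)) ?invr_ge0 ?(ltW pt)// mulrC.
rewrite ler_pM2r ?invr_gt0//.
apply: le_trans (le_normr_Rintegral (lebesgue_itv _) (integrable_mul_dens t sf)) _.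
rewrite /Rintegral (_ : (\int[_]_(x in _) _)%E = (\int[mu]_(x in `[0%R, t]) (`|f x| * d x)%:E)%E); last first.
  by apply: eq_integral => x _; rewrite normrM (ger0_norm (dens_ge0 nphi x)).
rewrite -lee_fin fineK// ge0_fin_numE; first exact: le_lt_trans hb (ltry _).
by apply: integral_ge0 => x _; exact: fd0.
Qed.

Lemma in_space_Lam_sum f : in_space (Lam phi) f -> in_space (sum_Linfty (Lam phi)) f.
Proof. by move/sum_Linfty_l => []. Qed.

Lemma in_space_Linfty_sum f : in_space Linfty f -> in_space (sum_Linfty (Lam phi)) f.
Proof.
move=> sf; split; first by case: sf.
apply: le_lt_trans (sum_Linfty_r _ _ sf) _.
- rewrite /Lam (eq_integral (cst 0%E)) ?integral0// => x; rewrite inE halflineE => x0.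
  by rewrite rearr_cst0.
- exact: measurable_cst.
- by case: sf.
Qed.

Lemma avg_Lam : bounded_op (Lam phi) (Mst phi) avg.
Proof.
exists 2 => // f sf; have [b b0 fb] := Lam_fin sf; have [mf _] := sf.
have h : (Mst phi (avg f) <= 2%:E * Lam phi f)%E.
  rewrite fb -EFinM; apply: (Mst_le nphi) => [|t t0]; first by rewrite lee_fin mulr_ge0.
  have pt := phi_gt0 nphi t0.
  have /(lee_wpmul2l (_ : 0 <= (phi t)%:E)%E) : (rearr (avg f) t <= (2 * b / phi t)%:E)%E.
    apply: (@rearr_ub _ _ (fun t => 2 * b / phi t)) => //.
    + exact: lmeasurable_avg.
    + move=> x y x0 xy; apply: ler_wpM2l; first by rewrite mulr_ge0.
      by rewrite lef_pV2 ?posrE ?phi_gt0 ?(lt_le_trans x0)// phi_le// ltW.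
    + by rewrite divr_ge0 ?mulr_ge0// ltW.
    + apply: aeIW => x _ x0; apply: norm_avg_le => //; first exact: in_space_Lam_sum.
      by apply: le_trans (int_norm_dens_le_Lam _ mf) _; rewrite fb EFinM.
  rewrite lee_fin (ltW pt) => /(_ isT) h; apply: le_trans h _.
  by rewrite -EFinM mulrC divfK// gt_eqF.
split => //; split; first exact: lmeasurable_avg.
by apply: le_lt_trans h _; rewrite fb -EFinM ltry.
Qed.

Lemma avg_Linfty : bounded_op Linfty Linfty avg.
Proof.
exists 1 => // f sf; have [c c0 [fc hc]] := Linfty_ae sf; have [mf _] := sf.
rewrite mul1e fc; apply: Linfty_le; first exact: lmeasurable_avg.
rewrite rearr_le_fin//; last exact: lmeasurable_avg.
rewrite /distr (_ : level (avg f) c = set0) ?measure0//.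
apply/seteqP; split => x //= [+]; rewrite halflineE le_eqVlt => /predU1P[<-|x0].
  (* At 0 the convention that the inverse of 0 is 0 makes [avg f 0] vanish. *)
  by rewrite /avg (phi0 nphi) invr0 mul0r normr0 ltNge c0.
have px := phi_gt0 nphi x0.
have := norm_avg_le x0 (in_space_Linfty_sum sf) (int_norm_dens_sup mf c0 x0 hc).
by rewrite mulfK ?gt_eqF// leNgt => /negP.
Qed.

Lemma avg_linear_op : linear_op (sum_Linfty (Lam phi)) (sum_Linfty (Mst phi)) avg.
Proof.
split => [f [mf /sum_Linfty_lt[g [h [sg sh fE _]]]]|f g [mf _] [mg _] fg|c f g sf sg].
- split; first exact: lmeasurable_avg.
  have [C1 _ /(_ g sg)[sTg _]] := avg_Lam; have [C2 _ /(_ h sh)[sTh _]] := avg_Linfty.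
  apply: le_lt_trans (sum_Linfty_le sTg sTh _) _; last first.
    by apply: lte_add_pinfty; [exact: sTg.2|exact: sTh.2].
  apply: aeIW => t _; have [[mg _] [mh _]] := (sg, sh).
  rewrite (@avg_eq _ (fun x => 1 * g x + h x))//.
  + by rewrite avg_linear ?mul1r//; [exact: in_space_Lam_sum|exact: in_space_Linfty_sum].
  + by apply: lmeasurableD => //; exact: lmeasurableZ.
  + by apply: aeI_mono fE _ => x _ ->; rewrite mul1r.
- by apply: aeIW => t _; exact: avg_eq.
- by apply: aeIW => t _; exact: avg_linear.
Qed.

Lemma LI_avg N : LI (Lam phi) (Mst phi) N N -> bounded_op N N avg.
Proof.
by case=> _ _ _; apply; [exact: avg_linear_op|exact: avg_Lam|exact: avg_Linfty].
Qed.

Lemma avg_ge f t : in_space (sum_Linfty (Lam phi)) f -> 0 < t ->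
  (forall x, 0 <= f x) ->
  (\int[mu]_(x in `]0%R, t]) (f x * d x)%:E = (phi t * avg f t)%:E)%E.
Proof.
move=> sf t0 f0; have pt := phi_gt0 nphi t0; have [mf _] := sf.
have fi := integrable_mul_dens t sf.
rewrite /avg mulrA divff ?gt_eqF// mul1r /Rintegral fineK; last exact: (integrable_fin_num (lebesgue_itv _) fi).
rewrite [RHS](@ge0_negligible_integral _ LR R mu `[0, t]%classic [set 0]).
- congr (integral _ _ _); apply/seteqP; split => x /=; rewrite !in_itv/=.
    by move=> /andP[x0 ->]; rewrite ltW//; split => //; apply/eqP; rewrite gt_eqF.
  by move=> [/andP[x0 ->] /eqP x0']; rewrite andbT lt_neqAle eq_sym x0' x0.
- by apply: borel_lebesgue; exact: measurable_set1.
- exact: lebesgue_itv.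
- by apply/measurable_EFinP; apply: measurable_mul_dens => //; exact: sub0I.
- by move=> x _; rewrite lee_fin mulr_ge0 ?dens_ge0.
- exact: leb_set1.
Qed.

(* [avg f] decays at most like [1 / phi], so it loses at most the factor
   [phi (3 t) <= 3 phi t] on an interval of length [2 t] starting at [t]. *)
Lemma rearr_avg_ge f t (b : R) : lmeasurable f -> 0 < t -> 0 <= b ->
  (forall x, t <= x -> b / phi x <= `|avg f x|) ->
  ((b / (3 * phi t))%:E <= rearr (avg f) t)%E.
Proof.
move=> mf t0 b0 hb; have pt := phi_gt0 nphi t0.
apply: (@rearr_lb _ _ `[t, 3 * t[%classic).
- exact: lmeasurable_avg.
- exact: lebesgue_itv.
- by move=> x /=; rewrite in_itv/= halflineE => /andP[/(le_trans (ltW t0))].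
- rewrite [X in (_ < X)%E](leb_itv `[t, 3 * t[)/= lte_fin ifT; last by lra.
  by rewrite -EFinD lte_fin; lra.
- move=> x /=; rewrite in_itv/= => /andP[tx x3]; apply: le_trans (hb x tx).
  have x0 : 0 < x by exact: lt_le_trans tx.
  rewrite ler_wpM2l// lef_pV2 ?posrE ?mulr_gt0 ?ltr0n ?(phi_gt0 nphi)//.
  apply: (@le_trans _ _ (phi (3 * t))); first by apply: (phi_le nphi) => //; exact: ltW.
  by apply: (phi_scale nphi) => //; rewrite ler1n.
Qed.

(** With an atom at 0, [Lam] is contained in [L^oo], hence so is the sum space. The sum embedding
    then forces the functions of the Lorentz space to be bounded. *)
Lemma rearr0_le_sum f : 0 < phi0p phi -> lmeasurable f ->
  (rearr f 0 <= ((phi0p phi)^-1 + 1)%:E * sum_Linfty (Lam phi) f)%E.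
Proof.
move=> p0 mf; have c0 : 0 < (phi0p phi)^-1 + 1 by rewrite addr_gt0// invr_gt0.
rewrite -lee_pdivrMl//; apply: le_ereal_inf_tmp => _ [g [h [[mg _] [mh _] fE ->]]].
rewrite lee_pdivrMl// (eq_rearr mf _ fE); last exact: lmeasurableD.
have := rearrD 0 0 mg mh; rewrite addr0 => /le_trans; apply.
rewrite EFinD ge0_muleDl ?lee_fin ?invr_ge0 ?(ltW p0)// mul1e.
have L0 := @Lam_ge0 _ phi g; have r0 := rearr_ge0 h 0; rewrite Linfty_rearr//.
apply: leeD; last by rewrite leeDr.
apply: (@le_trans _ _ ((phi0p phi)^-1%:E * Lam phi g)%E).
  by rewrite lee_pdivlMl//; exact: rearr0_le_Lam.
by apply: lee_wpmul2l; [rewrite lee_fin invr_ge0 ltW|rewrite leeDl].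
Qed.

End averaging_operator.

(** * Indicators of initial intervals *)

Section indicator.
Context {R : realType}.
Local Notation I := (@halfline R).
Local Notation mu := (@leb R).
Local Notation LR := (lebesgueType R).
Implicit Types (r t : R).

Definition chi r : R -> R := \1_(`[0, r]%classic : set R).

Definition step r t : R := (t <= r)%R%:R.

Lemma chi_ge0 r x : 0 <= chi r x.
Proof. by rewrite /chi indicE ler0n. Qed.

Lemma chi1 r x : 0 <= x -> x <= r -> chi r x = 1.
Proof. by move=> x0 xr; rewrite /chi indicE mem_set//= in_itv/= x0. Qed.

Lemma lmeasurable_chi r : lmeasurable (chi r).
Proof. by apply: measurable_indic; exact: lebesgue_itv. Qed.

Lemma rearr_chi_le r t : 0 < t -> (rearr (chi r) t <= (step r t)%:E)%E.
Proof.
move=> t0; rewrite /step; apply: (@rearr_ub _ _ (step r)) => //.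
- exact: lmeasurable_chi.
- move=> x y _ xy; rewrite /step ler_nat; case: (leP y r) => // yr.
  by rewrite (le_trans xy yr).
- apply: aeIW => x Ix _; rewrite /chi indicE /step normr_nat ler_nat.
  case: (boolP (x \in _)) => //; rewrite inE/= in_itv/= => /andP[_ ->] //.
Qed.

Lemma rearr_chi0 r : 0 < r -> (1 <= rearr (chi r) 0)%E.
Proof.
move=> r0; apply: (@rearr_lb _ _ `[0, r]%classic).
- exact: lmeasurable_chi.
- exact: lebesgue_itv.
- exact: sub0I.
- by rewrite [X in (_ < X)%E](leb_itv `[0, r])/= lte_fin r0 -EFinD subr0 lte_fin.
- by move=> x /=; rewrite in_itv/= => /andP[x0 xr]; rewrite chi1// normr1.
Qed.

End indicator.

(** * Necessity of the weight condition for finite [q] *)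

Section necessity.
Context {R : realType}.
Variables (q : R) (v : R -> R) (phi : R -> R).
Local Notation I := (@halfline R).
Local Notation mu := (@leb R).
Local Notation LR := (lebesgueType R).
Local Notation W := (primw v).
Implicit Types (t r s : R).
Hypotheses (q1 : 1 <= q) (v0 : forall x, 0 <= v x) (mv : lmeasurable v).
Hypotheses (Wfin : forall t, (W t < +oo)%E).
Hypothesis nphi : normalized_fundamental phi.
Local Notation N := (fun f => Lq q v (rearr f)).
Hypothesis LIq : LI (Lam phi) (Mst phi) N N.

Let q0 : 0 < q. Proof. exact: lt_le_trans q1. Qed.

Lemma Phiq_chi r : (Phiq q v (rearr (chi r)) <= W r)%E.
Proof.
pose g t := (step r t)%:E.
have ag : antitone g.
  split => [t|s t st]; first by rewrite /g /step lee_fin ler0n.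
  rewrite /g /step lee_fin ler_nat; case: (leP t r) => // tr.
  by rewrite (le_trans st tr).
apply: (@le_trans _ _ (Phiq q v g)).
  by apply: Phiq_le => //; [exact: antitone_rearr|exact: rearr_chi_le].
rewrite /Phiq /primw [leLHS]integral_mkcond [leRHS]integral_mkcond.
apply: (@ge0_le_integral _ LR R mu setT measurableT).
- by move=> t _; apply: erestrict_ge0 => x _; exact: integrand_ge0.
- apply/(measurable_restrictT _ _).1; [exact: mI|exact: measurable_integrand].
- apply/(measurable_restrictT _ _).1; [exact: lebesgue_itv|].
  by apply: mve_sub => //; exact: sub0I.
- move=> t _; rewrite !patchE; case: ifPn => [|_]; last first.
    by case: ifPn => // _; rewrite lee_fin.
  rewrite inE halflineE => t0; rewrite /g /step; case: (leP t r) => tr.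
    rewrite mem_set; last by rewrite /= in_itv/= t0.
    by rewrite [true%:R]/(1 : R) poweR_EFin powR1 mul1e.
  rewrite [false%:R]/(0 : R) poweR0r ?gt_eqF// mul0e.
  by case: ifPn => // _; rewrite lee_fin.
Qed.

Lemma in_space_chi r : in_space N (chi r).
Proof.
split; first exact: lmeasurable_chi.
by apply: poweR_lty; apply: le_lt_trans (Phiq_chi r) (Wfin r).
Qed.

(** With an atom at 0 the Lorentz norm would dominate the sup norm. The indicator of [[0, t]] has
    sup norm 1 and Lorentz norm at most [W t] to the power [q^-1], which tends to 0 with [t]. *)
Lemma LI_phi0p : phi0p phi = 0.
Proof.
have := phi0p_ge0 nphi; rewrite le_eqVlt => /predU1P[//|p0].
have [_ [_ [C C0 hC]] _ _] := LIq.
pose K := ((phi0p phi)^-1 + 1) * C.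
have c0 : 0 < (phi0p phi)^-1 + 1 by rewrite addr_gt0// invr_gt0.
have K0 : 0 < K by rewrite mulr_gt0.
(* [t] is taken so small that the indicator has Lorentz norm at most [(2 * K)^-1]; the embedding
   then gives [1 <= K * (2 * K)^-1], that is [1 <= 1 / 2]. *)
have K2 : 0 < (2 * K)^-1 by rewrite invr_gt0 mulr_gt0.
have [t t0 Wt] := primw_small v0 mv Wfin (powR_gt0 q K2).
have [_ h] := hC _ (in_space_chi t).
have : (1 <= K%:E * ((2 * K)^-1)%:E :> \bar R)%E.
  apply: le_trans (rearr_chi0 t0) _.
  apply: le_trans (rearr0_le_sum p0 (lmeasurable_chi t)) _.
  rewrite /K EFinM -muleA; apply: lee_wpmul2l; first by rewrite lee_fin ltW.
  apply: le_trans h _; apply: lee_wpmul2l; first by rewrite lee_fin ltW.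
  have -> : ((2 * K)^-1)%:E = poweR (((2 * K)^-1 `^ q)%:E) q^-1.
    by rewrite poweR_EFin -powRrM mulfV ?gt_eqF// powRr1// ltW.
  apply: lee_poweR; [by rewrite invr_ge0 ltW|exact: Phiq_ge0|].
  by apply: le_trans (Phiq_chi t) (ltW Wt).
rewrite -EFinM lee_fin invfM mulrCA divff ?gt_eqF// mulr1.
by lra.
Qed.

(** The integral over [[0, x]] contains that of [dens] over []0, r]]. By [int_dens_lb] with
    [phi (0+) = 0], the latter is at least [phi (2 r) / 2], hence at least [phi r / 2]. *)
Lemma avg_chi r x : 0 < r -> r <= x -> phi r / 2 / phi x <= avg phi (chi r) x.
Proof.
move=> r0 rx; have x0 := lt_le_trans r0 rx; have px := phi_gt0 nphi x0.
have [_ [_ [C C0 hC]] _ _] := LIq.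
have [sc _] := hC _ (in_space_chi r).
rewrite ler_pdivrMr// mulrC -lee_fin [X in (_ <= X%:E)%E]mulrC.
rewrite -(avg_ge nphi sc x0); last by move=> y; exact: chi_ge0.
have h := int_dens_lb nphi r0; rewrite LI_phi0p subr0 in h.
apply: (@le_trans _ _ (2^-1 * phi (2 * r))%:E).
  by rewrite lee_fin ler_pM2l// (phi_le nphi)//; lra.
apply: le_trans h _.
have -> : (\int[mu]_(y in `]0%R, r]) (dens phi y)%:E =
    \int[mu]_(y in `]0%R, r]) (chi r y * dens phi y)%:E)%E.
  apply: eq_integral => y; rewrite inE/= in_itv/= => /andP[y0 yr].
  by rewrite chi1 ?mul1r// ltW.
apply: ge0_subset_integral.
- exact: lebesgue_itv.
- exact: lebesgue_itv.
- apply/measurable_EFinP; apply: measurable_mul_dens => //; first exact: lmeasurable_chi.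
  by move=> y /=; rewrite in_itv/= halflineE => /andP[/ltW].
- by move=> y _; rewrite lee_fin mulr_ge0 ?chi_ge0 ?dens_ge0.
- by move=> y /=; rewrite !in_itv/= => /andP[-> /le_trans ->].
Qed.

Lemma LI_necessary_q : exists2 B : R, 0 < B & forall t, 0 < t ->
  (\int[mu]_(x in `[t, +oo[) (v x / phi x `^ q)%:E <= (B / phi t `^ q)%:E * W t)%E.
Proof.
have [C C0 hC] := LI_avg nphi LIq.
(* The 6 is the loss 2 of [avg_chi] times the loss 3 of [rearr_avg_ge]; [C] is the norm bound for
   [avg]. *)
exists ((6 * C) `^ q); first by rewrite powR_gt0// mulr_gt0.
move=> r r0; have pr := phi_gt0 nphi r0; set f := chi r.
have [_ hf] := hC _ (in_space_chi r).
have mf := lmeasurable_chi r.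
have H1 : (Phiq q v (rearr (avg phi f)) <= (C `^ q)%:E * W r)%E.
  rewrite -(LqK q1 v0).
  apply: (@le_trans _ _ (poweR (C%:E * N f) q)).
    by apply: lee_poweR => //; [exact: ltW|exact: poweR_ge0].
  rewrite poweRM ?lee_fin ?(ltW C0) ?poweR_ge0// poweR_EFin LqK//.
  by apply: lee_wpmul2l; [rewrite lee_fin powR_ge0|exact: Phiq_chi].
pose k := (phi r / 6) `^ q; have k0 : 0 < k by rewrite powR_gt0// divr_gt0.
have sub : `[r, +oo[ `<=` `]0, +oo[%classic.
  by move=> x /=; rewrite !in_itv/= !andbT; exact: lt_le_trans.
have subI : `[r, +oo[%classic `<=` I.
  by move=> x /sub/=; rewrite in_itv/= andbT halflineE => /ltW.
have mvp := measurable_v_phi q1 mv nphi sub.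
have vp0 x : (0 <= (v x / phi x `^ q)%:E)%E by exact: v_phi_ge0.
have H2 : (k%:E * \int[mu]_(x in `[r, +oo[) (v x / phi x `^ q)%:E <= (C `^ q)%:E * W r)%E.
  apply: le_trans H1; rewrite -ge0_integralZl.
  - apply: (@le_trans _ _ (\int[mu]_(x in `[r, +oo[) (poweR (rearr (avg phi f) x) q * (v x)%:E))%E).
      apply: ge0_le_integral.
      + exact: lebesgue_itv.
      + by move=> x _; apply: mule_ge0 => //; rewrite lee_fin ltW.
      + by apply: measurable_funeM; exact: mvp.
      + by apply: measurable_funS mI subI _; exact: (measurable_integrand q mv (antitone_rearr _)).
      + move=> x /[dup] rx /sub/=; rewrite in_itv/= andbT => x0.
        have px := phi_gt0 nphi x0.
        have {}rx : r <= x by move: rx; rewrite /= in_itv/= andbT.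
        apply: (@le_trans _ _ (poweR ((phi r / 2 / (3 * phi x))%:E) q * (v x)%:E)%E).
          rewrite poweR_EFin -!EFinM lee_fin mulrCA mulrC; apply: ler_wpM2r => //.
          rewrite (_ : phi r / 2 / (3 * phi x) = phi r / 6 * (phi x)^-1); last first.
            by field; rewrite gt_eqF.
          rewrite powRM ?invr_ge0 ?(ltW px)//; last by rewrite divr_ge0// ltW.
          rewrite -/k ler_pM2l// -(ler_pM2l (powR_gt0 q px)) mulfV ?gt_eqF ?powR_gt0//.
          by rewrite -powRM ?invr_ge0 ?(ltW px)// mulfV ?gt_eqF// powR1.
        apply: lee_wpmul2r; first by rewrite lee_fin.
        apply: lee_poweR; [exact: ltW|by rewrite lee_fin !divr_ge0 ?mulr_ge0// ltW|].
        apply: (rearr_avg_ge nphi) => //; first by rewrite divr_ge0// ltW.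
        move=> y xy; apply: le_trans (ler_norm _); apply: avg_chi => //.
        exact: le_trans xy.
    apply: ge0_subset_integral.
    + exact: lebesgue_itv.
    + exact: mI.
    + exact: (measurable_integrand q mv (antitone_rearr _)).
    + by move=> x _; exact: integrand_ge0.
    + exact: subI.
  - exact: lebesgue_itv.
  - exact: mvp.
  - by move=> x _; exact: vp0.
  - by rewrite lee_fin ltW.
rewrite -(@lee_pmul2l _ k%:E) ?lte_fin//; apply: le_trans H2 _.
rewrite muleA -EFinM (_ : k * ((6 * C) `^ q / phi r `^ q) = C `^ q)//.
have P0 : phi r `^ q != 0 by rewrite gt_eqF// powR_gt0.
rewrite /k mulrA -powRM ?divr_ge0 ?mulr_ge0 ?(ltW pr) ?(ltW C0)//.
apply: (mulIf P0); rewrite divfK// -powRM ?(ltW C0) ?(ltW pr)//.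
by congr (_ `^ _); field.
Qed.

End necessity.

(** * Necessity of the weight condition for [q = oo] *)

Section necessity_sup.
Context {R : realType}.
Variables (w phi : R -> R).
Local Notation I := (@halfline R).
Local Notation mu := (@leb R).
Local Notation LR := (lebesgueType R).
Local Notation GR := (measurableTypeR R).
Local Notation m := (stieltjes phi).
Implicit Types (t r s : R).
Hypotheses (w0 : forall t, 0 < t -> 0 < w t)
  (w_le : forall s t, 0 < s -> s <= t -> w s <= w t).
Hypothesis nphi : normalized_fundamental phi.
Local Notation N := (fun f => Lsup w (rearr f)).
Local Notation f := (inv_weight w).

Let mf : lmeasurable f. Proof. exact: lmeasurable_inv_weight0. Qed.

Let f_pos x : 0 < x -> f x = (w x)^-1. Proof. by rewrite /inv_weight => ->. Qed.

(** The extremal test function: every function of norm at most 1 has its rearrangement below [1 / w]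
    at positive points. *)
Lemma Lsup_inv_weight : (N f <= 1)%E.
Proof.
apply: Lsup_le => t t0; have wt := w0 t0.
have h : (rearr f t <= ((w t)^-1)%:E)%E.
  apply: (@rearr_ub _ _ (fun x => (w x)^-1)) => //.
  - by move=> x y x0 xy; rewrite lef_pV2 ?posrE ?w0 ?w_le// (lt_le_trans x0).
  - by rewrite invr_ge0 ltW.
  - by apply: aeIW => x _ x0; rewrite f_pos// ger0_norm// invr_ge0 ltW// w0.
apply: (@le_trans _ _ ((w t)^-1%:E * (w t)%:E)%E).
  by apply: lee_wpmul2r; rewrite // lee_fin ltW.
by rewrite -EFinM mulVf// gt_eqF.
Qed.

Lemma in_space_inv_weight : in_space N f.
Proof. by split => //; apply: le_lt_trans Lsup_inv_weight (ltry _). Qed.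

Hypothesis LIw : LI (Lam phi) (Mst phi) N N.

(** [phi x * avg phi f x] is the nondecreasing integral of [f * dens], so [rearr_avg_ge] applies
    with its value at [t]. The boundedness of [avg] then bounds this integral, with the loss 3. *)
Lemma int_dens_weight : exists2 C : R, 0 < C & forall t, 0 < t ->
  (\int[mu]_(x in `]0%R, t]) (f x * dens phi x)%:E <= (C * (phi t / w t))%:E)%E.
Proof.
have [C C0 hC] := LI_avg nphi LIw; have [_ hf] := hC _ in_space_inv_weight.
have [_ [_ [C1 _ hC1]] _ _] := LIw; have [sf _] := hC1 _ in_space_inv_weight.
exists (3 * C) => [|t t0]; first by rewrite mulr_gt0.
have pt := phi_gt0 nphi t0; have wt := w0 t0.
have f0 x : 0 <= f x by exact: inv_weight_ge0.
have E x : 0 < x -> (\int[mu]_(y in `]0%R, x]) (f y * dens phi y)%:E = (phi x * avg phi f x)%:E)%E.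
  by move=> x0; exact: avg_ge.
have b0 : 0 <= phi t * avg phi f t.
  by rewrite -lee_fin -E//; apply: integral_ge0 => y _; rewrite lee_fin mulr_ge0 ?dens_ge0.
have h : ((phi t * avg phi f t / (3 * phi t))%:E <= rearr (avg phi f) t)%E.
  apply: (rearr_avg_ge nphi) => // x tx; have x0 := lt_le_trans t0 tx.
  have px := phi_gt0 nphi x0.
  apply: le_trans (ler_norm _); rewrite ler_pdivrMr// [leRHS]mulrC -lee_fin -!E//.
  apply: ge0_subset_integral.
  - exact: lebesgue_itv.
  - exact: lebesgue_itv.
  - apply/measurable_EFinP; apply: measurable_mul_dens => //.
    by move=> y /=; rewrite in_itv/= halflineE => /andP[/ltW].
  - by move=> y _; rewrite lee_fin mulr_ge0 ?dens_ge0.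
  - by move=> y /=; rewrite !in_itv/= => /andP[-> /le_trans ->].
have h2 : (rearr (avg phi f) t * (w t)%:E <= C%:E)%E.
  apply: le_trans (Lsup_ub w (rearr (avg phi f)) t0) _; apply: le_trans hf _.
  by rewrite -[leRHS]mule1; apply: lee_wpmul2l; [rewrite lee_fin ltW|exact: Lsup_inv_weight].
have := le_trans (lee_wpmul2r _ h) h2; rewrite lee_fin (ltW wt) => /(_ isT).
rewrite -EFinM lee_fin E// lee_fin => h3.
rewrite mulrA ler_pdivlMr//.
have -> : phi t * avg phi f t * w t = 3 * phi t * (phi t * avg phi f t / (3 * phi t) * w t).
  by field; rewrite gt_eqF.
have := ler_wpM2l (_ : 0 <= 3 * phi t) h3; rewrite mulr_ge0 ?(ltW pt)// => /(_ isT).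
by move=> h4; apply: le_trans h4 _; rewrite mulrAC.
Qed.

(** With an atom at 0, [1 / phi] is bounded and has [Mst] norm at most 1. The intersection embedding
    places it in the Lorentz space, which means that [w / phi] is bounded. *)
Lemma weight_le_phi : 0 < phi0p phi -> exists2 C : R, 0 < C & forall t, 0 < t -> w t <= C * phi t.
Proof.
move=> p0; have [_ _ [[C C0 hC] _] _] := LIw.
pose g x := (phi x)^-1; have mg : lmeasurable g by exact: lmeasurable_inv_phi.
have g_le x y : 0 < x -> x <= y -> g y <= g x.
  move=> x0 xy; rewrite lef_pV2 ?posrE ?(phi_gt0 nphi) ?(lt_le_trans x0 xy)//.
  by apply: (phi_le nphi) => //; exact: ltW.
have g0 x : 0 <= x -> 0 <= g x by move=> x0; rewrite invr_ge0 (phi_ge0 nphi).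
pose K := Num.max 1 (phi0p phi)^-1.
have K0 : 0 < K by rewrite lt_max ltr01.
have cg : (cap_Linfty (Mst phi) g <= K%:E)%E.
  rewrite /cap_Linfty ge_max; apply/andP; split.
    apply: (Mst_le nphi) => [|t t0]; first by rewrite lee_fin ltW.
    have pt := phi_gt0 nphi t0.
    have h : (rearr g t <= (g t)%:E)%E.
      apply: rearr_ub => //; first exact/g0/ltW.
      by apply: aeIW => x _ x0; rewrite ger0_norm// g0// ltW.
    apply: (@le_trans _ _ ((phi t)%:E * (g t)%:E)%E).
      by apply: lee_wpmul2l => //; rewrite lee_fin ltW.
    by rewrite -EFinM lee_fin /g mulfV ?gt_eqF// le_max lexx.
  apply: (Linfty_le mg _).2; rewrite rearr_le_fin//; last exact: ltW.
  rewrite /distr (_ : level g K = set0) ?measure0//.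
  apply/seteqP; split => x //= [Ix]; have x0 : 0 <= x by move: Ix; rewrite halflineE.
  rewrite ger0_norm ?g0// => /lt_geF/negP; apply.
  rewrite le_max; apply/orP; right; move: x0; rewrite le_eqVlt => /predU1P[<-|x0].
    by rewrite /g (phi0 nphi) invr0 invr_ge0 ltW.
  by rewrite /g lef_pV2 ?posrE ?(phi_gt0 nphi)// phi0p_le.
have [_ hg] : in_space N g /\ (N g <= C%:E * cap_Linfty (Mst phi) g)%E.
  by apply: hC; split => //; apply: le_lt_trans cg (ltry _).
exists (2 * (C * K)) => [|t t0]; first by rewrite !mulr_gt0.
have pt := phi_gt0 nphi t0; have wt := w0 t0.
(* On an interval of length [2 t], which exceeds [t], [1 / phi] is at least [1 / phi (2 t)], and
   [phi (2 t) <= 2 * phi t]. *)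
have h : (((2 * phi t)^-1)%:E <= rearr g t)%E.
  apply: (@rearr_lb _ _ `]0, 2 * t[%classic) => //.
  - exact: lebesgue_itv.
  - by move=> x /=; rewrite in_itv/= halflineE => /andP[/ltW].
  - rewrite [X in (_ < X)%E](leb_itv `]0, 2 * t[)/= lte_fin ifT; last by lra.
    by rewrite -EFinD lte_fin; lra.
  - move=> x /=; rewrite in_itv/= => /andP[x0 xt]; rewrite ger0_norm ?g0 ?(ltW x0)//.
    rewrite /g lef_pV2 ?posrE ?(phi_gt0 nphi)//; last by rewrite mulr_gt0.
    apply: (@le_trans _ _ (phi (2 * t))); first by apply: (phi_le nphi); exact: ltW.
    by apply: (phi_scale nphi) => //; rewrite ler1n.
have h2 : (rearr g t * (w t)%:E <= (C * K)%:E)%E.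
  apply: le_trans (Lsup_ub w (rearr g) t0) _; apply: le_trans hg _.
  by rewrite EFinM; apply: lee_wpmul2l => //; rewrite lee_fin ltW.
have := le_trans (lee_wpmul2r _ h) h2; rewrite lee_fin (ltW wt) => /(_ isT).
rewrite -EFinM lee_fin mulrC ler_pdivrMr ?mulr_gt0// => h3; apply: le_trans h3 _.
by rewrite le_eqVlt; apply/orP; left; apply/eqP; ring.
Qed.

(** [1 / w] belongs to the Lorentz space, which lies in [L^oo] when [dphi] has an atom at 0. Hence
    [w (0+)] is positive and the atom contributes a finite amount. *)
Lemma inv_weight_bounded : 0 < phi0p phi -> exists2 K : R, 0 < K & forall t, 0 < t -> (w t)^-1 <= K.
Proof.
move=> p0; have [_ [_ [C C0 hC]] _ _] := LIw; have [_ hf] := hC _ in_space_inv_weight.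
have c0 : 0 < (phi0p phi)^-1 + 1 by rewrite addr_gt0// invr_gt0.
exists (((phi0p phi)^-1 + 1) * C) => [|t t0]; first by rewrite mulr_gt0.
have wt := w0 t0.
rewrite -lee_fin; apply: (@le_trans _ _ (rearr f 0)).
  apply: (@rearr_lb _ _ `]0, t[%classic) => //.
  - exact: lebesgue_itv.
  - by move=> x /=; rewrite in_itv/= halflineE => /andP[/ltW].
  - by rewrite [X in (_ < X)%E](leb_itv `]0, t[)/= lte_fin t0 -EFinD subr0 lte_fin.
  - move=> x /=; rewrite in_itv/= => /andP[x0 xt]; have wx := w0 x0.
    rewrite f_pos// ger0_norm; last by rewrite invr_ge0 ltW.
    by rewrite lef_pV2 ?posrE// w_le// ltW.
apply: le_trans (rearr0_le_sum p0 mf) _; rewrite EFinM; apply: lee_wpmul2l.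
  by rewrite lee_fin ltW.
apply: le_trans hf _; rewrite -[leRHS]mule1; apply: lee_wpmul2l; first by rewrite lee_fin ltW.
exact: Lsup_inv_weight.
Qed.

(** The contribution of the point 0 to the Stieltjes integral. If there is an atom, [w (0+)] is
    bounded below by [inv_weight_bounded], and [phi t / w t] is bounded below by [weight_le_phi]. *)
Lemma atom_bound : exists2 C : R, 0 <= C & forall t, 0 < t ->
  (((weight_at w 0)%:E)^-1 * (phi0p phi)%:E <= (C * (phi t / w t))%:E)%E.
Proof.
have := phi0p_ge0 nphi; rewrite le_eqVlt => /predU1P[<-|p0].
  by exists 0 => // t _; rewrite mule0 mul0r.
have [C C0 hC] := weight_le_phi p0; have [K K0 hK] := inv_weight_bounded p0.
exists (K * phi0p phi * C) => [|t t0]; first by rewrite !mulr_ge0 ?ltW.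
have wt := w0 t0; have wi : K^-1 <= weight_at w 0.
  rewrite /weight_at eqxx; apply: lb_le_inf; first by case: (winf_lb w0).
  move=> _ [y /= + <-]; rewrite in_itv/= andbT => y0; have wy := w0 y0.
  by rewrite invf_ple ?posrE ?hK.
have wi0 : 0 < weight_at w 0 by apply: lt_le_trans wi; rewrite invr_gt0.
rewrite inver gt_eqF// -EFinM lee_fin -mulrA.
apply: (@le_trans _ _ (K * phi0p phi)).
  by apply: ler_wpM2r; [exact: ltW|rewrite invf_ple ?posrE].
rewrite -mulrA; apply: ler_wpM2l; first exact: ltW.
rewrite -[leLHS]mulr1; apply: ler_wpM2l; first exact: ltW.
by rewrite mulrA ler_pdivlMr// mul1r hC.
Qed.

(** Superlevel sets of [1 / w] are intervals from 0, of endpoint [a] say. The mass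
    [phi a - phi (0+)] is bounded by [int_dens_lb] at [a / 2], where the doubling of the argument
    restores [a]. *)
Lemma stieltjes_weight_le t : 0 < t ->
  (\int[m]_(x in `]0%R, t]) (f x)%:E <=
   2%:E * \int[mu]_(x in `]0%R, t]) (f x * dens phi x)%:E)%E.
Proof.
move=> t0.
have f_le x y : 0 < x -> x <= y -> f y <= f x.
  move=> x0 xy; have y0 := lt_le_trans x0 xy.
  by rewrite !f_pos// lef_pV2 ?posrE ?w0// w_le.
have f0 x : 0 <= f x by exact: inv_weight_ge0.
have mfG : measurable_fun (`]0, t]%classic : set GR) (fun x => (f x)%:E).
  apply: measurable_antitone; first exact: interval_is_interval.
  by move=> x y; rewrite /= !in_itv/= => /andP[x0 _] _ xy; rewrite lee_fin f_le.
have sub : `]0, t]%classic `<=` I.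
  by move=> y /=; rewrite in_itv/= halflineE => /andP[/ltW].
have -> : (\int[m]_(x in `]0%R, t]) (f x)%:E = \int[m]_(x in `]0%R, t]) ((f x)%:E * cst 1%E x))%E.
  by apply: eq_integral => x _; rewrite mule1.
have -> : (\int[mu]_(x in `]0%R, t]) (f x * dens phi x)%:E =
    \int[mu]_(x in `]0%R, t]) ((f x)%:E * (dens phi x)%:E))%E.
  by apply: eq_integral => x _; rewrite EFinM.
apply: (@le_integral_layer _ _ _ _ R
  (lebesgue_stieltjes_measure (right_limit_fun phi)) mu `]0, t]%classic `]0, t]%classic
  (fun x => (f x)%:E) (cst 1%E) (fun x => (f x)%:E) (fun x => (dens phi x)%:E) 2).
- exact: measurable_itv.
- exact: mfG.
- exact: measurable_cst.
- by move=> x _; rewrite lee_fin.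
- by move=> x _.
- exact: lebesgue_itv.
- by apply/measurable_EFinP; apply: measurable_funS mI sub mf.
- exact: measurable_dens.
- by move=> x _; rewrite lee_fin.
- by move=> x _; rewrite lee_fin dens_ge0.
- by [].
move=> s _; set S := _ `&` _.
have Sdown x y : S y -> 0 < x -> x <= y -> S x.
  move=> [/=]; rewrite in_itv/= lte_fin => /andP[_ yt] sy x0 xy.
  split; first by rewrite /= in_itv/= x0 (le_trans xy).
  by rewrite /= lte_fin (lt_le_trans sy)// f_le.
have Spos x : S x -> 0 < x by move=> [/=]; rewrite in_itv/= => /andP[].
have iS : is_interval S.
  move=> x y Sx Sy z /andP[xz zy]; apply: Sdown Sy _ zy.
  exact: lt_le_trans (Spos _ Sx) xz.
have mS : measurable (S : set GR) by exact: is_interval_measurable.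
rewrite integral_cst ?mul1e//.
have [->|/set0P[z Sz]] := eqVneq S set0; first by rewrite measure0 integral_set0 mule0.
have hsS : has_sup S.
  by split; [exists z|exists t => y [/=]; rewrite in_itv/= => /andP[]].
pose a := sup S; have ub x : S x -> x <= a by move=> Sx; apply: ub_le_sup Sx; case: hsS.
have a0 : 0 < a by exact: lt_le_trans (Spos _ Sz) (ub _ Sz).
have a20 : 0 < a / 2 by rewrite divr_gt0.
(* Whether or not [S] contains its supremum [a], it contains a point beyond [a / 2], hence all of
   []0, a / 2]]. *)
have [y Sy ay] : exists2 y, S y & a / 2 < y.
  have [y [Sy]] := sup_adherent a20 hsS.
  by rewrite -/a (_ : a - a / 2 = a / 2)//; [exists y|field].
apply: (@le_trans _ _ (m `]0%R, a]%classic)).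
  apply: le_measure; rewrite ?inE; [exact: mS|exact: measurable_itv|].
  by move=> x Sx; rewrite /= in_itv/= (Spos _ Sx) ub.
rewrite (stieltjes_oo phi (ltW a0)) (right_limit_pos nphi a0).
apply: (@le_trans _ _ (2%:E * \int[mu]_(x in `]0%R, (a / 2)%R]) (dens phi x)%:E)%E).
  have := int_dens_lb nphi a20; rewrite (_ : 2 * (a / 2) = a); last by field.
  move=> /(lee_wpmul2l (_ : 0 <= 2%:E)%E); rewrite lee_fin => /(_ (ler0n _ _)).
  by rewrite -EFinM mulrA mulfV// mul1r.
apply: lee_wpmul2l => //; apply: ge0_subset_integral.
- exact: lebesgue_itv.
- exact: borel_lebesgue.
- by apply: measurable_dens => // x /Spos/ltW; rewrite halflineE.
- by move=> x _; rewrite lee_fin dens_ge0.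
- move=> x /=; rewrite in_itv/= => /andP[x0 xa]; apply: Sdown Sy x0 _.
  exact: le_trans xa (ltW ay).
Qed.

Lemma LI_necessary_sup : exists2 C : R, 0 < C & forall t, 0 < t ->
  (\int[m]_(x in `[0%R, t]) ((weight_at w x)%:E)^-1 <= (C * (phi t / w t))%:E)%E.
Proof.
have [C C0 hC] := int_dens_weight; have [K K0 hK] := atom_bound.
exists (K + 2 * C) => [|t t0]; first by rewrite ltr_wpDl// mulr_gt0.
have E : `[0, t]%classic = [set 0] `|` `]0, t]%classic.
  apply/seteqP; split => x /=; rewrite !in_itv/=.
    by move=> /andP[]; rewrite le_eqVlt => /predU1P[<- _|-> ->]; [left|right].
  by move=> [->|/andP[/ltW -> ->]//]; rewrite lexx ltW.
rewrite E ge0_integral_setU.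
- rewrite mulrDl EFinD; apply: leeD.
    rewrite (eq_integral (cst ((weight_at w 0)%:E^-1)%E)); last by move=> x; rewrite inE/= => ->.
    rewrite integral_cst; last exact: measurable_set1.
    by rewrite [X in (_ * X)%E](stieltjes_set0 phi) hK.
  have -> : (\int[m]_(x in `]0%R, t]) ((weight_at w x)%:E)^-1 =
      \int[m]_(x in `]0%R, t]) (f x)%:E)%E.
    apply: eq_integral => x; rewrite inE/= in_itv/= => /andP[x0 _].
    by rewrite weight_at_pos// inver gt_eqF ?w0// f_pos.
  apply: le_trans (stieltjes_weight_le t0) _.
  rewrite -mulrA EFinM; apply: lee_wpmul2l => //; exact: hC.
- exact: measurable_set1.
- exact: measurable_itv.
- rewrite -E; exact: measurable_inv_weight_at.
- move=> x xt; rewrite inve_ge0 lee_fin weight_at_ge0//; move: xt; rewrite -E/= in_itv/=.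
  by case/andP.
- rewrite disj_set2E; apply/eqP/seteqP; split => x //= [->].
  by rewrite in_itv/= ltxx.
Qed.

End necessity_sup.

(** * From weights positive a.e. to weights controlled pointwise *)

Section weights.
Context {R : realType}.
Variables (w : R -> R).
Local Notation I := (@halfline R).
Local Notation mu := (@leb R).
Local Notation LR := (lebesgueType R).
Implicit Types (t r s : R).
Hypothesis ww : weight w.

(* A weight is positive only almost everywhere. *)
Definition wpos x := Num.max 0 (w x).
Local Notation v := wpos.
Local Notation W := (primw v).

Let mw : lmeasurable w. Proof. by case: ww. Qed.

Lemma wpos_ge0 x : 0 <= v x. Proof. by rewrite /wpos le_max lexx. Qed.

Lemma lmeasurable_wpos : lmeasurable v.
Proof. by apply: measurable_maxr => //; exact: measurable_cst. Qed.

Let v0 := wpos_ge0.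
Let mv := lmeasurable_wpos.

Lemma wpos_ae : aeI_eq w v.
Proof.
have [_ w0 _ _] := ww; apply: aeI_mono w0 _ => x _ w0.
by rewrite /wpos (max_idPr (ltW w0)).
Qed.

Lemma eq_int_wpos (A : set R) (h : R -> \bar R) : measurable (A : set LR) -> A `<=` I ->
  measurable_fun (A : set LR) h ->
  (\int[mu]_(x in A) (h x * (w x)%:E) = \int[mu]_(x in A) (h x * (v x)%:E))%E.
Proof.
move=> mA AI mh; apply: ae_eq_integral.
- exact: mA.
- by apply: emeasurable_funM mh _; apply/measurable_EFinP; exact: (measurable_funS mI AI mw).
- by apply: emeasurable_funM mh _; apply/measurable_EFinP; exact: (measurable_funS mI AI mv).
- by apply: ae_eq_aeI => //; apply: aeI_mono wpos_ae _ => x _ ->.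
Qed.

Lemma int_wpos (A : set R) : measurable (A : set LR) -> A `<=` I ->
  (\int[mu]_(x in A) (w x)%:E = \int[mu]_(x in A) (v x)%:E)%E.
Proof.
move=> mA AI; have := @eq_int_wpos A (cst 1%E) mA AI (measurable_cst _).
by under eq_integral do rewrite mul1e; under [RHS]eq_integral do rewrite mul1e.
Qed.

Lemma primw_wpos t : (\int[mu]_(x in `[0%R, t]) (w x)%:E = W t)%E.
Proof. by apply: int_wpos; [exact: lebesgue_itv|exact: sub0I]. Qed.

Lemma wpos_fin t : (W t < +oo)%E.
Proof. by rewrite -primw_wpos; case: ww. Qed.

Lemma wpos_inf : (\int[mu]_(x in I) (v x)%:E = +oo)%E.
Proof. by rewrite -int_wpos//; [case: ww|exact: mI]. Qed.

Lemma wpos_gt0 t : 0 < t -> (0 < W t)%E.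
Proof.
move=> t0; rewrite lt_neqAle primw_ge0// andbT; apply/negP => /eqP W0.
have mvt : measurable_fun (`[0, t]%classic : set LR) (fun x => (v x)%:E).
  by apply: mve_sub => //; exact: sub0I.
have H := (ae_eq_integral_abs mu (lebesgue_itv _) mvt).1.
have {}H : ae_eq mu (`[0, t]%classic : set LR) (fun x => (v x)%:E) (cst 0%E).
  apply: H; rewrite [RHS]W0 /primw; apply: eq_integral => x _.
  by rewrite gee0_abs// lee_fin.
have [_ w0 _ _] := ww.
have vp : aeI (fun x => 0 < v x).
  by apply: aeI_mono2 w0 wpos_ae _ => x _ wx <-.
have F : aeI (fun x => `[0, t]%classic x -> (set0 : set R) x).
  move: vp H; rewrite /aeI /ae_eq => vp H.
  apply: filterS2 vp H => x h1 h2 Ix xt.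
  by have := h1 Ix; have [->] := h2 xt; rewrite ltxx.
have := leb_le_ae (lebesgue_itv `[0, t]) measurable0 (@sub0I R t) F.
by rewrite measure0 [X in (X <= _)%E](leb_itv `[0, t])/= lte_fin t0 -EFinD subr0 lee_fin leNgt t0.
Qed.

Lemma lorentzE q f : lorentz w q%:E f = Lq q v (rearr f).
Proof.
rewrite /lorentz /Lq /Phiq; congr poweR; apply: eq_int_wpos.
- exact: mI.
- by [].
- by apply: measurable_antitone_poweR; exact: antitone_rearr.
Qed.

Lemma int_tail (c : R -> R) t : 0 < t ->
  (forall x y, 0 < x -> x <= y -> c y <= c x) ->
  (\int[mu]_(x in `[t, +oo[) (w x * c x)%:E =
   \int[mu]_(x in `[t, +oo[) (v x * c x)%:E)%E.
Proof.
move=> t0 c_le.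
have E (u : R -> R) : (fun x => (u x * c x)%:E) = (fun x => (c x)%:E * (u x)%:E)%E.
  by apply/funext => x; rewrite -EFinM mulrC.
rewrite !E; apply: eq_int_wpos.
- exact: lebesgue_itv.
- by move=> x /=; rewrite in_itv/= andbT halflineE => /(lt_le_trans t0)/ltW.
- apply: measurable_antitone_leb; first exact: interval_is_interval.
  move=> x y; rewrite /= !in_itv/= !andbT => tx _ xy.
  by rewrite lee_fin c_le// (lt_le_trans t0).
Qed.

Lemma AM_doubling q : 1 <= q -> AM q w ->
  exists2 D : R, 0 < D & forall t, 0 < t -> (W (2 * t) <= D%:E * W t)%E.
Proof.
move=> q1 [B B0 hB]; have q0 : 0 < q by exact: lt_le_trans q1.
have c_le x y : 0 < x -> x <= y -> (y `^ q)^-1 <= (x `^ q)^-1.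
  move=> x0 xy; have y0 := lt_le_trans x0 xy.
  rewrite lef_pV2 ?posrE ?powR_gt0//; apply: ge0_ler_powR; rewrite ?nnegrE// ltW//.
exists (1 + 2 `^ q * B) => [|t t0]; first by rewrite addr_gt0// mulr_gt0// powR_gt0.
have t2 : t <= 2 * t by lra.
have t20 : 0 < 2 * t by rewrite mulr_gt0.
rewrite (primw_oc v0 mv (ltW t0) t2) EFinD ge0_muleDl ?lee_fin ?mulr_ge0 ?powR_ge0 ?(ltW B0)//.
rewrite mul1e; apply: leeD => //.
have sub : `]t, 2 * t]%classic `<=` I.
  by move=> x /=; rewrite in_itv/= halflineE => /andP[/(lt_trans t0)/ltW].
have subt : `[t, +oo[%classic `<=` I.
  by move=> x /=; rewrite in_itv/= andbT halflineE => /(lt_le_trans t0)/ltW.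
have mvc (A : set R) : A `<=` `]0, +oo[%classic ->
    measurable_fun (A : set LR) (fun x => (v x * (x `^ q)^-1)%:E).
  move=> A0; under eq_fun do rewrite EFinM; apply: emeasurable_funM.
    by apply: mve_sub => // x /A0; rewrite halflineE/= in_itv/= andbT; exact: ltW.
  apply: (@measurable_funS _ _ LR _ `]0, +oo[%classic); [exact: lebesgue_itv|exact: A0|].
  apply: measurable_antitone_leb; first exact: interval_is_interval.
  by move=> x y; rewrite /= !in_itv/= !andbT => x0 _ xy; rewrite lee_fin c_le.
have sub0 : `[t, +oo[%classic `<=` `]0, +oo[%classic.
  by move=> x /=; rewrite !in_itv/= !andbT; exact: lt_le_trans.
have vc0 x : (0 <= (v x * (x `^ q)^-1)%:E)%E.
  by rewrite lee_fin mulr_ge0 ?invr_ge0 ?powR_ge0.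
apply: (@le_trans _ _ (((2 * t) `^ q)%:E * \int[mu]_(x in `[t, +oo[) (v x * (x `^ q)^-1)%:E)%E).
  rewrite -ge0_integralZl.
  - apply: (@le_trans _ _ (\int[mu]_(x in `]t, (2 * t)%R])
        (((2 * t) `^ q)%:E * (v x * (x `^ q)^-1)%:E))%E).
      apply: ge0_le_integral.
      + exact: lebesgue_itv.
      + by move=> x _; rewrite lee_fin.
      + exact: mve_sub.
      + apply: measurable_funeM; apply: mvc => x /=; rewrite !in_itv/= andbT.
        by move=> /andP[/(lt_trans t0)].
      + move=> x; rewrite /= in_itv/= => /andP[tx x2]; have x0 := lt_trans t0 tx.
        rewrite -EFinM lee_fin mulrCA -[leLHS]mulr1; apply: ler_wpM2l => //.
        rewrite ler_pdivlMr ?powR_gt0// mul1r; apply: ge0_ler_powR; rewrite ?nnegrE// ltW//.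
    apply: ge0_subset_integral.
    + exact: lebesgue_itv.
    + exact: lebesgue_itv.
    + by apply: measurable_funeM; exact: mvc.
    + by move=> x _; apply: mule_ge0; rewrite // lee_fin powR_ge0.
    + by move=> x /=; rewrite !in_itv/= andbT => /andP[/ltW].
  - exact: lebesgue_itv.
  - exact: mvc.
  - by move=> x _; exact: vc0.
  - by rewrite lee_fin powR_ge0.
have := hB _ t0; rewrite int_tail// primw_wpos => h.
apply: le_trans (lee_wpmul2l _ h) _; first by rewrite lee_fin powR_ge0.
rewrite muleA -EFinM (_ : (2 * t) `^ q * (B / t `^ q) = 2 `^ q * B)//.
rewrite powRM ?(ltW t0)//; have : t `^ q != 0 by rewrite gt_eqF// powR_gt0.
by move: (t `^ q) (2 `^ q) => T Q T0; field.
Qed.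

(** A value [w t <= 0] would spread by monotonicity to all of [[0, t]], a set of positive
    measure. *)
Lemma weight_gt0 : {in I &, {homo w : s t / s <= t}} -> forall t, 0 < t -> 0 < w t.
Proof.
move=> w_le t t0; rewrite ltNge; apply/negP => wt.
have [_ w0 _ _] := ww.
have F : aeI (fun x => `[0, t]%classic x -> (set0 : set R) x).
  apply: aeI_mono w0 _ => x Ix wx /=; rewrite in_itv/= => /andP[_ xt].
  have : w x <= 0.
    apply: le_trans wt; apply: w_le => //; rewrite inE//.
    by rewrite halflineE ltW.
  by rewrite leNgt wx.
have := leb_le_ae (lebesgue_itv `[0, t]) measurable0 (@sub0I R t) F.
by rewrite measure0 [X in (X <= _)%E](leb_itv `[0, t])/= lte_fin t0 -EFinD subr0 lee_fin leNgt t0.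
Qed.

End weights.

(** * The two characterizations *)

Lemma LI_lorentz_iff (R : realType) (phi w : R -> R) :
  normalized_fundamental phi -> weight w ->
  (forall q : R, 1 <= q -> AM q w ->
     (LI (Lam phi) (Mst phi) (lorentz w q%:E) (lorentz w q%:E) <->
      exists2 B : R, 0 < B & forall t : R, 0 < t ->
        (\int[leb]_(x in `[t, +oo[) (w x / phi x `^ q)%:E <=
         (B / phi t `^ q)%:E *
         \int[leb]_(x in `[0%R, t]) (w x)%:E)%E)) /\
  ({in halfline &, {homo w : s t / s <= t}} -> A1 w ->
     (LI (Lam phi) (Mst phi) (lorentz w +oo%E) (lorentz w +oo%E) <->
      exists2 C : R, 0 < C & forall t : R, 0 < t ->
        (\int[stieltjes phi]_(x in `[0%R, t]) ((weight_at w x)%:E)^-1 <=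
         (C * (phi t / w t))%:E)%E)).
Proof.
move=> nphi ww; split => [q q1 aq|w_le a1].
- have -> : lorentz w q%:E = (fun f => Lq q (wpos w) (rearr f)).
    by apply/funext => f; exact: lorentzE.
  have v0 := @wpos_ge0 _ w; have mv := lmeasurable_wpos ww.
  have Wfin := wpos_fin ww; have Winf := wpos_inf ww; have Wpos := wpos_gt0 ww.
  have tail t : 0 < t -> (\int[leb]_(x in `[t, +oo[) (w x / phi x `^ q)%:E =
      \int[leb]_(x in `[t, +oo[) (wpos w x / phi x `^ q)%:E)%E.
    move=> t0; apply: (int_tail ww) => // x y x0 xy; have y0 := lt_le_trans x0 xy.
    by rewrite lef_pV2 ?posrE ?(phi_pow_gt0 q nphi)// (phi_pow_le q1 nphi).
  split => [H|[B B0 hB]].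
    have [B B0 hB] := LI_necessary_q q1 v0 mv Wfin nphi H.
    by exists B => // t t0; rewrite tail// (primw_wpos ww); exact: hB.
  apply: (LI_of_hardy nphi); first by apply: Lq_ri_functional => //; exact: (AM_doubling ww q1 aq).
  apply: (hardy_Lq q1 v0 mv Wfin Winf nphi B0) => t t0.
  by rewrite -tail// -(primw_wpos ww); exact: hB.
- have w0 := weight_gt0 ww w_le.
  have w_le' s t : 0 < s -> s <= t -> w s <= w t.
    move=> s0 st; apply: w_le => //; rewrite inE halflineE; first exact: ltW.
    by apply: ltW; exact: lt_le_trans st.
  split => [H|h]; first exact: (LI_necessary_sup w0 w_le' nphi H).
  have rJ := Lsup_ri_functional w0 w_le' (A1_doubling w0 w_le' a1).
  exact: (LI_of_hardy nphi rJ (hardy_Lsup w0 w_le' nphi h)).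
Qed.

Theorem proposition4 (R : realType) (X : (R -> R) -> \bar R) (w : R -> R) :
  banach_ri X -> normalized_fundamental (fundamental X) -> weight w ->
  (forall q : R, 1 <= q -> AM q w ->
     (LI (Lambda X) (Mstar X) (lorentz w q%:E) (lorentz w q%:E) <->
      exists2 B : R, 0 < B & forall t : R, 0 < t ->
        (\int[leb]_(x in `[t, +oo[) (w x / fundamental X x `^ q)%:E <=
         (B / fundamental X t `^ q)%:E *
         \int[leb]_(x in `[0%R, t]) (w x)%:E)%E)) /\
  ({in halfline &, {homo w : s t / s <= t}} -> A1 w ->
     (LI (Lambda X) (Mstar X) (lorentz w +oo%E) (lorentz w +oo%E) <->
      exists2 C : R, 0 < C & forall t : R, 0 < t ->
        (\int[stieltjes (fundamental X)]_(x in `[0%R, t]) ((weight_at w x)%:E)^-1 <=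
         (C * (fundamental X t / w t))%:E)%E)).
Proof. by move=> _; exact: LI_lorentz_iff. Qed.
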